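(* Let $\nabla_{\mathcal E}=f_*\nabla_{\mathcal L}$ be the direct image connection described in the context. Its monodromy matrices (with respect to the fundamental matrix of the context) are $$M_a=\frac12\begin{pmatrix}e^{-N_1}+e^{-N_2}&e^{-N_1}-e^{-N_2}\\ e^{-N_1}-e^{-N_2}&e^{-N_1}+e^{-N_2}\end{pmatrix},\qquad M_b=\frac12\begin{pmatrix}e^{-N_3}+e^{-N_4}&e^{-N_3}-e^{-N_4}\\ e^{-N_3}-e^{-N_4}&e^{-N_3}+e^{-N_4}\end{pmatrix},$$ $$M_{\gamma_i}=\begin{pmatrix}1&0\\0&-1\end{pmatrix}\quad(i=1,2),$$ where $N_1=\int_{a_1}\omega$, $N_2=\int_{a_2}\omega$, $N_3=\int_{b_1}\omega$, $N_4=\int_{b_2}\omega$ are the periods of $\omega$.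
   Context: Let $t,t'\in\mathbb C\setminus\{0,1\}$, $t\neq t'$. $E$: $y^2=x(x-1)(x-t)$ with point at infinity $\infty$; $C$: $y^2=(t'-\xi^2)(t'-1-\xi^2)(t'-t-\xi^2)$ (smooth projective models); $f:C\to E$, $(\xi,y)\mapsto(t'-\xi^2,y)$, of degree $2$, with branch points $p_\pm=(t',\pm y_0)$, $y_0=\sqrt{t'(t'-1)(t'-t)}$, and ramification points $\tilde p_\pm=(0,\pm y_0)$; $f^{-1}(\infty)=\{\infty_+,\infty_-\}$; $\iota:C\to C$, $(\xi,y)\mapsto(-\xi,y)$, is the Galois involution of $f$. Let $\mathcal L=\mathcal O_C(\tilde q_1+\tilde q_2-\infty_+-\infty_-)$ with $\tilde q_i=(\xi_i,y_i)\in C$, $\xi_i\ne0$, and $\nabla_{\mathcal L}=d+\omega$ the regular connection on $\mathcal L$ given in the meromorphic trivialization $1$ by $$\omega=\frac12\left(\frac{y+y_1}{\xi-\xi_1}+\frac{y+y_2}{\xi-\xi_2}\right)\frac{d\xi}{y}+\lambda_1\frac{d\xi}{y}+\lambda_2\frac{\xi\,d\xi}{y},\qquad\lambda_1,\lambda_2\in\mathbb C.$$ Then $\nabla_{\mathcal E}=f_*\nabla_{\mathcal L}$ is a logarithmic connection on $\mathcal E=f_*\mathcal L$ with poles only at $p_\pm$. Since $\omega$ has integer residues, the numbers $e^{-N_i}$ are well defined. Loops: $\pi_1(E\setminus\{p_\pm\},\infty)$ is generated by $a,b,\gamma_1,\gamma_2$ with $[a,b]\gamma_1\gamma_2=1$,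 where $\gamma_1$ (resp. $\gamma_2$) is a simple loop going once around $p_+$ (resp. $p_-$); $a_1,b_1,a_2,b_2$ are loops in $C\setminus\{\tilde p_\pm\}$ based at $\infty_+$ whose classes form a symplectic basis of $H_1(C,\mathbb Z)$ and with $f_*(a_1)=a$, $f_*(b_1)=b$, $f_*(a_2)=\gamma_1^{-1}a\gamma_1$, $f_*(b_2)=\gamma_1^{-1}b\gamma_1$. In the meromorphic basis $(1,\xi)$ of $\mathcal E$, the horizontal sections of $\nabla_{\mathcal E}$ have the fundamental matrix $$\mathbf\Phi=\frac12\begin{pmatrix}e^{-\int\omega}+e^{-\int\omega^*}&e^{-\int\omega}-e^{-\int\omega^*}\\ \frac1\xi\left(e^{-\int\omega}-e^{-\int\omega^*}\right)&\frac1\xi\left(e^{-\int\omega}+e^{-\int\omega^*}\right)\end{pmatrix},\qquad\omega^*=\iota^*\omega$$ (with constants of integration suitably chosen). The monodromy matrix $M_\gamma$ is defined by $T_\gamma(\mathbf\Phi)=\mathbf\Phi M_\gamma$, $T_\gamma$ denoting analytic continuation along $\gamma$. *)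

(* Defs.v *)
From HB Require Import structures.
From mathcomp Require Import all_boot all_order all_algebra.
From mathcomp Require Import all_classical all_reals all_analysis.
From mathcomp Require Export complex.

Set Implicit Arguments.
Unset Strict Implicit.
Unset Printing Implicit Defensive.

Import Order.TTheory GRing.Theory Num.Theory.
Import numFieldNormedType.Exports.

Local Open Scope classical_set_scope.
Local Open Scope complex_scope.
Local Open Scope ring_scope.

(* Packing R[i] as a numClosedFieldType gives it the topology of its norm. *)
Definition Cx (R : realType) : numClosedFieldType := R[i].

Definition Cexp (R : realType) (z : Cx R) : Cx R :=
  (expR (complex.Re z) * cos (complex.Im z)) +i* (expR (complex.Re z) * sin (complex.Im z)).

(* Two copies of C^2, with coordinates (x, y) and (u, v), glued along
   u = 1/x, v = y/x^k: the total space of O(k) over P^1.  [Inf v] is the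
   point (u, v) = (0, v) over x = oo. *)
Inductive surf (R : realType) (k : nat) : Type :=
  | Aff of Cx R & Cx R
  | Inf of Cx R.
Arguments Aff {R k} _ _.
Arguments Inf {R k} _.

Definition chart_aff (R : realType) (k : nat) (p : Cx R * Cx R) : surf R k :=
  Aff p.1 p.2.

Definition chart_inf (R : realType) (k : nat) (p : Cx R * Cx R) : surf R k :=
  if p.1 == 0 then Inf p.2 else Aff p.1^-1 (p.2 / p.1 ^+ k).

HB.instance Definition _ (R : realType) (k : nat) := gen_eqMixin (surf R k).
HB.instance Definition _ (R : realType) (k : nat) := gen_choiceMixin (surf R k).

Definition surf_open (R : realType) (k : nat) : set_system (surf R k) :=
  [set U | open (@chart_aff R k @^-1` U) /\ open (@chart_inf R k @^-1` U)].

Lemma surf_openT (R : realType) (k : nat) : @surf_open R k setT.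
Proof. by split; rewrite preimage_setT; exact: openT. Qed.

Lemma surf_openI (R : realType) (k : nat) : setI_closed (@surf_open R k).
Proof.
by move=> U V [U0 U1] [V0 V1]; split; rewrite preimage_setI; exact: openI.
Qed.

Lemma surf_open_bigU (R : realType) (k : nat) (I : Type)
    (f : I -> set (surf R k)) :
  (forall i, surf_open (f i)) -> surf_open (\bigcup_i f i).
Proof.
move=> fo; split; rewrite preimage_bigcup; apply: bigcup_open => i _.
- exact: (fo i).1.
- exact: (fo i).2.
Qed.

HB.instance Definition _ (R : realType) (k : nat) :=
  isOpenTopological.Build (surf R k)
    (@surf_openT R k) (@surf_openI R k) (@surf_open_bigU R k).

(* For deg F <= 2k, the closure of y^2 = F(x) is given in the chart (u, v) by
   v^2 = u^(2k) F(1/u), whose value at u = 0 is the coefficient of x^(2k).  It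
   is smooth when F is separable of degree 2k or 2k-1. *)
Definition hyperelliptic (R : realType) (k : nat) (F : {poly Cx R}) :
    set (surf R k) :=
  [set P | match P with
           | Aff x y => y ^+ 2 = F.[x]
           | Inf v => v ^+ 2 = F`_(2 * k)%N
           end].

(* The coordinate functions; x and y take the junk value 0 at infinity, and u
   the junk value 0 at x = 0. *)
Definition xco (R : realType) (k : nat) (P : surf R k) : Cx R :=
  if P is Aff x _ then x else 0.
Definition yco (R : realType) (k : nat) (P : surf R k) : Cx R :=
  if P is Aff _ y then y else 0.
Definition uco (R : realType) (k : nat) (P : surf R k) : Cx R :=
  if P is Aff x _ then x^-1 else 0.
Definition vco (R : realType) (k : nat) (P : surf R k) : Cx R :=
  match P with Aff x y => y / x ^+ k | Inf v => v end.

(* A function on surf R k restricting, up to an additive constant, to a local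
   coordinate at P of a smooth hyperelliptic curve through P. *)
Definition loc_coord (R : realType) (k : nat) (P : surf R k) :
    surf R k -> Cx R :=
  match P with
  | Aff _ y => if y == 0 then @yco R k else @xco R k
  | Inf v => if v == 0 then @vco R k else @uco R k
  end.

(* dF/dtau = l at Q along X; this is the derivative of F|X when tau is a local
   coordinate of X at Q. *)
Definition has_deriv (R : realType) (k : nat) (X : set (surf R k))
    (tau F : surf R k -> Cx R) (Q : surf R k) (l : Cx R) : Prop :=
  (F P - F Q) / (tau P - tau Q) @[P --> within X Q^'] --> l.

Definition holo_at (R : realType) (k : nat) (X : set (surf R k))
    (F : surf R k -> Cx R) (P : surf R k) : Prop :=
  \forall Q \near P, X Q -> exists l, has_deriv X (loc_coord P) F Q l.

(* The germ of F at P is meromorphic, of order at least m; the value of F at P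
   itself is irrelevant. *)
Definition ord_ge (R : realType) (k : nat) (X : set (surf R k))
    (F : surf R k -> Cx R) (m : int) (P : surf R k) : Prop :=
  exists2 G, holo_at X G P &
    \forall Q \near P^', X Q ->
      F Q = G Q * (loc_coord P Q - loc_coord P P) ^ m.

Definition meromorphic_at (R : realType) (k : nat) (X : set (surf R k))
    (F : surf R k -> Cx R) (P : surf R k) : Prop :=
  exists m : int, ord_ge X F m P.

Definition germ_eq (R : realType) (k : nat) (X : set (surf R k)) (V : Type)
    (P : surf R k) (F G : surf R k -> V) : Prop :=
  \forall Q \near P^', X Q -> F Q = G Q.

(* G is the analytic continuation along gamma (parametrized by [0, 1]), as a
   germ of meromorphic matrix at gamma 1, of the germ F at gamma 0. *)
Definition continuation (R : realType) (k n : nat) (X : set (surf R k))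
    (gamma : R -> surf R k) (F G : surf R k -> 'M[Cx R]_n) : Prop :=
  exists Phi : R -> surf R k -> 'M[Cx R]_n,
  [/\ forall s : R, 0 <= s <= 1 -> forall i j,
        meromorphic_at X (fun P => Phi s P i j) (gamma s),
      germ_eq X (gamma 0) (Phi 0) F,
      germ_eq X (gamma 1) (Phi 1) G
    & forall s : R, 0 <= s <= 1 ->
        \forall s' \near s, 0 <= s' <= 1 ->
          germ_eq X (gamma s') (Phi s') (Phi s)].

(* T_gamma(Phi) = Phi M *)
Definition monodromy (R : realType) (k n : nat) (X : set (surf R k))
    (gamma : R -> surf R k) (Phi : surf R k -> 'M[Cx R]_n) (M : 'M[Cx R]_n) :
    Prop :=
  continuation X gamma Phi (fun P => Phi P *m M).

Definition path_in (R : realType) (T : topologicalType) (A : set T) (p q : T)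
    (c : R -> T) : Prop :=
  [/\ {within `[0%R, 1%R], continuous c}, c 0 = p, c 1 = q
    & forall s : R, 0 <= s <= 1 -> A (c s)].

Definition loop_in (R : realType) (T : topologicalType) (A : set T) (p : T)
    (c : R -> T) : Prop := path_in A p p c.

(* Paths are composed from left to right. *)
Definition pcat (R : realType) (T : Type) (c d : R -> T) : R -> T :=
  fun s => if s <= 2^-1 then c (2 * s) else d (2 * s - 1).

Definition path_rev (R : realType) (T : Type) (c : R -> T) : R -> T :=
  fun s => c (1 - s).

Definition pcomm (R : realType) (T : Type) (a b : R -> T) : R -> T :=
  pcat (pcat (pcat a b) (path_rev a)) (path_rev b).

Definition ppow (R : realType) (T : Type) (p : T) (c : R -> T) (n : int) :
    R -> T :=
  match n with
  | Posz m => iter m (pcat c) (fun=> p)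
  | Negz m => iter m.+1 (pcat (path_rev c)) (fun=> p)
  end.

Definition homotopic (R : realType) (T : topologicalType) (A : set T)
    (c d : R -> T) : Prop :=
  exists H : R * R -> T,
  [/\ {within `[0%R, 1%R] `*` `[0%R, 1%R], continuous H},
      forall r s : R, 0 <= r <= 1 -> 0 <= s <= 1 -> A (H (r, s)),
      forall s : R, 0 <= s <= 1 -> H (0, s) = c s /\ H (1, s) = d s
    & forall r : R, 0 <= r <= 1 -> H (r, 0) = c 0 /\ H (r, 1) = c 1].

Definition free_homotopic (R : realType) (T : topologicalType) (A : set T)
    (c d : R -> T) : Prop :=
  exists H : R * R -> T,
  [/\ {within `[0%R, 1%R] `*` `[0%R, 1%R], continuous H},
      forall r s : R, 0 <= r <= 1 -> 0 <= s <= 1 -> A (H (r, s)),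
      forall s : R, 0 <= s <= 1 -> H (0, s) = c s /\ H (1, s) = d s
    & forall r : R, 0 <= r <= 1 -> H (r, 0) = H (r, 1)].

Inductive word_in (R : realType) (T : Type) (p : T) (S : set (R -> T)) :
    (R -> T) -> Prop :=
  | word_1 : word_in p S (fun=> p)
  | word_gen c : S c -> word_in p S c
  | word_cat c d : word_in p S c -> word_in p S d -> word_in p S (pcat c d)
  | word_inv c : word_in p S c -> word_in p S (path_rev c).

Definition pi1_generated (R : realType) (T : topologicalType) (A : set T)
    (p : T) (S : set (R -> T)) : Prop :=
  forall c, loop_in A p c -> exists2 d, word_in p S d & homotopic A c d.

(* Equality in H_1(A, Z) = pi_1(A, p)^ab, for A path-connected. *)
Inductive homologous (R : realType) (T : topologicalType) (A : set T) (p : T) :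
    (R -> T) -> (R -> T) -> Prop :=
  | hlg_homotopic c d : loop_in A p c -> loop_in A p d -> homotopic A c d ->
      homologous A p c d
  | hlg_sym c d : homologous A p c d -> homologous A p d c
  | hlg_trans c d e : homologous A p c d -> homologous A p d e ->
      homologous A p c e
  | hlg_cat c c' d d' : homologous A p c c' -> homologous A p d d' ->
      homologous A p (pcat c d) (pcat c' d')
  | hlg_comm c d : loop_in A p c -> loop_in A p d ->
      homologous A p (pcat c d) (pcat d c).

Definition H1_basis (R : realType) (T : topologicalType) (A : set T) (p : T)
    (a1 b1 a2 b2 : R -> T) : Prop :=
  forall c, loop_in A p c ->
    exists! n : int * int * int * int,
      homologous A p c
        (pcat (pcat (ppow p a1 n.1.1.1) (ppow p b1 n.1.1.2))
              (pcat (ppow p a2 n.1.2) (ppow p b2 n.2))).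

Definition polyE (R : realType) (t : Cx R) : {poly Cx R} :=
  'X * ('X - 1) * ('X - t%:P).

Definition polyC2 (R : realType) (t t' : Cx R) : {poly Cx R} :=
  (t'%:P - 'X^2) * ((t' - 1)%:P - 'X^2) * ((t' - t)%:P - 'X^2).

Definition curveE (R : realType) (t : Cx R) : set (surf R 2) :=
  @hyperelliptic R 2 (polyE t).

(* Its points at infinity are the Inf v with v^2 = -1. *)
Definition curveC (R : realType) (t t' : Cx R) : set (surf R 3) :=
  @hyperelliptic R 3 (polyC2 t t').

Definition infE (R : realType) : surf R 2 := Inf 0.

Definition coverf (R : realType) (t' : Cx R) (P : surf R 3) : surf R 2 :=
  match P with Aff x y => Aff (t' - x ^+ 2) y | Inf _ => infE R end.

(* In the chart (u, v), the involution (xi, y) |-> (-xi, y) is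
   (u, v) |-> (-u, -v). *)
Definition iotaC (R : realType) (P : surf R 3) : surf R 3 :=
  match P with Aff x y => Aff (- x) y | Inf v => Inf (- v) end.

Definition Epunct (R : realType) (t t' y0 : Cx R) : set (surf R 2) :=
  curveE t `\` [set Aff t' y0; Aff t' (- y0)].

Definition Cpunct (R : realType) (t t' y0 : Cx R) : set (surf R 3) :=
  curveC t t' `\` [set Aff 0 y0; Aff 0 (- y0)].

(* A meromorphic 1-form on C is represented by its coefficient along d xi, at
   the points where the formula makes sense. *)
Definition omega (R : realType) (q1 q2 : Cx R * Cx R) (l1 l2 : Cx R)
    (P : surf R 3) : Cx R :=
  if P is Aff x y then
    2^-1 * ((y + q1.2) / (x - q1.1) + (y + q2.2) / (x - q2.1)) / y
    + l1 / y + l2 * x / y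
  else 0.

(* The sign comes from iota^* d xi = - d xi. *)
Definition iota_pull (R : realType) (eta : surf R 3 -> Cx R) (P : surf R 3) :
    Cx R := - eta (iotaC P).

(* L = O_C(q1 + q2 - oo_+ - oo_-); its sections near P are the germs sigma of
   meromorphic functions with ord_P sigma >= - (divL at P). *)
Definition divL (R : realType) (q1 q2 : Cx R * Cx R) (vinf : Cx R)
    (P : surf R 3) : int :=
  (P == Aff q1.1 q1.2)%:Z + (P == Aff q2.1 q2.2)%:Z
  - (P == Inf vinf)%:Z - (P == Inf (- vinf))%:Z.

(* nabla_L sigma = (d + eta) sigma = c d xi at P (a point where xi is a local
   coordinate). *)
Definition nablaL (R : realType) (t t' : Cx R) (eta sigma : surf R 3 -> Cx R)
    (P : surf R 3) (c : Cx R) : Prop :=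
  has_deriv (curveC t t') (@xco R 3) sigma P (c - eta P * sigma P).

(* A section of f_* L over U is a section of L over f^-1(U): the column
   (s_0, s_1) of coordinates in the basis (1, xi) stands for
   s_0 o f + xi (s_1 o f). *)
Definition upstairs (R : realType) (t' : Cx R) (s : surf R 2 -> 'cV[Cx R]_2)
    (P : surf R 3) : Cx R :=
  s (coverf t' P) 0 0 + xco P * s (coverf t' P) 1 0.

(* nabla_E s = (c_0 + c_1 xi) dx at p, where f^* dx = - 2 xi d xi. *)
Definition nablaE (R : realType) (t t' : Cx R) (eta : surf R 3 -> Cx R)
    (s : surf R 2 -> 'cV[Cx R]_2) (p : surf R 2) (c : 'cV[Cx R]_2) : Prop :=
  forall P, curveC t t' P -> coverf t' P = p ->
    nablaL t t' eta (upstairs t' s) P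
      ((c 0 0 + xco P * c 1 0) * (- 2 * xco P)).

Definition sectionE (R : realType) (t t' vinf : Cx R) (q1 q2 : Cx R * Cx R)
    (s : surf R 2 -> 'cV[Cx R]_2) (p : surf R 2) : Prop :=
  forall P, curveC t t' P -> coverf t' P = p ->
    ord_ge (curveC t t') (upstairs t' s) (- divL q1 q2 vinf P) P.

Definition fundamental_matrix (R : realType) (t t' vinf : Cx R)
    (q1 q2 : Cx R * Cx R) (eta : surf R 3 -> Cx R)
    (Phi : surf R 2 -> 'M[Cx R]_2) (p0 : surf R 2) : Prop :=
  (forall j, sectionE t t' vinf q1 q2 (fun p => col j (Phi p)) p0) /\
  \forall p \near p0^', curveE t p ->
    Phi p \in unitmx /\
    forall j, nablaE t t' eta (fun p' => col j (Phi p')) p 0.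

(* e is a branch near P of exp(- \int eta).  It may be single-valued around P
   even when \int eta is not. *)
Definition exp_int (R : realType) (t t' : Cx R) (eta e : surf R 3 -> Cx R)
    (P : surf R 3) : Prop :=
  \forall Q \near P^', curveC t t' Q ->
    exists W : surf R 3 -> Cx R,
    \forall Q' \near Q, curveC t t' Q' ->
      has_deriv (curveC t t') (@xco R 3) W Q' (eta Q') /\
      e Q' = Cexp (- W Q').

Definition mx22 (R : realType) (a b c d : Cx R) : 'M[Cx R]_2 :=
  \matrix_(i < 2, j < 2)
    if i == 0 then (if j == 0 then a else b) else (if j == 0 then c else d).

(* A germ at oo of matrix on E; xi, e1 and e2 are read on E through the local
   inverse of f with value Inf vinf at oo. *)
Definition Phi_form (R : realType) (t t' vinf : Cx R)
    (e1 e2 : surf R 3 -> Cx R) (Phi : surf R 2 -> 'M[Cx R]_2) : Prop :=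
  \forall P \near ((Inf vinf : surf R 3)^'), curveC t t' P ->
    Phi (coverf t' P) =
      2^-1 *: mx22 (e1 P + e2 P) (e1 P - e2 P)
                   ((xco P)^-1 * (e1 P - e2 P)) ((xco P)^-1 * (e1 P + e2 P)).

(* The points of C where omega is given by its formula and xi is a local
   coordinate; y != 0 also excludes the points at infinity. *)
Definition Cgen (R : realType) (t t' : Cx R) (q1 q2 : Cx R * Cx R) :
    set (surf R 3) :=
  [set P | [/\ curveC t t' P, yco P != 0, xco P != q1.1 & xco P != q2.1]].

(* d(xi o c)/ds *)
Definition velocity (R : realType) (c : R -> surf R 3) (s : R) : Cx R :=
  derive1 (fun r : R => complex.Re (xco (c r))) s
  +i* derive1 (fun r : R => complex.Im (xco (c r))) s.

(* A closed C^1 curve (y o c is C^1 because xi is a local coordinate). *)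
Definition C1_loop (R : realType) (A : set (surf R 3)) (c : R -> surf R 3) :
    Prop :=
  [/\ forall s, A (c s), forall s, c (s + 1) = c s, continuous c
    & forall g : R -> R,
        g = (fun r => complex.Re (xco (c r))) \/ g = (fun r => complex.Im (xco (c r))) ->
        (forall s, derivable g s 1) /\ continuous (derive1 g)].

Definition path_integral (R : realType) (eta : surf R 3 -> Cx R)
    (c : R -> surf R 3) : Cx R :=
  (\int[lebesgue_measure]_(s in `[0%R, 1%R]) complex.Re (eta (c s) * velocity c s))
  +i*
  (\int[lebesgue_measure]_(s in `[0%R, 1%R]) complex.Im (eta (c s) * velocity c s)).

(* N = \int_a omega.  The loops a start at a pole of omega, so the integral is
   taken over a closed curve homotopic to a in C and avoiding the poles; N
   depends on the choice of this curve, but exp(- N) does not. *)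
Definition is_period (R : realType) (t t' : Cx R) (q1 q2 : Cx R * Cx R)
    (l1 l2 : Cx R) (a : R -> surf R 3) (N : Cx R) : Prop :=
  exists c, [/\ C1_loop (Cgen t t' q1 q2) c, free_homotopic (curveC t t') a c
    & N = path_integral (omega q1 q2 l1 l2) c].

(* Sign of the frame (c'(s), d'(r)) for the orientation given by xi. *)
Definition crossing_sign (R : realType) (c d : R -> surf R 3) (x : R * R) : R :=
  Num.sg (complex.Im ((velocity c x.1)^* * velocity d x.2)).

(* c and d are transverse, with algebraic number of crossings n. *)
Definition crossing_number (R : realType) (c d : R -> surf R 3) (n : int) :
    Prop :=
  exists l : seq (R * R),
  [/\ uniq l,
      forall x, x \in l <-> [/\ 0 <= x.1 < 1, 0 <= x.2 < 1 & c x.1 = d x.2],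
      forall x, x \in l -> crossing_sign c d x != 0
    & n%:~R = \sum_(x <- l) crossing_sign c d x].

Definition intersection_number (R : realType) (t t' : Cx R)
    (q1 q2 : Cx R * Cx R) (a b : R -> surf R 3) (n : int) : Prop :=
  exists c d, [/\ C1_loop (Cgen t t' q1 q2) c, C1_loop (Cgen t t' q1 q2) d,
    free_homotopic (curveC t t') a c, free_homotopic (curveC t t') b d
    & crossing_number c d n].

Definition symplectic_basis (R : realType) (t t' : Cx R)
    (q1 q2 : Cx R * Cx R) (p : surf R 3) (a1 b1 a2 b2 : R -> surf R 3) : Prop :=
  H1_basis (curveC t t') p a1 b1 a2 b2 /\
  let I := intersection_number t t' q1 q2 in
  [/\ I a1 b1 1 /\ I a2 b2 1, I a1 a2 0, I b1 b2 0 & I a1 b2 0 /\ I a2 b1 0].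

(* The closed disc of centre p = (x0, y0) and radius r for the coordinate x of
   E, given as the graph over |x - x0| <= r of a branch h of y. *)
Definition coord_disc (R : realType) (t : Cx R) (p : Cx R * Cx R) (r : R)
    (h : Cx R -> Cx R) : Prop :=
  [/\ 0 < r, {within [set x | `|x - p.1| <= r%:C], continuous h}, h p.1 = p.2
    & forall x, `|x - p.1| <= r%:C ->
        (polyE t).[x] != 0 /\ h x ^+ 2 = (polyE t).[x]].

(* In pi_1(A, base), g is a simple path from the base point to the boundary of
   a disc around p, followed by the boundary circle, described once in either
   direction, and by the way back. *)
Definition simple_loop_around (R : realType) (t : Cx R) (A : set (surf R 2))
    (base : surf R 2) (p : Cx R * Cx R) (g : R -> surf R 2) : Prop :=
  exists (r : R) (h : Cx R -> Cx R) (delta : R -> surf R 2) (o : bool),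
  let circle : R -> surf R 2 := fun s =>
    let x := p.1 + r%:C * Cexp (0 +i* ((-1) ^+ o * 2 * pi * s)) in
    Aff x (h x) in
  [/\ coord_disc t p r h, path_in A base (circle 0) delta,
      {in `[0%R, 1%R] &, injective delta},
      forall (s : R) x, 0 <= s < 1 -> `|x - p.1| <= r%:C -> delta s <> Aff x (h x)
    & homotopic A g (pcat (pcat delta circle) (path_rev delta))].

Record loop_system (R : realType) (t t' y0 vinf : Cx R) (q1 q2 : Cx R * Cx R)
    (a b g1 g2 : R -> surf R 2) (a1 b1 a2 b2 : R -> surf R 3) : Prop := {
  ls_downstairs : forall c, [set a; b; g1; g2] c ->
    loop_in (Epunct t t' y0) (infE R) c;
  ls_generate : pi1_generated (Epunct t t' y0) (infE R) [set a; b; g1; g2];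
  ls_relation : homotopic (Epunct t t' y0)
    (pcat (pcat (pcomm a b) g1) g2) (fun=> infE R);
  ls_g1 : simple_loop_around t (Epunct t t' y0) (infE R) (t', y0) g1;
  ls_g2 : simple_loop_around t (Epunct t t' y0) (infE R) (t', - y0) g2;
  ls_upstairs : forall c, [set a1; b1; a2; b2] c ->
    loop_in (Cpunct t t' y0) (Inf vinf) c;
  ls_symplectic : symplectic_basis t t' q1 q2 (Inf vinf) a1 b1 a2 b2;
  ls_a1 : homotopic (Epunct t t' y0) (coverf t' \o a1) a;
  ls_b1 : homotopic (Epunct t t' y0) (coverf t' \o b1) b;
  ls_a2 : homotopic (Epunct t t' y0) (coverf t' \o a2)
    (pcat (pcat (path_rev g1) a) g1);
  ls_b2 : homotopic (Epunct t t' y0) (coverf t' \o b2)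
    (pcat (pcat (path_rev g1) b) g1)
}.

(* Main.v *)
Require Import Defs.
From mathcomp Require Import all_boot all_order all_algebra.
From mathcomp Require Import all_classical all_reals all_analysis.
From mathcomp Require Import ring lra.
Import Order.TTheory GRing.Theory Num.Theory.
Import numFieldNormedType.Exports.
Set Implicit Arguments.
Unset Strict Implicit.
Unset Printing Implicit Defensive.
Local Open Scope classical_set_scope.
Local Open Scope ring_scope.

(** Near a point P of C, continuing a branch of exp(- \int omega) from P to
    nearby points multiplies it by a cocycle s P Q.  Locally
    omega = (n / (z - z0) + h) dz with n an integer, so that
    s P Q = (z - z0)^(- n) exp(- \int h) stays well defined across the poles of
    omega.  Pushed forward by f, the cocycle gives a local system over E minus the
    branch points whose fibre over p consists of the pairs (P, c) with f(P) = p
    and c the value of a branch at P.  Its transport along a loop based at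
    infinity determines the monodromy matrix: the two columns of Phi are the sum
    and the difference of the germs of the two sheets, so that a transport fixing
    the sheets and multiplying the germs by m1 and m2 acts by the matrix
    1/2 (m1 + m2, m1 - m2; m1 - m2, m1 + m2), and one exchanging the two germs
    acts by diag(1, -1).

    A lift a1 of a starting at infinity_+ gives m1 = exp(- N1).  Transport along
    the circle in gamma_1 exchanges the sheets, and applied twice it is trivial
    because the double circle lifts to a contractible loop of C.  Hence gamma_1
    exchanges (infinity_+, 1) with some (infinity_-, k), which is taken as the
    initial value of the second branch.  Conjugating a by gamma_1 then turns the
    period of a2 into m2 = exp(- N2), and gamma_2 is determined by the relation
    [a, b] gamma_1 gamma_2 = 1, in which the transport of [a, b] is trivial. *)

(** The loops are based at infinity, which is itself a pole of omega, while a period is an integral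
    over a curve that is only freely homotopic to the given loop. This forces a transport defined on
    all of C, poles included. Its fibres are acted on by nonzero scalars, which commute with
    transport, so the multiplier along a loop survives free homotopy and can be computed on a curve
    avoiding the poles. The residue of omega at P is the coefficient of P in the divisor of L. This
    is why the power [(z - z0) ^ (- n)] is single-valued, and also why the branch has exactly the
    order allowed for a section of L, so that the columns of the matrix are sections of f_* L at
    infinity. Recording the point P next to the value c makes the exchange of sheets and the
    multiplication of germs one and the same transport. The analysis rests on strict
    differentiability. It makes slopes uniform near a point, which gives local injectivity, and a
    Goursat estimate by subdivision then provides local primitives without assuming continuous
    derivatives. *)

(** * The real-valued modulus, and limits in the complex plane *)

(** The norm of [Cx R] takes its values in [Cx R]; as a real number it can be handled with the total
    order of [R]. *)
Definition mod (R : realType) (z : Cx R) : R := complex.Re `|z|.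

Lemma modE (R : realType) (z : Cx R) : `|z| = (mod z)%:C%C.
Proof. by rewrite /mod normc_def. Qed.

Lemma mod_ge0 (R : realType) (z : Cx R) : 0 <= mod z.
Proof. by rewrite -lecR -modE normr_ge0. Qed.

Lemma modD (R : realType) (z w : Cx R) : mod (z + w) <= mod z + mod w.
Proof. by rewrite -lecR rmorphD /= -!modE ler_normD. Qed.

Lemma modM (R : realType) (z w : Cx R) : mod (z * w) = mod z * mod w.
Proof. by apply: complexI; rewrite rmorphM /= -!modE normrM. Qed.

Lemma modN (R : realType) (z : Cx R) : mod (- z) = mod z.
Proof. by rewrite /mod normrN. Qed.

Lemma mod_eq0 (R : realType) (z : Cx R) : (mod z == 0) = (z == 0).
Proof. by rewrite -(normr_eq0 z) modE -(inj_eq (@complexI _)). Qed.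

Lemma mod0 (R : realType) : mod (0 : Cx R) = 0.
Proof. by apply/eqP; rewrite mod_eq0. Qed.

Lemma mod_gt0 (R : realType) (z : Cx R) : (0 < mod z) = (z != 0).
Proof. by rewrite lt_neqAle mod_ge0 andbT eq_sym mod_eq0. Qed.

Lemma mod1 (R : realType) : mod (1 : Cx R) = 1.
Proof. by rewrite /mod normr1. Qed.

Lemma modi (R : realType) : mod ('i%C : Cx R) = 1.
Proof. by rewrite /mod normc_def /= expr0n expr1n add0r sqrtr1. Qed.

Lemma modC (R : realType) (z w : Cx R) : mod (z - w) = mod (w - z).
Proof. by rewrite -modN opprB. Qed.

Lemma mod_real (R : realType) (x : R) : mod (x%:C%C : Cx R) = `|x|.
Proof. by rewrite /mod normc_def /= expr0n addr0 sqrtr_sqr. Qed.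

Lemma Re_le_mod (R : realType) (z : Cx R) : `|complex.Re z| <= mod z.
Proof. by rewrite -lecR -modE normc_ge_Re. Qed.

Lemma Im_le_mod (R : realType) (z : Cx R) : `|complex.Im z| <= mod z.
Proof.
rewrite /mod normc_def /= -sqrtr_sqr ler_wsqrtr // lerDr.
exact: sqr_ge0.
Qed.

Lemma mod_le_ReIm (R : realType) (z : Cx R) :
  mod z <= `|complex.Re z| + `|complex.Im z|.
Proof.
have {1}-> : z = (complex.Re z)%:C%C + 'i%C * (complex.Im z)%:C%C :> Cx R.
  by rewrite {1}[z]complexE.
by rewrite (le_trans (modD _ _)) // modM modi mul1r !mod_real.
Qed.

Lemma nbhs_mod (R : realType) (z : Cx R) (P : set (Cx R)) :
  nbhs z P <-> exists2 e : R, 0 < e & forall w, mod (w - z) < e -> P w.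
Proof.
split.
  move=> /nbhs_ballP[e /= e0 eP].
  (* A positive element of [Cx R] has zero imaginary part. *)
  have eE : e = (complex.Re e)%:C%C.
    by case: e e0 {eP} => a b; rewrite ltcE /= => /andP[/eqP -> _].
  exists (complex.Re e); first by rewrite -ltcR -eE.
  by move=> w we; apply: eP; rewrite /ball /= distrC modE eE ltcR.
move=> [e e0 eP]; apply/nbhs_ballP; exists (e%:C%C); first by rewrite /= ltcR.
by move=> w; rewrite /ball /= distrC modE ltcR; exact: eP.
Qed.

Lemma cvg_mod (R : realType) (T : Type) (F : set_system T) (FF : Filter F)
    (f : T -> Cx R) (l : Cx R) :
  (f x @[x --> F] --> l) <->
  forall e : R, 0 < e -> \forall x \near F, mod (f x - l) < e.
Proof.
split=> [fl e e0|fl].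
  have /fl : nbhs l [set w | mod (w - l) < e] by apply/nbhs_mod; exists e.
  by [].
move=> A /nbhs_mod[e e0 eA]; have := fl e e0.
by apply: filterS => x /eA.
Qed.

Definition tends (T : Type) (K : numFieldType) (F : set_system T) (f : T -> K)
  (l : K) : Prop := f x @[x --> F] --> l.

Section Tends.
Context (T : Type) (K : numFieldType) (F : set_system T) {FF : Filter F}.
Implicit Types (f g : T -> K) (l m : K).

Lemma tends_cst l : tends F (fun=> l) l.
Proof. exact: cvg_cst. Qed.

Lemma tendsD f g l m : tends F f l -> tends F g m ->
  tends F (fun x => f x + g x) (l + m).
Proof. exact: cvgD. Qed.

Lemma tendsN f l : tends F f l -> tends F (fun x => - f x) (- l).
Proof. exact: cvgN. Qed.

Lemma tendsB f g l m : tends F f l -> tends F g m ->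
  tends F (fun x => f x - g x) (l - m).
Proof. exact: cvgB. Qed.

Lemma tendsM f g l m : tends F f l -> tends F g m ->
  tends F (fun x => f x * g x) (l * m).
Proof. exact: cvgM. Qed.

Lemma tendsV f l : l != 0 -> tends F f l -> tends F (fun x => (f x)^-1) l^-1.
Proof. exact: cvgV. Qed.

Lemma tendsX f l n : tends F f l -> tends F (fun x => f x ^+ n) (l ^+ n).
Proof.
move=> fl; elim: n => [|n IH]; first exact: tends_cst.
rewrite exprS; have := tendsM fl IH.
by apply: cvg_trans; apply: near_eq_cvg; apply: nearW => x; rewrite exprS.
Qed.

Lemma tends_near f g l : (\forall x \near F, f x = g x) -> tends F f l -> tends F g l.
Proof. by move=> fg; apply: cvg_trans; exact: near_eq_cvg. Qed.

Lemma tends_ext f g l : f =1 g -> tends F f l -> tends F g l.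
Proof. by move=> /funext ->. Qed.

Lemma tends_neq0 f l : tends F f l -> l != 0 -> \forall x \near F, f x != 0.
Proof. by move=> fl l0; exact: (cvgr_neq0 _ fl l0). Qed.

Lemma tends_pair f g l m : tends F f l -> tends F g m ->
  (f x, g x) @[x --> F] --> ((l, m) : K * K).
Proof. by move=> fl gm; exact: (cvg_pair fl gm). Qed.

Lemma tends_comp (f : T -> K) (g : K -> K) l m :
  tends F f l -> tends (nbhs l) g m -> tends F (g \o f) m.
Proof. by move=> fl gm; exact: (cvg_comp _ _ fl gm). Qed.

End Tends.
Arguments tends_cst {T K F FF} l.
Arguments tendsD {T K F FF f g l m} _ _.
Arguments tendsB {T K F FF f g l m} _ _.
Arguments tendsM {T K F FF f g l m} _ _.
Arguments tendsN {T K F FF f l} _.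
Arguments tendsV {T K F FF f l} _ _.
Arguments tendsX {T K F FF f l} n _.
Arguments tends_near {T K F FF f g l} _ _.
Arguments tends_neq0 {T K F FF f l} _ _.
Arguments tends_pair {T K F FF f g l m} _ _.
Arguments tends_comp {T K F f g l m} _ _.

Lemma tends_id (K : numFieldType) (z : K) : tends (nbhs z) id z.
Proof. exact: cvg_id. Qed.

Arguments tends_id {K} z.

Lemma tends_filter (T : Type) (K : numFieldType) (F G : set_system T)
  (f : T -> K) l : G `=>` F -> tends F f l -> tends G f l.
Proof. by move=> GF; apply: cvg_trans; exact: cvg_app. Qed.

(** * Strict differentiability *)

(** Both points of the pair tend to [z] independently, and pairs on the diagonal are kept. *)
Definition diag (K : numFieldType) (z : K) : set_system (K * K) :=
  nbhs (z, z).

Global Instance diag_filter (K : numFieldType) (z : K) : ProperFilter (diag z).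
Proof. exact: nbhs_pfilter. Qed.

(* Strict differentiability in the form of Caratheodory; at every point of a
   neighbourhood, it amounts to holomorphy. *)
Definition sd (K : numFieldType) (f : K -> K) (z l : K) : Prop :=
  exists q : K * K -> K,
  [/\ tends (diag z) q l,
      q (z, z) = l & \forall p \near diag z, f p.1 - f p.2 = q p * (p.1 - p.2)].

Section StrictDerivative.
Context (K : numFieldType).
Implicit Types (f g : K -> K) (z l m : K).

Lemma near_diag (P : set (K * K)) z :
  (\forall p \near diag z, P p) -> \forall w \near z, P (w, z).
Proof.
by move=> H; pose proof (tends_pair (tends_id z) (tends_cst z)) as G; exact: (G _ H).
Qed.

Lemma near_fst (P : set K) z :
  (\forall w \near z, P w) -> \forall p \near diag z, P p.1.
Proof. by move=> H; exact: (@cvg_fst _ _ (nbhs z) (nbhs z) _ _ H). Qed.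

Lemma near_snd (P : set K) z :
  (\forall w \near z, P w) -> \forall p \near diag z, P p.2.
Proof. by move=> H; exact: (@cvg_snd _ _ (nbhs z) (nbhs z) _ _ H). Qed.

Lemma tends_diag q z l : tends (diag z) q l -> tends (nbhs z) (fun w => q (w, z)) l.
Proof. by move=> ql A /ql H; exact: (@near_diag (q @^-1` A)). Qed.

Lemma tends_fst f z l : tends (nbhs z) f l -> tends (diag z) (fun p => f p.1) l.
Proof. by move=> fl A /fl H; exact: (@near_fst (f @^-1` A)). Qed.

Lemma tends_snd f z l : tends (nbhs z) f l -> tends (diag z) (fun p => f p.2) l.
Proof. by move=> fl A /fl H; exact: (@near_snd (f @^-1` A)). Qed.

Lemma sd_cont f z l : sd f z l -> tends (nbhs z) f (f z).
Proof.
case=> q [/tends_diag ql qz /near_diag fq].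
pose proof (tendsD (tends_cst (f z)) (tendsM ql (tendsB (tends_id z) (tends_cst z)))) as G.
move: G; rewrite subrr mulr0 addr0; apply: tends_near; apply: filterS fq => w /= <-.
by rewrite addrC subrK.
Qed.

Lemma sd_cvg f z l : sd f z l -> tends z^' (fun w => (f w - f z) / (w - z)) l.
Proof.
case=> q [/tends_diag ql qz /near_diag fq].
have : tends z^' (fun w => q (w, z)) l.
  by apply: tends_filter ql; exact: cvg_within.
apply: tends_near; move: fq; rewrite /dnbhs /within /=.
by apply: filterS => w /= -> wz; rewrite mulfK // subr_eq0.
Qed.

Lemma sd_cst (c : K) z : sd (fun=> c) z 0.
Proof.
exists (fun=> 0); split=> //; first exact: tends_cst.
by apply: nearW => p; rewrite subrr mul0r.
Qed.

Lemma sd_id z : sd id z 1.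
Proof.
exists (fun=> 1); split=> //; first exact: tends_cst.
by apply: nearW => p; rewrite mul1r.
Qed.

Lemma sdD f g z l m : sd f z l -> sd g z m -> sd (fun w => f w + g w) z (l + m).
Proof.
move=> [q [ql qz fq]] [r [rl rz gr]]; exists (fun p => q p + r p); split.
- exact: tendsD.
- by rewrite qz rz.
- by apply: filterS2 fq gr => p; rewrite mulrDl => <- <-; ring.
Qed.

Lemma sdM f g z l m :
  sd f z l -> sd g z m -> sd (fun w => f w * g w) z (l * g z + f z * m).
Proof.
move=> fl gm; have fc := sd_cont fl; have gc := sd_cont gm.
case: fl => q [ql qz fq]; case: gm => r [rl rz gr].
exists (fun p => q p * g p.1 + f p.2 * r p); split.
- apply: tendsD; apply: tendsM => //; [exact: tends_fst|exact: tends_snd].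
- by rewrite qz rz.
- apply: filterS2 fq gr => p fq gr.
  have -> : (q p * g p.1 + f p.2 * r p) * (p.1 - p.2) =
    (q p * (p.1 - p.2)) * g p.1 + f p.2 * (r p * (p.1 - p.2)) by ring.
  by rewrite -fq -gr; ring.
Qed.

Lemma sdV f z l : f z != 0 -> sd f z l -> sd (fun w => (f w)^-1) z (- l / f z ^+ 2).
Proof.
move=> f0 fl; have fc := sd_cont fl.
case: fl => q [ql qz fq].
pose proof (tends_neq0 fc f0) as fn.
exists (fun p => - q p / (f p.1 * f p.2)); split.
- rewrite expr2; apply: tendsM; first exact: tendsN.
  apply: tendsV; first by rewrite mulf_neq0.
  by apply: tendsM; [exact: tends_fst|exact: tends_snd].
- by rewrite qz expr2.
- apply: filterS3 (near_fst fn) (near_snd fn) fq => p f1 f2 fp.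
  have -> : - q p / (f p.1 * f p.2) * (p.1 - p.2) =
     - (q p * (p.1 - p.2)) / (f p.1 * f p.2) by ring.
  by rewrite -fp; field; rewrite f1 f2.
Qed.

Lemma sdS f z l m : l = m -> sd f z l -> sd f z m. Proof. by move=> ->. Qed.

Lemma sdN f z l : sd f z l -> sd (fun w => - f w) z (- l).
Proof.
move=> [q [ql qz fq]]; exists (fun p => - q p); split.
- exact: tendsN.
- by rewrite qz.
- by apply: filterS fq => p; rewrite mulNr => <-; ring.
Qed.

Lemma sdB f g z l m : sd f z l -> sd g z m -> sd (fun w => f w - g w) z (l - m).
Proof. by move=> fl gm; apply: sdD => //; exact: sdN. Qed.

Lemma sd_comp f g z l m : sd g z m -> sd f (g z) l -> sd (fun w => f (g w)) z (l * m).
Proof.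
move=> gm; have gc := sd_cont gm; case: gm => r [rl rz gr].
move=> [q [ql qz fq]].
have gg : (g p.1, g p.2) @[p --> diag z] --> diag (g z).
  by apply: tends_pair; [exact: tends_fst|exact: tends_snd].
exists (fun p => q (g p.1, g p.2) * r p); split.
- by apply: tendsM => // A /ql /gg.
- by rewrite /= qz rz.
- have H : \forall p \near diag z, f (g p.1) - f (g p.2) = q (g p.1, g p.2) * (g p.1 - g p.2).
    exact: (gg _ fq).
  by apply: filterS2 H gr => p /= -> ->; rewrite mulrA.
Qed.

Lemma sd_near f g z l : (\forall w \near z, f w = g w) -> sd f z l -> sd g z l.
Proof.
move=> fg [q [ql qz fq]]; exists q; split=> //.
apply: filterS3 (near_fst fg) (near_snd fg) fq => p /= e1 e2.
by rewrite e1 e2.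
Qed.

Lemma sd_ext f g z l : f =1 g -> sd f z l -> sd g z l.
Proof. by move=> fg; have -> : g = f by apply/funext => w; rewrite fg. Qed.

Lemma sd_uniq f z l m : sd f z l -> sd f z m -> l = m.
Proof.
move=> /sd_cvg fl /sd_cvg fm; exact: (cvg_unique _ fl fm).
Qed.

Lemma sdX f z l n : sd f z l -> sd (fun w => f w ^+ n) z (l * f z ^+ n.-1 *+ n).
Proof.
move=> fl; elim: n => [|n IH]; first exact: sd_cst.
apply: (@sd_ext (fun w => f w * f w ^+ n)).
  by move=> w; rewrite exprS.
apply: sdS (sdM fl IH).
case: n {IH} => [|n]; first by rewrite /= mulr0n mulr0 addr0 mulr1n.
rewrite [in RHS]mulrS /= exprS mulrnAr; congr (_ + _ *+ _); ring.
Qed.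

Lemma sd_horner (p : {poly K}) z : sd (horner p) z p^`().[z].
Proof.
elim/poly_ind: p => [|p c IH].
  by rewrite deriv0 horner0; apply: sd_ext (sd_cst 0 z) => w; rewrite horner0.
rewrite derivMXaddC hornerD hornerMX.
apply: (@sd_ext (fun w => p.[w] * w + c)); first by move=> w; rewrite hornerMXaddC.
apply: sdS (sdD (sdM IH (sd_id z)) (sd_cst c z)); ring.
Qed.

(** The slope [q] is nonzero on all pairs close to [(z, z)]; a derivative at the single point [z]
    would not give this. *)
Lemma sd_inj_near f z l : sd f z l -> l != 0 ->
  \forall p \near diag z, f p.1 = f p.2 -> p.1 = p.2.
Proof.
move=> [q [ql qz fq]] l0.
pose proof (tends_neq0 ql l0) as q0.
apply: filterS2 q0 fq => p q0 e ff.
move: e; rewrite ff subrr => /esym/eqP; rewrite mulf_eq0 (negbTE q0) /= subr_eq0.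
by move/eqP.
Qed.

(** All slopes between points near [z] have norm at least [|l| / 2], hence so has any derivative at
    a nearby point. *)
Lemma sd_neq0_near f z l : sd f z l -> l != 0 ->
  \forall w \near z, forall m, sd f w m -> m != 0.
Proof.
move=> [q [ql qz fq]] l0.
pose e := `|l| / 2.
have e0 : 0 < e by rewrite divr_gt0 ?normr_gt0.
have Hq : \forall p \near diag z, e <= `|q p| /\ f p.1 - f p.2 = q p * (p.1 - p.2).
  have /cvgrPdist_lt/(_ e e0) ql' := ql.
  apply: filterS2 ql' fq => p h ->; split=> //.
  rewrite -(lerD2l `|l - q p|) -[leLHS]addrC.
  apply: le_trans (_ : `|l| <= _); last first.
    by rewrite -[X in `|X| <= _](subrK (q p)) ler_normD.
  by rewrite [leRHS](_ : _ = e + e) ?lerD2l ?ltW // /e -splitr.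
pose proof (tends_pair (tends_id z) (tends_id z)) as G.
have H2 : \forall w \near z, \forall p \near diag w,
    e <= `|q p| /\ f p.1 - f p.2 = q p * (p.1 - p.2) := G _ (near_join Hq).
apply: (filterS _ H2) => w /near_diag {}H2 m /sd_cvg fm.
apply/eqP => m0; move: fm; rewrite m0 => fm.
have /cvgrPdist_lt/(_ e e0) fe := fm.
have H3 : \forall w' \near w^', e <= `|q (w', w)| /\ f w' - f w = q (w', w) * (w' - w).
  exact: cvg_within H2.
have H4 : \forall w' \near w^', w' != w by exact: nbhs_dnbhs_neq.
have : \forall w' \near w^', False.
  apply: filterS3 fe H3 H4 => w' lt [ge eq] ww; move: lt.
  by rewrite eq mulfK ?subr_eq0 // sub0r normrN => /lt_le_trans/(_ ge); rewrite ltxx.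
by move=> /filter_ex[].
Qed.

End StrictDerivative.

(** * Subdivision of intervals and rectangles *)

(** Compactness of [[a, b]] for a property of subintervals that is stable under concatenation: the
    supremum of the points reached from [a] cannot lie before [b]. *)
Lemma cousin (R : realType) (Q : R -> R -> Prop) (a b : R) : a <= b ->
  (forall x y z, a <= x -> x <= y -> y <= z -> z <= b -> Q x y -> Q y z -> Q x z) ->
  (forall x, a <= x <= b -> exists2 e, 0 < e &
     forall u v, a <= u -> u <= x -> x <= v -> v <= b -> v - u < e -> Q u v) ->
  Q a b.
Proof.
move=> ab Qcat Qloc.
pose S := [set x | a <= x <= b /\ Q a x].
have Sa : S a.
  have [|e e0 H] := Qloc a; first by rewrite lexx.
  by split; rewrite ?lexx //; apply: H => //; rewrite subrr.
have Sb : has_sup S by split; [exists a|exists b => x [/andP[]]].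
have as_ : a <= sup S by apply: ub_le_sup => //; case: Sb.
have sb : sup S <= b by apply: ge_sup; [exists a|move=> x [/andP[]]].
have [|e e0 H] := Qloc (sup S); first by rewrite as_.
have e20 : 0 < e / 2 by rewrite divr_gt0.
have [x [/andP[ax xb] Qx] xs] := sup_adherent e20 Sb.
have xs' : x <= sup S by apply: ub_le_sup; [case: Sb|split=> //; rewrite ax].
have Qs : Q a (sup S).
  by apply: (Qcat _ x) => //; apply: H => //; lra.
have [sb'|] := ltP (sup S) b; last by move=> bs; have -> : b = sup S by lra.
pose v := Num.min b (sup S + e / 2).
have vb : v <= b by rewrite ge_min lexx.
have sv : sup S < v by rewrite lt_min sb' /=; lra.
have ve : v <= sup S + e / 2 by rewrite ge_min lexx orbT.
have Qv : Q a v.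
  by apply: (Qcat _ (sup S)) => //; [lra|apply: H => //; lra].
have : v <= sup S by apply: ub_le_sup; [case: Sb|split=> //; apply/andP; split=> //; lra].
lra.
Qed.

Lemma cousin2 (R : realType) (P : R -> R -> R -> R -> Prop) (a b c d : R) :
  a <= b -> c <= d ->
  (forall x y z u v, a <= x -> x <= y -> y <= z -> z <= b -> c <= u -> u <= v -> v <= d ->
    P x y u v -> P y z u v -> P x z u v) ->
  (forall x y u v w, a <= x -> x <= y -> y <= b -> c <= u -> u <= v -> v <= w -> w <= d ->
    P x y u v -> P x y v w -> P x y u w) ->
  (forall x y, a <= x <= b -> c <= y <= d -> exists2 e, 0 < e &
     forall u v u' v', a <= u -> u <= x -> x <= v -> v <= b ->
       c <= u' -> u' <= y -> y <= v' -> v' <= d ->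
       v - u < e -> v' - u' < e -> P u v u' v') ->
  P a b c d.
Proof.
move=> ab cd P1 P2 Ploc.
apply: (@cousin R (fun u v => P u v c d) a b ab).
  by move=> x y z ax xy yz zb; apply: P1.
move=> x axb.
(* For fixed [x], the induction in the second variable carries along the width of a strip around
   [x]; concatenation keeps the smaller of two widths. *)
apply: (@cousin R (fun u' v' => exists2 e, 0 < e & forall u v, a <= u -> u <= x -> x <= v ->
   v <= b -> v - u < e -> P u v u' v') c d cd).
  move=> x' y z cx xy yz zd [e e0 He] [f f0 Hf].
  exists (Num.min e f); first by rewrite lt_min e0.
  move=> u v au ux xv vb; rewrite lt_min => /andP[ve vf].
  apply: (P2 _ _ _ y) => //; first exact: le_trans xv.
  - exact: He.
  - exact: Hf.
move=> y cyd; have [e e0 He] := Ploc x y axb cyd.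
exists e => // u' v' cu uy yv vd ve; exists e => // u v au ux xv vb uv.
exact: He.
Qed.

(** * Paths in the complex plane: derivatives, antiderivatives, mean value inequality *)

Section RealVariable.
Context (R : realType).
Local Notation K := (Cx R).
Implicit Types (G g : R -> K) (x : R) (l : K).

Lemma ReB (z w : K) : complex.Re (z - w) = complex.Re z - complex.Re w.
Proof. by case: z w => a b [c d]. Qed.
Lemma ImB (z w : K) : complex.Im (z - w) = complex.Im z - complex.Im w.
Proof. by case: z w => a b [c d]. Qed.
Lemma ReZ (x : R) (z : K) : complex.Re (x%:C%C * z) = x * complex.Re z.
Proof. by case: z => a b /=; rewrite mul0r subr0. Qed.
Lemma ImZ (x : R) (z : K) : complex.Im (x%:C%C * z) = x * complex.Im z.
Proof. by case: z => a b /=; rewrite mul0r addr0. Qed.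

Lemma tends_Re (T : Type) (F : set_system T) {FF : Filter F} (f : T -> K) l :
  tends F f l -> tends F (fun u => complex.Re (f u)) (complex.Re l).
Proof.
move=> /cvg_mod fl; apply/cvgrPdist_lt => e e0.
have := fl e e0; apply: filterS => x; apply: le_lt_trans.
by rewrite -ReB modC Re_le_mod.
Qed.

Lemma tends_Im (T : Type) (F : set_system T) {FF : Filter F} (f : T -> K) l :
  tends F f l -> tends F (fun u => complex.Im (f u)) (complex.Im l).
Proof.
move=> /cvg_mod fl; apply/cvgrPdist_lt => e e0.
have := fl e e0; apply: filterS => x; apply: le_lt_trans.
by rewrite -ImB modC Im_le_mod.
Qed.

Lemma tends_ReIm (T : Type) (F : set_system T) {FF : Filter F} (f : T -> K) l :
  tends F (fun u => complex.Re (f u)) (complex.Re l) ->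
  tends F (fun u => complex.Im (f u)) (complex.Im l) -> tends F f l.
Proof.
move=> /cvgrPdist_lt fR /cvgrPdist_lt fI; apply/cvg_mod => e e0.
have e20 : 0 < e / 2 by rewrite divr_gt0.
apply: filterS2 (fR _ e20) (fI _ e20) => x h1 h2.
rewrite (le_lt_trans (mod_le_ReIm _)) // ReB ImB.
by rewrite distrC [X in _ + X]distrC (splitr e) ltrD.
Qed.

Definition rder G x l : Prop :=
  tends x^' (fun y => (G y - G x) / ((y - x)%:C%C : K)) l.

Lemma dnbhs_shift x (P : set R) : (\forall h \near 0^', P (h + x)) <-> \forall y \near x^', P y.
Proof.
rewrite !near_withinE !nearE; split=> /nbhs_ballP[e /= e0 H]; apply/nbhs_ballP; exists e => //= y.
  move=> xy yx; have := H (y - x); rewrite subrK subr_eq0; apply=> //.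
  by rewrite /ball /= sub0r normrN distrC.
move=> y0 yn; apply: H; last by rewrite -subr_eq0 addrK.
by move: y0; rewrite /ball /= sub0r normrN opprD addrCA subrr addr0 normrN.
Qed.

Lemma is_derive_tends (f : R -> R) x (l : R) :
  is_derive x 1 f l <-> tends x^' (fun y => (f y - f x) / (y - x)) l.
Proof.
have H (g : R -> R) A : (\forall h \near 0^', A (h^-1 *: (f (h *: 1 + x) - f x))) <->
   \forall y \near x^', A ((f y - f x) / (y - x)).
  rewrite -(dnbhs_shift x (fun y => A ((f y - f x) / (y - x)))).
  by split; apply: filterS => h; rewrite addrK /GRing.scale /= mulr1 mulrC.
split.
  move=> [df <-]; move: df => /cvg_ex[m fm] A HA; apply/(H f A).
  have e : 'D_1 f x = m by exact: cvg_lim fm.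
  by rewrite e in HA; exact: fm.
move=> fl.
have fl' : (fun h => h^-1 *: ((f \o shift x) (h *: 1) - f x)) @ 0^' --> l.
  by move=> A HA; apply/(H f A); exact: fl.
by apply: DeriveDef; [apply/cvg_ex; exists l|rewrite /derive (cvg_lim _ fl')].
Qed.

(** The complex quotient composes well with [sd]; the real and imaginary parts give access to the
    fundamental theorem of calculus and the mean value theorem. *)
Lemma rderP G x l : rder G x l <->
  is_derive x 1 (fun y => complex.Re (G y)) (complex.Re l) /\
  is_derive x 1 (fun y => complex.Im (G y)) (complex.Im l).
Proof.
have E y : (G y - G x) / ((y - x)%:C%C : K) = ((y - x)^-1)%:C%C * (G y - G x).
  by rewrite mulrC fmorphV.
have ER y : complex.Re ((G y - G x) / ((y - x)%:C%C : K)) =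
   (complex.Re (G y) - complex.Re (G x)) / (y - x).
  by rewrite E ReZ ReB mulrC.
have EI y : complex.Im ((G y - G x) / ((y - x)%:C%C : K)) =
   (complex.Im (G y) - complex.Im (G x)) / (y - x).
  by rewrite E ImZ ImB mulrC.
rewrite !is_derive_tends; split=> [H|[H1 H2]].
  split; first by apply: (tends_ext ER); exact: (tends_Re H).
  by apply: (tends_ext EI); exact: (tends_Im H).
apply: tends_ReIm; first by apply: (tends_ext (fsym ER)); exact: H1.
by apply: (tends_ext (fsym EI)); exact: H2.
Qed.

End RealVariable.

Section Antiderivative.
Context (R : realType).
Local Notation K := (Cx R).

Lemma cont_near_ub (g : R -> R) (a x : R) : continuous g -> a < x ->
  let F := fun x0 : R => \int[lebesgue_measure]_(t in `[a, x0]) g t in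
  derivable F x 1 /\ derive1 F x = g x.
Proof.
move=> gc ax.
apply: (@continuous_FTC1_closed R g a x (x + 1)) => //.
- by rewrite ltrDl.
- apply: continuous_compact_integrable; first exact: segment_compact.
  exact: continuous_subspaceT.
- exact: gc.
Qed.

Lemma antiderivative_real (g : R -> R) (a : R) : continuous g ->
  exists G : R -> R, forall x, a < x -> is_derive x 1 G (g x).
Proof.
move=> gc; exists (fun x0 : R => \int[lebesgue_measure]_(t in `[a, x0]) g t) => x ax.
have [d e] := cont_near_ub gc ax.
by apply: (DeriveDef d); rewrite -derive1E; exact: e.
Qed.

(** The primitive is the integral from [a], differentiable only to the right of [a]; the uses take
    [a] below the range of interest, so that endpoints become interior points. *)
Lemma antiderivative (g : R -> K) (a : R) :
  (forall x, tends (nbhs x) g (g x)) ->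
  exists G : R -> K, forall x, a < x -> rder G x (g x).
Proof.
move=> gc.
have [GR HR] : exists G : R -> R, forall x, a < x -> is_derive x 1 G (complex.Re (g x)).
  by apply: antiderivative_real => x; exact: (tends_Re (gc x)).
have [GI HI] : exists G : R -> R, forall x, a < x -> is_derive x 1 G (complex.Im (g x)).
  by apply: antiderivative_real => x; exact: (tends_Im (gc x)).
by exists (fun x => GR x +i* GI x)%C => x ax; apply/rderP; split; [exact: HR|exact: HI].
Qed.

(** The mean value theorem fails for complex values. It is applied to the real and imaginary parts
    separately, whence the factor 2. *)
Lemma rder_mvt_le (G g : R -> K) (a b : R) (c : K) (e : R) : a <= b ->
  (forall x, a <= x <= b -> rder G x (g x)) ->
  (forall x, a <= x <= b -> mod (g x - c) <= e) ->
  mod (G b - G a - (b - a)%:C%C * c) <= 2 * e * (b - a).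
Proof.
move=> ab dG gc.
have H (p : K -> R) : (forall z w, p (z - w) = p z - p w) ->
    (forall x z, p (x%:C%C * z) = x * p z) -> (forall z, `|p z| <= mod z) ->
    (forall x, a <= x <= b -> is_derive x 1 (fun y => p (G y)) (p (g x))) ->
    `|p (G b - G a - (b - a)%:C%C * c)| <= e * (b - a).
  move=> pB pZ pm dp.
  have dd y : y \in `]a, b[%R -> is_derive y 1 (fun y => p (G y)) (p (g y)).
    by rewrite in_itv /= => /andP[/ltW ay /ltW yb]; apply: dp; rewrite ay.
  have cc : {within `[a, b], continuous (fun y => p (G y))}.
    apply: derivable_within_continuous => y; rewrite in_itv /= => yab.
    exact: (@ex_derive _ _ _ _ _ _ _ (dp y yab)).
  have [x xab e1] := MVT_segment ab dd cc.
  have ab0 : 0 <= b - a by rewrite subr_ge0.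
  rewrite !pB pZ e1 (mulrC (p _)) -mulrBr -pB normrM (ger0_norm ab0) mulrC.
  apply: (ler_wpM2r ab0).
  by apply: (le_trans (pm _)); apply: gc; move: xab; rewrite in_itv.
apply: (le_trans (mod_le_ReIm _)).
have -> : 2 * e * (b - a) = e * (b - a) + e * (b - a) by ring.
apply: lerD; apply: H.
- exact: ReB.
- exact: ReZ.
- exact: Re_le_mod.
- by move=> x /dG/rderP[].
- exact: ImB.
- exact: ImZ.
- exact: Im_le_mod.
- by move=> x /dG/rderP[].
Qed.

Lemma rder_mvt (G g : R -> K) (a b : R) (c : K) (e : R) :
  (forall x, Num.min a b <= x <= Num.max a b -> rder G x (g x)) ->
  (forall x, Num.min a b <= x <= Num.max a b -> mod (g x - c) <= e) ->
  mod (G b - G a - (b - a)%:C%C * c) <= 2 * e * `|b - a|.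
Proof.
have [ab|/ltW ba] := leP a b => dG gc.
  by rewrite ger0_norm ?subr_ge0 //; exact: rder_mvt_le dG gc.
have := rder_mvt_le ba dG gc; rewrite -modN.
rewrite ler0_norm ?subr_le0 //; congr (mod _ <= _).
  have -> : (b - a)%:C%C = - (a - b)%:C%C :> K by rewrite -rmorphN opprB.
  by ring.
by rewrite opprB.
Qed.

Lemma rder_const (G : R -> K) (a b : R) :
  (forall x, Num.min a b <= x <= Num.max a b -> rder G x 0) -> G a = G b.
Proof.
move=> dG; have := @rder_mvt G (fun=> 0) a b 0 0 dG.
rewrite !mulr0 !subr0 mul0r => H.
apply/esym/eqP; rewrite -subr_eq0 -mod_eq0 eq_le mod_ge0 andbT; apply: H => x _.
by rewrite mod0.
Qed.

Lemma rder_near (G H : R -> K) x l : (\forall y \near x, G y = H y) ->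
  rder G x l -> rder H x l.
Proof.
move=> GH; apply: tends_near.
have e := nbhs_singleton GH.
have : \forall y \near x^', G y = H y by exact: cvg_within GH.
by apply: filterS => y ->; rewrite e.
Qed.

Lemma rderD (G H : R -> K) x l m : rder G x l -> rder H x m ->
  rder (fun y => G y + H y) x (l + m).
Proof.
move=> Gl Hm; apply: tends_ext (tendsD Gl Hm) => y /=.
by rewrite -mulrDl; congr (_ / _); ring.
Qed.

Lemma rderZ (G : R -> K) x l (c : K) : rder G x l -> rder (fun y => c * G y) x (c * l).
Proof.
move=> Gl; apply: tends_ext (tendsM (tends_cst c) Gl) => y /=.
by rewrite mulrA mulrBr.
Qed.

Lemma rder_cst (c : K) x : rder (fun=> c) x 0.
Proof. by apply: tends_ext (tends_cst 0) => y; rewrite subrr mul0r. Qed.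

Lemma rderB (G H : R -> K) x l m : rder G x l -> rder H x m ->
  rder (fun y => G y - H y) x (l - m).
Proof.
move=> Gl Hm; apply: tends_ext (tendsB Gl Hm) => y /=.
by rewrite -mulrBl; congr (_ / _); ring.
Qed.

Lemma rder_cont (G : R -> K) x l : rder G x l -> tends (nbhs x) G (G x).
Proof.
move=> /rderP[d1 d2]; apply: tends_ReIm.
  by apply: differentiable_continuous; apply/derivable1_diffP; exact: ex_derive.
by apply: differentiable_continuous; apply/derivable1_diffP; exact: ex_derive.
Qed.

Lemma rder_comp (W : K -> K) (G : R -> K) x l m :
  rder G x l -> sd W (G x) m -> rder (fun y => W (G y)) x (m * l).
Proof.
move=> Gl; have Gc := rder_cont Gl; case=> q [qm qz Wq].
have Gd : (G y, G x) @[y --> x] --> diag (G x).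
  exact: (tends_pair Gc (tends_cst (G x))).
have qG : tends (nbhs x) (fun y => q (G y, G x)) m.
  by move=> A /qm /Gd.
have H : \forall y \near x, W (G y) - W (G x) = q (G y, G x) * (G y - G x).
  exact: (Gd _ Wq).
have H' : \forall y \near x^', q (G y, G x) * ((G y - G x) / ((y - x)%:C%C : K)) =
    (W (G y) - W (G x)) / ((y - x)%:C%C : K).
  by apply: cvg_within; apply: filterS H => y ->; rewrite mulrA.
apply: tends_near H' _; apply: tendsM Gl.
by apply: tends_filter qG; exact: cvg_within.
Qed.

End Antiderivative.

(** * From partial derivatives to strict differentiability *)

Section StrictDerivativeEps.
Context (R : realType).
Local Notation K := (Cx R).

Lemma sd_eps (f : K -> K) (z l : K) :
  (forall e : R, 0 < e -> \forall p \near diag z,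
     mod (f p.1 - f p.2 - l * (p.1 - p.2)) <= e * mod (p.1 - p.2)) -> sd f z l.
Proof.
move=> H; exists (fun p => if p.1 == p.2 then l else (f p.1 - f p.2) / (p.1 - p.2)).
split; last 2 first.
- by rewrite eqxx.
- apply: filterS filterT => p _; case: eqP => [->|/eqP ne]; first by rewrite !subrr mulr0.
  by rewrite divfK // subr_eq0.
apply/cvg_mod => e e0; have e20 : 0 < e / 2 by rewrite divr_gt0.
apply: filterS (H _ e20) => p; case: eqP => [_ _|/eqP ne le]; first by rewrite subrr mod0.
have pp : p.1 - p.2 != 0 by rewrite subr_eq0.
have -> : (f p.1 - f p.2) / (p.1 - p.2) - l = (f p.1 - f p.2 - l * (p.1 - p.2)) / (p.1 - p.2).
  by field.
have m0 : 0 < mod (p.1 - p.2) by rewrite mod_gt0.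
rewrite -(ltr_pM2r m0) -modM mulfVK //; apply: (le_lt_trans le).
by rewrite ltr_pM2r //; lra.
Qed.

Lemma sd_le (f : K -> K) (z l : K) : sd f z l ->
  forall e : R, 0 < e -> \forall p \near diag z,
     mod (f p.1 - f p.2 - l * (p.1 - p.2)) <= e * mod (p.1 - p.2).
Proof.
move=> [q [/cvg_mod ql qz fq]] e e0.
apply: filterS2 (ql _ e0) fq => p pe ->.
by rewrite -mulrBl modM; apply: ler_wpM2r; [exact: mod_ge0|exact: ltW].
Qed.

Lemma diag_mod (z : K) (P : set (K * K)) :
  (\forall p \near diag z, P p) <-> exists2 e : R, 0 < e &
     forall v w, mod (v - z) < e -> mod (w - z) < e -> P (v, w).
Proof.
split.
  move=> [[A B] /= [/nbhs_mod[e e0 eA] /nbhs_mod[e' e'0 eB]] AB].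
  exists (Num.min e e'); first by rewrite lt_min e0.
  move=> v w; rewrite !lt_min => /andP[v1 _] /andP[_ w2].
  by apply: AB; split=> /=; [exact: eA|exact: eB].
move=> [e e0 eP]; exists ([set v | mod (v - z) < e], [set w | mod (w - z) < e]) => /=.
  by split; apply/nbhs_mod; exists e.
by move=> [v w] /= [h1 h2]; exact: eP.
Qed.

(** A square rather than a disc: a path with one horizontal and one vertical leg between two of its
    points stays inside. *)
Definition square (z : K) (r : R) (w : K) : Prop :=
  `|complex.Re w - complex.Re z| <= r /\ `|complex.Im w - complex.Im z| <= r.

Lemma near_square (z : K) (r : R) : 0 < r -> \forall w \near z, square z r w.
Proof.
move=> r0; apply/nbhs_mod; exists r => // w /ltW h; rewrite /square -ReB -ImB.
by split; apply: le_trans h; [exact: Re_le_mod|exact: Im_le_mod].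
Qed.

Lemma square_near (z : K) (P : set K) : (\forall w \near z, P w) ->
  exists2 r : R, 0 < r & forall w, square z r w -> P w.
Proof.
(* On this square the modulus of [w - z] is at most [2 e / 3]. *)
move=> /nbhs_mod[e e0 eP]; exists (e / 3); first by rewrite divr_gt0.
move=> w [h1 h2]; apply: eP; apply: (le_lt_trans (mod_le_ReIm _)).
rewrite ReB ImB; lra.
Qed.

Lemma between_square (z v w : K) (r x y : R) : square z r v -> square z r w ->
  Num.min (complex.Re v) (complex.Re w) <= x <= Num.max (complex.Re v) (complex.Re w) ->
  Num.min (complex.Im v) (complex.Im w) <= y <= Num.max (complex.Im v) (complex.Im w) ->
  square z r (x +i* y)%C.
Proof.
rewrite /square /= !ler_norml => -[/andP[a1 a2] /andP[a3 a4]] [/andP[b1 b2] /andP[b3 b4]].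
rewrite !ge_min !le_max => /andP[/orP h1 /orP h2] /andP[/orP h3 /orP h4].
split; apply/andP; split; lra.
Qed.

(* The Cauchy-Riemann equations with a continuous derivative. *)
Lemma sd_partial (f g : K -> K) (z : K) (r : R) : 0 < r ->
  tends (nbhs z) g (g z) ->
  (forall x y, square z r (x +i* y)%C -> rder (fun s => f (s +i* y)%C) x (g (x +i* y)%C)) ->
  (forall x y, square z r (x +i* y)%C ->
     rder (fun s => f (x +i* s)%C) y ('i%C * g (x +i* y)%C)) ->
  sd f z (g z).
Proof.
move=> r0 /cvg_mod gz fx fy; apply: sd_eps => e e0.
(* The two points are joined through the corner [x + i y']. By [rder_mvt] each leg costs [2 (e / 4)]
   times its length, and both lengths are at most the distance of the points. *)
have e40 : 0 < e / 4 by rewrite divr_gt0.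
have [d d0 dg] := square_near (gz _ e40).
pose s := Num.min r d.
have s0 : 0 < s by rewrite lt_min r0.
have sr w : square z s w -> square z r w.
  by move=> [h1 h2]; split; [apply: (le_trans h1)|apply: (le_trans h2)]; rewrite ge_min lexx.
have sdd w : square z s w -> square z d w.
  by move=> [h1 h2]; split; [apply: (le_trans h1)|apply: (le_trans h2)]; rewrite ge_min lexx orbT.
have N := near_square z s0.
apply: filterS2 (near_fst N) (near_snd N) => -[v w] /= sv sw.
case: v sv => x y sv; case: w sw => x' y' sw.
have H1 : mod (f (x +i* y')%C - f (x' +i* y')%C - (x - x')%:C%C * g z) <=
    2 * (e / 4) * `|x - x'|.
  apply: (@rder_mvt _ (fun s => f (s +i* y')%C) (fun s => g (s +i* y')%C)) => u uxx.
    apply: fx; apply: sr; apply: (between_square sw sv uxx).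
    by rewrite /= ge_min lexx le_max lexx.
  apply: ltW; apply: dg; apply: sdd; apply: (between_square sw sv uxx).
  by rewrite /= ge_min lexx le_max lexx.
have H2 : mod (f (x +i* y)%C - f (x +i* y')%C - (y - y')%:C%C * ('i%C * g z)) <=
    2 * (e / 4) * `|y - y'|.
  apply: (@rder_mvt _ (fun s => f (x +i* s)%C) (fun s => 'i%C * g (x +i* s)%C)) => u uxx.
    apply: fy; apply: sr; apply: (between_square sw sv _ uxx).
    by rewrite /= ge_min lexx le_max lexx !orbT.
  rewrite -mulrBr modM modi mul1r.
  apply: ltW; apply: dg; apply: sdd; apply: (between_square sw sv _ uxx).
  by rewrite /= ge_min lexx le_max lexx !orbT.
set D := ((x +i* y)%C - (x' +i* y')%C : K).
have ED : D = (x - x')%:C%C + 'i%C * (y - y')%:C%C.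
  by rewrite [LHS]complexE /D ReB ImB.
have -> : f (x +i* y)%C - f (x' +i* y')%C - g z * D =
  (f (x +i* y)%C - f (x +i* y')%C - (y - y')%:C%C * ('i%C * g z)) +
  (f (x +i* y')%C - f (x' +i* y')%C - (x - x')%:C%C * g z).
  by rewrite ED; ring.
apply: (le_trans (modD _ _)).
have K1 : `|x - x'| <= mod D by have := Re_le_mod D; rewrite /D ReB.
have K2 : `|y - y'| <= mod D by have := Im_le_mod D; rewrite /D ImB.
have := ler_wpM2l (ltW e0) K1; have := ler_wpM2l (ltW e0) K2; lra.
Qed.

End StrictDerivativeEps.

(** * Goursat's theorem and local primitives on a square *)

(** Composing with [clamp] extends a function on the square continuously to the whole plane, as
    [antiderivative] requires. *)
Definition clamp (R : realType) (c r x : R) : R := Num.max (c - r) (Num.min (c + r) x).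

Lemma clamp_itv (R : realType) (c r x : R) : 0 <= r -> `|clamp c r x - c| <= r.
Proof.
move=> r0; rewrite ler_norml /clamp; apply/andP; split.
  by rewrite lerBrDl le_max lexx.
by rewrite lerBlDl ge_max ge_min lexx /= andbT; lra.
Qed.

Lemma clamp_id (R : realType) (c r x : R) : `|x - c| <= r -> clamp c r x = x.
Proof.
rewrite ler_norml => /andP[h1 h2]; rewrite /clamp min_r; last by lra.
by rewrite max_r //; lra.
Qed.

Lemma clamp_cont (R : realType) (c r : R) : continuous (clamp c r).
Proof.
move=> x.
have H : {for x, continuous ((cst (c + r) : R -> R^o) \min (id : R -> R^o))}.
  by apply: continuous_min; [exact: cst_continuous|exact: cvg_id].
have : {for x, continuous ((cst (c - r) : R -> R^o) \max
    ((cst (c + r) : R -> R^o) \min (id : R -> R^o)))}.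
  by apply: continuous_max; [exact: cst_continuous|exact: H].
by [].
Qed.

Section Primitive.
Context (R : realType).
Local Notation K := (Cx R).
Context (h : K -> K) (z0 : K) (r : R) (r0 : 0 < r).
Hypothesis dh : forall w, square z0 r w -> exists l, sd h w l.

Let x0 := complex.Re z0.
Let y0 := complex.Im z0.
Let hh (x y : R) : K := h (clamp x0 r x +i* clamp y0 r y)%C.

Let hhE x y : square z0 r (x +i* y)%C -> hh x y = h (x +i* y)%C.
Proof. by move=> [h1 h2]; rewrite /hh !clamp_id. Qed.

Let hh_cont (T : topologicalType) (f g : T -> R) (p : T) :
  {for p, continuous f} -> {for p, continuous g} ->
  tends (nbhs p) (fun q => hh (f q) (g q)) (hh (f p) (g p)).
Proof.
move=> fc gc; have [l /sd_cont hl] : exists l, sd h (clamp x0 r (f p) +i* clamp y0 r (g p))%C l.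
  by apply: dh; split; apply: clamp_itv; exact: ltW.
apply: (tends_comp _ hl); apply: tends_ReIm => /=.
  by apply: (@continuous_comp _ _ _ f (clamp x0 r)); [exact: fc|exact: clamp_cont].
by apply: (@continuous_comp _ _ _ g (clamp y0 r)); [exact: gc|exact: clamp_cont].
Qed.

Let horizontal : exists G : R -> R -> K, forall y x, x0 - r - 1 < x -> rder (G y) x (hh x y).
Proof.
have H y : exists G : R -> K, forall x, x0 - r - 1 < x -> rder G x (hh x y).
  apply: antiderivative => x; apply: (@hh_cont _ id (cst y)); first exact: cvg_id.
  exact: cst_continuous.
by have [G HG] := choice H; exists G.
Qed.

Let vertical : exists V : R -> R -> K, forall x y, y0 - r - 1 < y -> rder (V x) y (hh x y).
Proof.
have H x : exists G : R -> K, forall y, y0 - r - 1 < y -> rder G y (hh x y).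
  apply: antiderivative => y; apply: (@hh_cont _ (cst x) id); last exact: cvg_id.
  exact: cst_continuous.
by have [G HG] := choice H; exists G.
Qed.

Let square_gt x y : square z0 r (x +i* y)%C -> x0 - r - 1 < x /\ y0 - r - 1 < y.
Proof.
move=> [/= h1 h2]; move: h1 h2; rewrite !ler_norml -/x0 -/y0 => /andP[h1 _] /andP[h2 _].
by split; lra.
Qed.

(* The integral of h dz along the boundary of [a, b] x [c, d], for primitives G
   and V of h in the variables x and y. *)
Let oint (G V : R -> R -> K) (a b c d : R) : K :=
  (G c b - G c a) - (G d b - G d a) + 'i%C * ((V b d - V b c) - (V a d - V a c)).

Let square_itv x y : x0 - r <= x <= x0 + r -> y0 - r <= y <= y0 + r ->
  square z0 r (x +i* y)%C.
Proof.
by move=> /andP[? ?] /andP[? ?]; split; rewrite /= ler_norml -/x0 -/y0; apply/andP; split; lra.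
Qed.

(* Strict differentiability makes the integral over a small rectangle small
   compared to its area. *)
Let oint_le (G V : R -> R -> K) (e : R) : 0 < e ->
  (forall y x, x0 - r - 1 < x -> rder (G y) x (hh x y)) ->
  (forall x y, y0 - r - 1 < y -> rder (V x) y (hh x y)) ->
  forall a b c d, x0 - r <= a -> a <= b -> b <= x0 + r ->
    y0 - r <= c -> c <= d -> d <= y0 + r ->
    mod (oint G V a b c d) <= 4 * e * ((b - a) * (d - c)).
Proof.
move=> e0 dG dV a b c d ha ab hb hc cd hd.
apply: (@cousin2 R (fun a b c d => mod (oint G V a b c d) <= 4 * e * ((b - a) * (d - c)))) => //.
- move=> x y z u v _ _ _ _ _ _ _ H1 H2.
  have -> : oint G V x z u v = oint G V x y u v + oint G V y z u v by rewrite /oint; ring.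
  by apply: (le_trans (modD _ _)); have := lerD H1 H2; lra.
- move=> x y u v w _ _ _ _ _ _ _ H1 H2.
  have -> : oint G V x y u w = oint G V x y u v + oint G V x y v w by rewrite /oint; ring.
  by apply: (le_trans (modD _ _)); have := lerD H1 H2; lra.
move=> x y /andP[ax xb] /andP[cy yd].
have sxy : square z0 r (x +i* y)%C by apply: square_itv; apply/andP; split; lra.
have [l /sd_le/(_ e e0)/diag_mod[dl dl0 Hl]] := dh sxy.
exists (dl / 2); first by rewrite divr_gt0.
move=> u v u' v' au ux xv vb cu uy yv vd vu vu'.
have near_ s t : u <= s -> s <= v -> u' <= t -> t <= v' ->
    mod ((s +i* t)%C - (x +i* y)%C : K) < dl /\ square z0 r (s +i* t)%C.
  move=> h1 h2 h3 h4; split; last by apply: square_itv; apply/andP; split; lra.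
  apply: (le_lt_trans (mod_le_ReIm _)); rewrite ReB ImB /=.
  have H1 : `|s - x| < dl / 2 by rewrite ltr_norml; apply/andP; split; lra.
  have H2 : `|t - y| < dl / 2 by rewrite ltr_norml; apply/andP; split; lra.
  lra.
have uv : u <= v by lra.
have uv' : u' <= v' by lra.
(* Strict differentiability compares opposite sides directly: the difference of [h] across the
   rectangle is [l] times the displacement, up to [e] times its length. The two linear terms cancel
   in [oint]. *)
have B1 : mod ((G u' v - G v' v) - (G u' u - G v' u) - (v - u)%:C%C * (l * - ('i%C * (v' - u')%:C%C)))
    <= 2 * (e * (v' - u')) * (v - u).
  apply: (@rder_mvt_le _ (fun s => G u' s - G v' s) (fun s => hh s u' - hh s v')) => // s /andP[us sv].
    have [_ /square_gt[sg _]] := near_ s u' us sv (lexx _) uv'.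
    by apply: rderB; apply: dG.
  have [m1 s1] := near_ s u' us sv (lexx _) uv'.
  have [m2 s2] := near_ s v' us sv uv' (lexx _).
  rewrite !hhE //; have := Hl _ _ m1 m2.
  have -> : (s +i* u')%C - (s +i* v')%C = - ('i%C * (v' - u')%:C%C) :> K.
    by rewrite [LHS]complexE ReB ImB /= subrr add0r -mulrN -rmorphN opprB.
  by rewrite modN modM modi mul1r mod_real ger0_norm // subr_ge0.
have B2 : mod ((V v v' - V u v') - (V v u' - V u u') - (v' - u')%:C%C * (l * (v - u)%:C%C))
    <= 2 * (e * (v - u)) * (v' - u').
  apply: (@rder_mvt_le _ (fun s => V v s - V u s) (fun s => hh v s - hh u s)) => // s /andP[us sv].
    have [_ /square_gt[_ sg]] := near_ u s (lexx _) uv us sv.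
    by apply: rderB; apply: dV.
  have [m1 s1] := near_ v s uv (lexx _) us sv.
  have [m2 s2] := near_ u s (lexx _) uv us sv.
  rewrite !hhE //; have := Hl _ _ m1 m2.
  have -> : (v +i* s)%C - (u +i* s)%C = (v - u)%:C%C :> K.
    by rewrite [LHS]complexE ReB ImB /= subrr mulr0 addr0.
  by rewrite mod_real ger0_norm // subr_ge0.
have -> : oint G V u v u' v' =
  ((G u' v - G v' v) - (G u' u - G v' u) - (v - u)%:C%C * (l * - ('i%C * (v' - u')%:C%C)))
  + 'i%C * ((V v v' - V u v') - (V v u' - V u u') - (v' - u')%:C%C * (l * (v - u)%:C%C)).
  by rewrite /oint; ring.
apply: (le_trans (modD _ _)); rewrite modM modi mul1r.
have := lerD B1 B2; lra.
Qed.

(** [W] integrates first horizontally, then vertically, which gives its derivative in the second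
    variable. As integrals over rectangles vanish, the other order gives the same function, hence
    the derivative in the first variable, and [sd_partial] concludes. Half the radius leaves room
    for a square around each point. *)
Lemma primitive : exists W : K -> K, W z0 = 0 /\
  forall w, square z0 (r / 2) w -> sd W w (h w).
Proof.
have [G dG] := horizontal; have [V dV] := vertical.
have oint0_le a b c d : x0 - r <= a -> a <= b -> b <= x0 + r ->
    y0 - r <= c -> c <= d -> d <= y0 + r -> oint G V a b c d = 0.
  move=> ha ab hb hc cd hd; apply/eqP; rewrite -mod_eq0 eq_le mod_ge0 andbT.
  set A := (b - a) * (d - c).
  have A0 : 0 <= A by rewrite mulr_ge0 ?subr_ge0.
  apply/ler_addgt0Pl => e e0; rewrite addr0.
  (* The denominator is [A + 1] because the rectangle may be degenerate. *)
  have e'0 : 0 < e / (4 * (A + 1)) by rewrite divr_gt0 // mulr_gt0 // ltr_wpDl.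
  apply: (le_trans (oint_le e'0 dG dV ha ab hb hc cd hd)); rewrite -/A.
  have -> : 4 * (e / (4 * (A + 1))) * A = e * (A / (A + 1)).
    by field; rewrite lt0r_neq0 // ltr_wpDl.
  rewrite -[leRHS]mulr1; apply: ler_wpM2l; first exact: ltW.
  by rewrite ler_pdivrMr ?mul1r ?ltr_wpDl // lerDl.
have oint0 a b c d : square z0 r (a +i* c)%C -> square z0 r (b +i* d)%C -> oint G V a b c d = 0.
  move=> [/= h1 h2] [/= h3 h4]; move: h1 h2 h3 h4; rewrite !ler_norml -/x0 -/y0.
  move=> /andP[a1 a2] /andP[c1 c2] /andP[b1 b2] /andP[d1 d2].
  (* Antisymmetry in each pair of endpoints reduces the four relative positions of the corners to
     one. *)
  have s1 a' b' c' d' : oint G V a' b' c' d' = - oint G V b' a' c' d' by rewrite /oint; ring.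
  have s2 a' b' c' d' : oint G V a' b' c' d' = - oint G V a' b' d' c' by rewrite /oint; ring.
  case: (leP a b) => [ab|/ltW ba]; case: (leP c d) => [cd|/ltW dc].
  - by apply: oint0_le; lra.
  - by rewrite s2 oint0_le ?oppr0 //; lra.
  - by rewrite s1 oint0_le ?oppr0 //; lra.
  - by rewrite s1 s2 oint0_le ?oppr0 //; lra.
have r20 : 0 < r / 2 by rewrite divr_gt0.
have z0E : z0 = (x0 +i* y0)%C by rewrite /x0 /y0; case: (z0).
have sz0 : square z0 r z0 by split; rewrite subrr normr0 ltW.
pose W (w : K) : K := (G y0 (complex.Re w) - G y0 x0) +
  'i%C * (V (complex.Re w) (complex.Im w) - V (complex.Re w) y0).
have WE w : square z0 r w -> W w = 'i%C * (V x0 (complex.Im w) - V x0 y0) +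
   (G (complex.Im w) (complex.Re w) - G (complex.Im w) x0).
  move=> sw; apply/eqP; rewrite -subr_eq0; apply/eqP.
  rewrite -[RHS](oint0 x0 (complex.Re w) y0 (complex.Im w)); first by rewrite /W /oint; ring.
    by rewrite -z0E.
  by move: sw; case: (w).
exists W; split; first by rewrite /W -/x0 -/y0 !subrr mulr0 addr0.
move=> w sw.
have sub x y : square w (r / 2) (x +i* y)%C -> square z0 r (x +i* y)%C.
  move: sw => [a1 a2] [/= b1 b2]; split => /=.
    have := ler_normD (x - complex.Re w) (complex.Re w - complex.Re z0).
    by rewrite addrA subrK; lra.
  have := ler_normD (y - complex.Im w) (complex.Im w - complex.Im z0).
  by rewrite addrA subrK; lra.
have [l /sd_cont hw] : exists l, sd h w l.
  by apply: dh; case: sw => a1 a2; split; lra.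
have r40 : 0 < r / 4 by rewrite divr_gt0.
apply: (sd_partial r40 hw) => x y sxy.
- have s2 : \forall s \near x, square w (r / 2) (s +i* y)%C.
    apply/nbhs_ballP; exists (r / 4) => // s; rewrite /ball /= => sx.
    move: sxy => [/= a1 a2]; split => /=; last by lra.
    have := ler_normD (s - x) (x - complex.Re w).
    by rewrite addrA subrK (distrC s x); lra.
  have sxy' := sub _ _ (nbhs_singleton s2).
  apply: (@rder_near _ (fun s => 'i%C * (V x0 y - V x0 y0) + (G y s - G y x0))).
    by apply: filterS s2 => s /sub /WE ->.
  rewrite -(hhE sxy').
  rewrite -[hh x y]add0r; apply: rderD; first exact: rder_cst.
  rewrite -[hh x y]subr0; apply: rderB; last exact: rder_cst.
  by apply: dG; have [] := square_gt sxy'.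
- have sxy' : square z0 r (x +i* y)%C by apply: sub; case: sxy => /= a1 a2; split => /=; lra.
  rewrite -(hhE sxy') -[_ * _]add0r; apply: rderD; first exact: rder_cst.
  apply: rderZ; rewrite -[hh x y]subr0; apply: rderB; last exact: rder_cst.
  by apply: dV; have [] := square_gt sxy'.
Qed.

End Primitive.

(** * Local primitives at a point and the complex exponential *)

Section Exponential.
Context (R : realType).
Local Notation K := (Cx R).

Lemma local_primitive (h : K -> K) (z0 : K) :
  (\forall w \near z0, exists l, sd h w l) ->
  exists W : K -> K, W z0 = 0 /\ \forall w \near z0, sd W w (h w).
Proof.
move=> /square_near[r r0 dh].
have [W [W0 dW]] := primitive r0 dh; exists W; split=> //.
have r20 : 0 < r / 2 by rewrite divr_gt0.
by apply: filterS (near_square z0 r20); exact: dW.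
Qed.

Lemma rder_affine (z v : K) (s : R) : rder (fun s => z + s%:C%C * v) s v.
Proof.
apply: tends_near _ (tends_cst v).
have : \forall y \near s^', y != s by exact: nbhs_dnbhs_neq.
apply: filterS => y ys.
have -> : z + y%:C%C * v - (z + s%:C%C * v) = (y - s)%:C%C * v.
  by rewrite rmorphB /=; ring.
have ne : (y - s)%:C%C != 0 :> K by rewrite eq_complex /= eqxx andbT subr_eq0.
by rewrite mulrAC divff // mul1r.
Qed.

Lemma sd0_const (f : K -> K) (z : K) : (\forall w \near z, sd f w 0) ->
  \forall w \near z, f w = f z.
Proof.
move=> /nbhs_mod[e e0 df]; apply/nbhs_mod; exists e => // w wz.
pose G (s : R) : K := z + s%:C%C * (w - z).
have : f (G 0) = f (G 1).
  apply: (@rder_const _ (fun s => f (G s))) => s.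
  rewrite min_l ?max_r // => /andP[s0 s1].
  suff : rder (fun s => f (G s)) s (0 * (w - z)) by rewrite mul0r.
  have dG : rder G s (w - z) by exact: rder_affine.
  apply: (rder_comp dG).
  apply: df; rewrite /G addrC addKr modM mod_real ger0_norm //.
  by apply: le_lt_trans wz; rewrite -[leRHS]mul1r; apply: ler_wpM2r s1; exact: mod_ge0.
by rewrite /G mul0r addr0 mul1r addrC subrK => ->.
Qed.

Lemma CexpD (z w : K) : Cexp (z + w) = Cexp z * Cexp w.
Proof.
case: z w => [a b] [c d]; rewrite /Cexp /= expRD cosD sinD.
by apply/eqP; rewrite eq_complex /=; apply/andP; split; apply/eqP; ring.
Qed.

Lemma Cexp0 : Cexp (0 : K) = 1.
Proof. by rewrite /Cexp /= expR0 cos0 sin0 mulr1 mulr0. Qed.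

Lemma CexpN (z : K) : Cexp (- z) * Cexp z = 1.
Proof. by rewrite -CexpD addNr Cexp0. Qed.

Lemma Cexp_neq0 (z : K) : Cexp z != 0.
Proof.
apply/eqP => z0; have := CexpN z; rewrite z0 mulr0 => /eqP.
by rewrite eq_sym oner_eq0.
Qed.

Lemma rder_Cexp_Re (x y : R) : rder (fun s => Cexp (s +i* y)%C) x (Cexp (x +i* y)%C).
Proof.
have H : is_derive x 1 expR (expR x) by exact: is_derive_expR.
apply/rderP; rewrite /Cexp /=; split.
  by apply: is_derive_eq; rewrite /GRing.scale /= mulr0 add0r mulrC.
by apply: is_derive_eq; rewrite /GRing.scale /= mulr0 add0r mulrC.
Qed.

Lemma rder_Cexp_Im (x y : R) :
  rder (fun s => Cexp (x +i* s)%C) y ('i%C * Cexp (x +i* y)%C).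
Proof.
have Hc : is_derive y 1 (@cos R) (- sin y) by exact: is_derive_cos.
have Hs : is_derive y 1 (@sin R) (cos y) by exact: is_derive_sin.
apply/rderP; rewrite /Cexp /= !mul0r !mul1r sub0r add0r; split.
  by apply: is_derive_eq; rewrite /GRing.scale /= ?mulr0 ?addr0 ?mulrN.
by apply: is_derive_eq; rewrite /GRing.scale /= ?mulr0 ?addr0.
Qed.

Lemma Cexp_cont0 (T : Type) (F : set_system T) {FF : Filter F} (f : T -> K) z :
  tends F f z -> tends F (fun x => Cexp (f x)) (Cexp z).
Proof.
move=> fz; pose proof (tends_Re fz) as fR; pose proof (tends_Im fz) as fI.
apply: tends_ReIm => /=.
  apply: tendsM; first exact: (cvg_comp _ _ fR (@continuous_expR R _)).
  exact: (cvg_comp _ _ fI (@continuous_cos R _)).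
apply: tendsM; first exact: (cvg_comp _ _ fR (@continuous_expR R _)).
exact: (cvg_comp _ _ fI (@continuous_sin R _)).
Qed.

Lemma sd_Cexp (z : K) : sd (@Cexp R) z (Cexp z).
Proof.
apply: (@sd_partial R _ _ z 1) => //.
- exact: Cexp_cont0 (tends_id z).
- by move=> x y _; exact: rder_Cexp_Re.
- by move=> x y _; exact: rder_Cexp_Im.
Qed.

Lemma Cexp_surj (c : K) : c != 0 -> exists z, Cexp z = c.
Proof.
move=> c0; have m0 : 0 < mod c by rewrite mod_gt0.
pose a := complex.Re c / mod c; pose b := complex.Im c / mod c.
have ab : a ^+ 2 + b ^+ 2 = 1.
  have := add_Re2_Im2 c; rewrite modE -rmorphXn => /complexI e.
  by rewrite /a /b !expr_div_n -mulrDl e divff // expf_neq0 // gt_eqF.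
have a1 : -1 <= a <= 1.
  by rewrite -ler_norml -(@ler_pXn2r _ 2) ?nnegrE // real_normK ?num_real // expr1n;
    have := sqr_ge0 b; lra.
have bE : b ^+ 2 = sin (acos a) ^+ 2.
  by have := cos2Dsin2 (acos a); rewrite acosK ?in_itv //=; lra.
have [th [ct st]] : exists th, cos th = a /\ sin th = b.
  (* The cosine determines the sine up to sign, and the sign is adjusted by negating the angle. *)
  move/eqP: bE; rewrite eqf_sqr => /orP[]/eqP bE.
    by exists (acos a); rewrite acosK ?in_itv.
  by exists (- acos a); rewrite cosN sinN acosK ?in_itv.
exists (ln (mod c) +i* th)%C; rewrite /Cexp /= lnK ?posrE // ct st.
apply/eqP; rewrite eq_complex /= /a /b.
by rewrite !(mulrCA (mod c)) divff ?lt0r_neq0 // !mulr1 !eqxx.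
Qed.

End Exponential.

(** * Local systems and their flat sections *)

(** Continuity along [D] in terms of neighbourhoods in the ambient space; the values of [H] off [D]
    are arbitrary. *)
Definition cont_on (S T : topologicalType) (D : set S) (H : S -> T) : Prop :=
  forall z, D z -> forall U, nbhs (H z) U -> \forall z' \near z, D z' -> U (H z').

Lemma within_cont_on (S T : topologicalType) (D : set S) (H : S -> T) :
  {within D, continuous H} -> cont_on D H.
Proof. by move=> /subspace_continuousP Hc z Dz U /(Hc z Dz). Qed.

Lemma cont_on_comp (S S' T : topologicalType) (D : set S) (D' : set S')
    (H : S -> T) (g : S' -> S) :
  cont_on D H -> cont_on D' g -> (forall z, D' z -> D (g z)) ->
  cont_on D' (fun z => H (g z)).
Proof.
move=> Hc gc gD z Dz U HU.
have := gc z Dz _ (Hc _ (gD z Dz) U HU).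
by apply: filterS => z' h /[dup] D'z /h; apply; exact: gD.
Qed.

Lemma continuous_cont_on (S T : topologicalType) (D : set S) (H : S -> T) :
  continuous H -> cont_on D H.
Proof. by move=> Hc z Dz U /(Hc z); apply: (@filterS _ (nbhs z) _ (fun z' => U (H z'))) => z' h _. Qed.

Definition rect (R : realType) (a b c d : R) : set (R * R) :=
  [set p | a <= p.1 <= b /\ c <= p.2 <= d].

Definition I01 (R : realType) : set R := [set s | 0 <= s <= 1].

Lemma near_lt1 (R : realType) (x : R * R) (y : R) : x.1 < y -> \forall p \near x, p.1 < y.
Proof. by move=> xy; exact: (@cvg_fst _ _ (nbhs x.1) (nbhs x.2) _ _ (lt_nbhsl xy)). Qed.
Lemma near_gt1 (R : realType) (x : R * R) (y : R) : y < x.1 -> \forall p \near x, y < p.1.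
Proof. by move=> xy; exact: (@cvg_fst _ _ (nbhs x.1) (nbhs x.2) _ _ (lt_nbhsr xy)). Qed.


Section LocalSystem.
Context (T : topologicalType) (F : Type) (A : set T) (Fib : T -> set F)
  (t : T -> T -> F -> F).

(* A locally constant sheaf of sets, given by its fibres and by the transport
   from a point to the points near it. *)
Record local_system : Prop := {
  lsys_id : forall p y, A p -> Fib p y -> t p p y = y;
  lsys_near : forall p, A p -> \forall q \near p, A q ->
    [/\ forall y, Fib p y -> Fib q (t p q y),
        forall y y', Fib p y -> Fib p y' -> t p q y = t p q y' -> y = y',
        forall y', Fib q y' -> exists2 y, Fib p y & t p q y = y'
      & \forall q' \near q, A q' -> forall y, Fib p y -> t q q' (t p q y) = t p q' y] }.

(** Horizontal sections of the pullback along [H]. The condition is local at each point, hence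
    stable under reparametrization and gluing. *)
Definition flat (S : topologicalType) (D : set S) (H : S -> T) (Y : S -> F) : Prop :=
  forall z, D z -> Fib (H z) (Y z) /\
    \forall z' \near z, D z' -> Y z' = t (H z) (H z') (Y z).

Lemma flat_comp (S S' : topologicalType) (D : set S) (D' : set S') (H : S -> T)
    (Y : S -> F) (g : S' -> S) :
  cont_on D' g -> (forall z, D' z -> D (g z)) -> flat D H Y ->
  flat D' (fun z => H (g z)) (fun z => Y (g z)).
Proof.
move=> gc gD HY z /[dup] D'z /gD Dz; have [h1 h2] := HY _ Dz; split=> //.
by apply: filterS (gc z D'z _ h2) => z' h /[dup] D'z' /h; apply; exact: gD.
Qed.

Lemma flat_eq (S : topologicalType) (D : set S) (H H' : S -> T) (Y : S -> F) :
  (forall z, D z -> H z = H' z) -> flat D H Y -> flat D H' Y.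
Proof.
move=> e HY z Dz; rewrite -e //; have [h1 h2] := HY z Dz; split=> //.
by apply: filterS h2 => z' h D'; rewrite -e //; exact: h.
Qed.

Hypothesis LS : local_system.

(** Near each point, injectivity of the transport makes equality there equivalent to equality at the
    points around it. As an equivalence the property passes through subdivisions, and it serves in
    both directions. *)
Lemma flat_unique (R : realType) (a b : R) (c : R -> T) (Y Y' : R -> F) : a <= b ->
  let D := [set s : R | a <= s <= b] in
  cont_on D c -> (forall s, D s -> A (c s)) -> flat D c Y -> flat D c Y' ->
  (Y a = Y' a <-> Y b = Y' b).
Proof.
move=> ab D cc cA fY fY'.
apply: (@cousin R (fun u v => Y u = Y' u <-> Y v = Y' v) a b ab).
  by move=> x y z _ _ _ _ -> ->.
move=> x Dx; have [fx nx] := fY x Dx; have [fx' nx'] := fY' x Dx.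
pose proof (filterI (filterI nx nx') (cc x Dx _ (lsys_near LS (cA x Dx)))) as N.
move: N => /nbhs_ballP[e /= e0 He].
have E z : a <= z <= b -> `|x - z| < e -> (Y z = Y' z <-> Y x = Y' x).
  move=> Dz xz; have [[-> //= -> //] /(_ Dz)/(_ (cA z Dz))[_ inj _ _]] := He z xz.
  by split=> [/inj|->] //; exact.
exists e => // u v au ux xv vb uve.
rewrite (E u) ?(E v) //; [by apply/andP; split; lra|rewrite ltr_norml; apply/andP; split; lra| | ].
  by apply/andP; split; lra.
by rewrite ltr_norml; apply/andP; split; lra.
Qed.

(* The two halves may be defined by a closed condition and its complement as
   soon as each is closed at the points of the other. *)
Lemma flat_glue (S : topologicalType) (D D1 D2 : set S) (b : S -> bool) (H : S -> T)
    (Y1 Y2 : S -> F) :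
  (forall z, D z -> b z -> D1 z) -> (forall z, D z -> ~~ b z -> D2 z) ->
  (forall z, D z -> b z -> ~ D2 z -> \forall z' \near z, D z' -> b z') ->
  (forall z, D z -> ~~ b z -> \forall z' \near z, D z' -> ~~ b z') ->
  (forall z, D z -> b z -> D2 z -> Y1 z = Y2 z) ->
  flat D1 H Y1 -> flat D2 H Y2 -> flat D H (fun z => if b z then Y1 z else Y2 z).
Proof.
move=> i1 i2 n1 n2 e12 f1 f2 z Dz; case: ifPn => bz.
  have [h1 h2] := f1 z (i1 z Dz bz); split=> //.
  have [D2z|D2z] := pselect (D2 z).
    have [_ h3] := f2 z D2z.
    apply: filterS2 h2 h3 => z' k1 k2 Dz'; case: ifPn => bz'.
      by apply: k1; exact: i1.
    by rewrite (e12 z) //; apply: k2; exact: i2.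
  apply: filterS2 h2 (n1 z Dz bz D2z) => z' k1 k2 Dz'.
  by rewrite k2 //; apply: k1; apply: i1 => //; exact: k2.
have [h1 h2] := f2 z (i2 z Dz bz); split=> //.
apply: filterS2 h2 (n2 z Dz bz) => z' k1 k2 Dz'.
by rewrite (negbTE (k2 Dz')); apply: k1; apply: i2 => //; exact: k2.
Qed.

(** Quantified over all initial values, so that the section on a second rectangle can start from the
    value reached on the first. *)
Let extends (R : realType) (H : R * R -> T) (a b c d : R) : Prop :=
  forall y, Fib (H (a, c)) y -> exists2 Y, flat (rect a b c d) H Y & Y (a, c) = y.

Let swap_cont (R : realType) (D : set (R * R)) : cont_on D (fun p : R * R => (p.2, p.1)).
Proof.
apply: continuous_cont_on => p.
exact: (@cvg_pair _ _ _ (nbhs p) (nbhs p.2) (nbhs p.1) _ _ _ snd fst cvg_snd cvg_fst).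
Qed.

Let extends_swap (R : realType) (H : R * R -> T) a b c d :
  extends (fun p => H (p.2, p.1)) c d a b -> extends H a b c d.
Proof.
move=> E y Fy; have [Y fY Y0] := E y Fy; exists (fun p => Y (p.2, p.1)) => //.
have f : flat (rect a b c d) (fun p => H (p.1, p.2)) (fun p => Y (p.2, p.1)).
  by apply: (@flat_comp _ _ _ _ _ _ (fun p : R * R => (p.2, p.1)) _ _ fY); [exact: swap_cont|move=> z []].
by apply: flat_eq f => -[].
Qed.

(** The two sections agree at the lower end of the common edge by choice, hence along the whole edge
    by [flat_unique]. *)
Let extends_split (R : realType) (H : R * R -> T) (x y z u v : R) :
  cont_on (rect x z u v) H -> (forall p, rect x z u v p -> A (H p)) ->
  x <= y -> y <= z -> u <= v -> extends H x y u v -> extends H y z u v -> extends H x z u v.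
Proof.
move=> Hc HA xy yz uv H1 H2 w /H1[Y1 f1 <-].
have r1 : rect x y u v (y, u) by split; rewrite /= ?lexx ?xy.
have [Y2 f2 e] := H2 _ (proj1 (f1 _ r1)).
have edge s : u <= s <= v -> Y1 (y, s) = Y2 (y, s).
  move=> /andP[us sv].
  pose D := [set r : R | u <= r <= s].
  have gc : cont_on D (fun r : R => (y, r)).
    apply: continuous_cont_on => r; apply: (@cvg_pair _ _ _ (nbhs r) (nbhs y) (nbhs r) _ _ _ (cst y) id).
      exact: cvg_cst.
    exact: cvg_id.
  have i c d : c <= y -> y <= d -> forall r, D r -> rect c d u v (y, r).
    by move=> ? ? r /= /andP[? ?]; split; apply/andP; split => /=; lra.
  have i1 := i x y xy (lexx y); have i2 := i y z (lexx y) yz; have i3 := i x z xy yz.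
  apply/(@flat_unique R u s (fun r => H (y, r)) (fun r => Y1 (y, r)) (fun r => Y2 (y, r)) us).
  + exact: (cont_on_comp Hc gc i3).
  + by move=> r /i3/HA.
  + exact: (flat_comp gc i1 f1).
  + exact: (flat_comp gc i2 f2).
  + by rewrite e.
exists (fun p => if p.1 <= y then Y1 p else Y2 p); last by rewrite /= xy.
apply: (@flat_glue _ _ (rect x y u v) (rect y z u v)) => //.
+ by move=> p [/andP[? ?] /andP[? ?]] ?; split; apply/andP; split; lra.
+ by move=> p [/andP[? ?] /andP[? ?]] ?; split; apply/andP; split; lra.
+ move=> p [/andP[p1 p2] p3] py D2.
  have py' : p.1 < y.
    rewrite lt_neqAle py andbT; apply/eqP => e'; apply: D2; split=> //.
    by rewrite e' lexx.
  by apply: filterS (near_lt1 py') => q /ltW.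
+ move=> p _; rewrite -ltNge => /near_gt1; apply: filterS => q yq _.
  by rewrite -ltNge.
+ move=> [p1 p2] [/= h1 h2] py [/= /andP[h3 h4] _].
  have -> : p1 = y by lra.
  exact: edge.
Qed.

Lemma flat_exists2 (R : realType) (H : R * R -> T) (y : F) :
  cont_on (rect 0 1 0 1) H -> (forall z : R * R, rect 0 1 0 1 z -> A (H z)) ->
  Fib (H (0, 0)) y ->
  exists2 Y, flat (rect 0 1 0 1) H Y & Y (0, 0) = y.
Proof.
move=> Hc HA; move: y.
have sub (a b c d : R) : 0 <= a -> b <= 1 -> 0 <= c -> d <= 1 ->
    forall p, rect a b c d p -> rect 0 1 0 1 p.
  by move=> ? ? ? ? p [/andP[? ?] /andP[? ?]]; split; apply/andP; split; lra.
apply: (@cousin2 R (extends H)) => //.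
- move=> x y z u v x0 xy yz z1 u0 uv v1.
  have i := sub x z u v x0 z1 u0 v1.
  apply: extends_split => // [|p /i/HA //].
  by apply: (cont_on_comp Hc _ i); apply: continuous_cont_on => p; exact: cvg_id.
- move=> x y u v w x0 xy y1 u0 uv vw w1 H1 H2; apply: extends_swap.
  have i p : rect u w x y p -> rect 0 1 0 1 (p.2, p.1).
    by move=> [p1 p2]; apply: (sub x y u w).
  apply: (@extends_split _ _ u v w x y) => //.
  + exact: (cont_on_comp Hc (@swap_cont R _) i).
  + by move=> p /i/HA.
  + by apply: extends_swap => s /H1[Y fY Y0]; exists Y => //; apply: flat_eq fY => -[].
  + by apply: extends_swap => s /H2[Y fY Y0]; exists Y => //; apply: flat_eq fY => -[].
move=> x y x01 y01.
have Dxy : rect 0 1 0 1 (x, y) by [].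
have /nbhs_ballP[e /= e0 He] := Hc _ Dxy _ (lsys_near LS (HA _ Dxy)).
exists e => // u v u' v' u0 ux xv v1 u'0 u'y yv' v'1 uve uve' w Fw.
have He' q : rect u v u' v' q -> A (H q) /\ rect 0 1 0 1 q /\
    [/\ forall y0, Fib (H (x, y)) y0 -> Fib (H q) (t (H (x, y)) (H q) y0),
        forall y1 y', Fib (H (x, y)) y1 -> Fib (H (x, y)) y' ->
          t (H (x, y)) (H q) y1 = t (H (x, y)) (H q) y' -> y1 = y',
        forall y', Fib (H q) y' -> exists2 y0, Fib (H (x, y)) y0 & t (H (x, y)) (H q) y0 = y'
      & \forall q' \near H q, A q' -> forall y0, Fib (H (x, y)) y0 ->
          t (H q) q' (t (H (x, y)) (H q) y0) = t (H (x, y)) q' y0].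
  move=> [/andP[q1 q2] /andP[q3 q4]].
  have Dq : rect 0 1 0 1 q by split; apply/andP; split; lra.
  split; first exact: HA; split=> //.
  apply: (He q) => //; last exact: HA.
  by split=> /=; rewrite /ball /= ltr_norml; apply/andP; split; lra.
have r0 : rect u v u' v' (u, u') by split; apply/andP; split => /=; lra.
(* The initial value sits at the corner while the local trivialization is centred at [(x, y)];
   surjectivity of the transport brings it back to the centre. *)
have [_ [_ [_ _ /(_ _ Fw)[w0 Fw0 <-] _]]] := He' _ r0.
exists (fun q => t (H (x, y)) (H q) w0) => // q rq.
have [Aq [Dq [h1 _ _ h4]]] := He' q rq; split; first exact: h1.
by apply: filterS (Hc q Dq _ h4) => q' h rq'; have [Aq' [Dq' _]] := He' q' rq'; rewrite h.
Qed.

End LocalSystem.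

(** * Parallel transport along paths and its invariance under homotopy *)

Section Transport.
Context (R : realType) (T : topologicalType) (F : Type) (A : set T)
  (Fib : T -> set F) (t : T -> T -> F -> F).
Hypothesis LS : local_system A Fib t.
Implicit Types (c d : R -> T) (y : F).
Local Notation I01 := (@I01 R).
Local Notation flat := (flat Fib t).

(** A relation, because existence and uniqueness of the end value hold only for continuous paths
    inside [A]. *)
Definition transport c y y' : Prop :=
  exists Y, [/\ flat I01 c Y, Y 0 = y & Y 1 = y'].

Let I010 : I01 0. Proof. by rewrite /I01 /= lexx ler01. Qed.
Let I011 : I01 1. Proof. by rewrite /I01 /= lexx ler01. Qed.

Lemma transport_fib c y y' : transport c y y' -> Fib (c 0) y /\ Fib (c 1) y'.
Proof. by move=> [Y [fY <- <-]]; split; apply: (proj1 (fY _ _)). Qed.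

Lemma transport_eq c d y y' : (forall s, I01 s -> c s = d s) ->
  transport c y y' -> transport d y y'.
Proof. by move=> e [Y [fY y0 y1]]; exists Y; split=> //; exact: flat_eq e fY. Qed.

Lemma cont_pair (S : topologicalType) (g : S -> R) (h : S -> R) :
  continuous g -> continuous h -> continuous (fun s => (g s, h s)).
Proof. by move=> gc hc s; exact: (cvg_pair (gc s) (hc s)). Qed.

(** The path is treated as a square constant in its first parameter. *)
Lemma transport_exists c y : cont_on I01 c -> (forall s, I01 s -> A (c s)) ->
  Fib (c 0) y -> exists y', transport c y y'.
Proof.
move=> cc cA y0.
have [Y fY Y0] : exists2 Y, flat (rect 0 1 0 1) (fun z => c z.2) Y & Y ((0, 0) : R * R) = y.
  apply: (flat_exists2 LS) => //; last by move=> z [_ /cA].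
  apply: (cont_on_comp cc); last by move=> z [].
  by apply: continuous_cont_on => z; exact: cvg_snd.
exists (Y (0, 1)), (fun s => Y (0, s)); split=> //.
apply: (@flat_comp _ _ _ _ _ _ _ _ _ _ (fun s : R => ((0 : R), s)) _ _ fY).
  by apply: continuous_cont_on; apply: cont_pair => s; [exact: cvg_cst|exact: cvg_id].
by move=> s Is; split=> //=; rewrite lexx ler01.
Qed.

Lemma transport_flat c Y y y' : cont_on I01 c -> (forall s, I01 s -> A (c s)) ->
  flat I01 c Y -> transport c y y' -> Y 0 = y -> Y 1 = y'.
Proof.
move=> cc cA fY [Y' [fY' <- <-]] e.
by apply/(flat_unique LS (@ler01 R) cc cA fY fY').
Qed.

Lemma transport_unique c y y' y'' : cont_on I01 c -> (forall s, I01 s -> A (c s)) ->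
  transport c y y' -> transport c y y'' -> y' = y''.
Proof.
by move=> cc cA [Y [fY y0 <-]] H; apply: (transport_flat cc cA fY H).
Qed.

Lemma I01_rev (u : R) : I01 u -> I01 (1 - u).
Proof. by rewrite /I01 /= => /andP[u0 u1]; apply/andP; split; lra. Qed.

Lemma rev_cont (X : topologicalType) (c : R -> X) : cont_on I01 c -> cont_on I01 (path_rev c).
Proof.
move=> cc; apply: (cont_on_comp cc) I01_rev.
by apply: continuous_cont_on => s; apply: cvgB; [exact: cvg_cst|exact: cvg_id].
Qed.

Lemma transport_rev c y y' : transport c y y' -> transport (path_rev c) y' y.
Proof.
move=> [Y [fY <- <-]]; exists (fun s => Y (1 - s)); split; rewrite ?subrr ?subr0 //.
apply: (@flat_comp _ _ _ _ _ _ _ _ _ _ (fun s : R => 1 - s) _ I01_rev fY).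
by apply: continuous_cont_on => s; apply: cvgB; [exact: cvg_cst|exact: cvg_id].
Qed.

Lemma affine_cont (a b : R) : continuous (fun s : R => a * s + b).
Proof.
move=> s; apply: cvgD; last exact: cvg_cst.
by apply: cvgM; [exact: cvg_cst|exact: cvg_id].
Qed.

Lemma transport_cat c d y y' y'' : c 1 = d 0 -> transport c y y' ->
  transport d y' y'' -> transport (pcat c d) y y''.
Proof.
move=> cd [Y1 [f1 <- e1]] [Y2 [f2 e2 <-]].
exists (fun s => if s <= 2^-1 then Y1 (2 * s + 0) else Y2 (2 * s + (-1))); split; last 2 first.
- by rewrite invr_ge0 ler0n mulr0 addr0.
- by rewrite ifF; [congr Y2; ring|apply/negbTE; rewrite -ltNge; lra].
have g1 : flat [set s : R | 0 <= s <= 2^-1] (pcat c d) (fun s => Y1 (2 * s + 0)).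
  apply: (@flat_eq _ _ Fib t _ [set s : R | 0 <= s <= 2^-1]
    (fun s => c (2 * s + 0)) (pcat c d) (fun s => Y1 (2 * s + 0))).
    by move=> s /= /andP[_ h]; rewrite /pcat h addr0.
  apply: (@flat_comp _ _ _ _ _ _ _ _ _ _ (fun s : R => 2 * s + 0) _ _ f1).
    exact: continuous_cont_on (@affine_cont 2 0).
  by rewrite /I01 /= => s /andP[s0 s1]; apply/andP; split; lra.
have g2 : flat [set s : R | 2^-1 <= s <= 1] (pcat c d) (fun s => Y2 (2 * s + (-1))).
  apply: (@flat_eq _ _ Fib t _ [set s : R | 2^-1 <= s <= 1]
    (fun s => d (2 * s + (-1))) (pcat c d) (fun s => Y2 (2 * s + (-1)))).
    move=> s /= /andP[h _]; rewrite /pcat; case: ifPn => // h'.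
    have -> : s = 2^-1 by lra.
    rewrite mulfV ?pnatr_eq0 // subrr.
    by rewrite cd.
  apply: (@flat_comp _ _ _ _ _ _ _ _ _ _ (fun s : R => 2 * s + (-1)) _ _ f2).
    exact: continuous_cont_on (@affine_cont 2 (-1)).
  by rewrite /I01 /= => s /andP[s0 s1]; apply/andP; split; lra.
apply: (@flat_glue _ _ _ _ _ I01 _ _ (fun s => s <= 2^-1) _ _ _ _ _ _ _ _ g1 g2).
- by rewrite /I01 /= => s /andP[s0 s1] h; apply/andP; split; lra.
- by rewrite /I01 /= => s /andP[s0 s1]; rewrite -ltNge => h; apply/andP; split; lra.
- rewrite /I01 /= => s /andP[s0 s1] h nD.
  have h' : s < 2^-1 by rewrite lt_neqAle h andbT; apply/eqP => e; apply: nD; apply/andP; split; lra.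
  by apply: filterS (lt_nbhsl h') => z /ltW.
- move=> s _; rewrite -ltNge => h.
  by apply: filterS (lt_nbhsr h) => z zh _; rewrite -ltNge.
- move=> s _ h /= /andP[h' _].
  have -> : s = 2^-1 by lra.
  by rewrite mulfV ?pnatr_eq0 // subrr addr0 e1 e2.
Qed.

Lemma edge_cont (D : set R) (r : R) : cont_on D (fun s : R => (r, s)).
Proof.
by apply: continuous_cont_on; apply: cont_pair => s; [exact: cvg_cst|exact: cvg_id].
Qed.
Lemma edge_cont' (D : set R) (r : R) : cont_on D (fun s : R => (s, r)).
Proof.
by apply: continuous_cont_on; apply: cont_pair => s; [exact: cvg_id|exact: cvg_cst].
Qed.

Lemma flat_square (H : R * R -> T) y : cont_on (rect 0 1 0 1) H ->
  (forall z, rect 0 1 0 1 z -> A (H z)) -> Fib (H (0, 0)) y ->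
  exists Y : R * R -> F, [/\ Y (0, 0) = y,
    forall r, I01 r -> flat I01 (fun s => H (r, s)) (fun s => Y (r, s)),
    forall r, I01 r -> flat I01 (fun s => H (s, r)) (fun s => Y (s, r)),
    forall r Y', I01 r -> flat I01 (fun s => H (r, s)) Y' -> (Y (r, 0) = Y' 0 <-> Y (r, 1) = Y' 1)
    & forall r Y', I01 r -> flat I01 (fun s => H (s, r)) Y' -> (Y (0, r) = Y' 0 <-> Y (1, r) = Y' 1)].
Proof.
move=> Hc HA Fy; have [Y fY Y0] := flat_exists2 LS Hc HA Fy; exists Y.
have row r : I01 r -> forall s, I01 s -> rect (0:R) 1 0 1 (r, s) by [].
have col r : I01 r -> forall s, I01 s -> rect (0:R) 1 0 1 (s, r) by [].
have frow r (Ir : I01 r) : flat I01 (fun s => H (r, s)) (fun s => Y (r, s)).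
  by apply: (@flat_comp _ _ _ _ _ _ _ _ _ _ (fun s : R => (r, s)) _ _ fY); [exact: edge_cont|exact: row].
have fcol r (Ir : I01 r) : flat I01 (fun s => H (s, r)) (fun s => Y (s, r)).
  by apply: (@flat_comp _ _ _ _ _ _ _ _ _ _ (fun s : R => (s, r)) _ _ fY); [exact: edge_cont'|exact: col].
split=> // r Y' Ir f'.
- exact: (flat_unique LS (@ler01 R) (cont_on_comp Hc (@edge_cont _ r) (row r Ir))
    (fun s Is => HA _ (row r Ir s Is)) (frow r Ir) f').
- exact: (flat_unique LS (@ler01 R) (cont_on_comp Hc (@edge_cont' _ r) (col r Ir))
    (fun s Is => HA _ (col r Ir s Is)) (fcol r Ir) f').
Qed.

Lemma flat_cst p y : A p -> Fib p y -> flat I01 (fun=> p) (fun=> y).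
Proof.
by move=> Ap Fy z _; split=> //; apply: filterS filterT => z' _ _; rewrite (lsys_id LS).
Qed.

(** A flat section over the homotopy is constant on the two sides where the endpoints stay fixed, so
    the two remaining sides give the same transport. *)
Lemma transport_homotopic c d y y' : homotopic A c d ->
  transport c y y' -> transport d y y'.
Proof.
move=> [H [/within_cont_on Hc HA Hcd Hends]] /[dup] Tc [Yc [fc ec0 ec1]].
have HA' z : rect (0:R) 1 0 1 z -> A (H z) by move=> [z1 z2]; case: z z1 z2 => r s; exact: HA.
have Fy : Fib (H (0, 0)) y by rewrite (proj1 (Hcd _ I010)); have [] := transport_fib Tc.
have [Y [Y0 frow fcol urow ucol]] := flat_square Hc HA' Fy.
have Y01 : Y (0, 1) = y'.
  rewrite -ec1; apply/(urow 0 Yc I010); last by rewrite Y0.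
  by apply: flat_eq fc => s Is; rewrite (proj1 (Hcd s Is)).
have side r p (Ir : I01 r) (e : forall s, I01 s -> H (s, r) = p) : Y (1, r) = Y (0, r).
  have f' : flat I01 (fun s => H (s, r)) (fun=> Y (0, r)).
    apply: (@flat_eq _ _ Fib t _ I01 (fun=> p)) => [s Is|]; first by rewrite e.
    rewrite -(e 0 I010); apply: flat_cst; first by apply: HA'.
    by have [] := fcol r Ir 0 I010.
  by have [-> ] := ucol r _ Ir f'.
exists (fun s => Y (1, s)); split.
- by apply: flat_eq (frow 1 I011) => s Is; rewrite (proj2 (Hcd s Is)).
- by rewrite (side 0 (c 0)) // => s Is; rewrite (proj1 (Hends s Is)).
- by rewrite (side 1 (c 1)) // => s Is; rewrite (proj2 (Hends s Is)).
Qed.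

(* The eigenvalues of the monodromy along freely homotopic loops agree. *)
Lemma transport_free_homotopic c d y (m : F -> F) :
  (forall p z, Fib p z -> Fib p (m z)) -> (forall p q z, t p q (m z) = m (t p q z)) ->
  free_homotopic A c d -> transport c y (m y) -> exists z, transport d z (m z).
Proof.
move=> mF mt [H [/within_cont_on Hc HA Hcd Hends]] /[dup] Tc [Yc [fc ec0 ec1]].
have HA' z : rect (0:R) 1 0 1 z -> A (H z) by move=> [z1 z2]; case: z z1 z2 => r s; exact: HA.
have Fy : Fib (H (0, 0)) y by rewrite (proj1 (Hcd _ I010)); have [] := transport_fib Tc.
have [Y [Y0 frow fcol urow ucol]] := flat_square Hc HA' Fy.
have Y01 : Y (0, 1) = m y.
  rewrite -ec1; apply/(urow 0 Yc I010); last by rewrite Y0.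
  by apply: flat_eq fc => s Is; rewrite (proj1 (Hcd s Is)).
exists (Y (1, 0)), (fun s => Y (1, s)); split=> //.
  by apply: flat_eq (frow 1 I011) => s Is; rewrite (proj2 (Hcd s Is)).
(* [H (s, 0)] and [H (s, 1)] are the same path of base points, so applying [m] to the section over
   the former gives a flat section over the latter. *)
have fm : flat I01 (fun s => H (s, 1)) (fun s => m (Y (s, 0))).
  apply: (@flat_eq _ _ _ _ _ _ (fun s => H (s, 0))) => [s Is|]; first exact: Hends.
  move=> s Is; have [h1 h2] := fcol 0 I010 s Is; split; first exact: mF.
  by apply: filterS h2 => z h Iz; rewrite h // mt.
by apply/(ucol 1 _ I011 fm); rewrite Y01 Y0.
Qed.

End Transport.

(** * Holomorphic functions and the implicit function theorem *)

Section Pairs.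
Context (K : numFieldType).

Lemma tends_fst2 (p : K * K) : tends (nbhs p) fst p.1.
Proof. exact: cvg_fst. Qed.
Lemma tends_snd2 (p : K * K) : tends (nbhs p) snd p.2.
Proof. exact: cvg_snd. Qed.

Lemma tends_diag_map (s : K -> K) (w : K) : tends (nbhs w) s (s w) ->
  (s p.1, s p.2) @[p --> diag w] --> diag (s w).
Proof. by move=> sc; exact: (tends_pair (tends_fst sc) (tends_snd sc)). Qed.

Lemma transition_cvg (k : nat) (p : K * K) : p.1 != 0 ->
  (fun q : K * K => (q.1^-1, q.2 / q.1 ^+ k)) @ p --> ((p.1^-1, p.2 / p.1 ^+ k) : K * K).
Proof.
move=> p0; have pk0 : p.1 ^+ k != 0 by rewrite expf_neq0.
pose proof (tendsV p0 (@tends_fst2 p)) as H1.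
pose proof (tendsM (@tends_snd2 p) (tendsV pk0 (tendsX k (@tends_fst2 p)))) as H2.
exact: (tends_pair H1 H2).
Qed.

Lemma fst_neq0_near (p : K * K) : p.1 != 0 -> \forall q \near p, q.1 != 0.
Proof. by move=> p0; pose proof (tends_neq0 (@tends_fst2 p) p0). Qed.

(** For an equation with separated variables the slope of [s] is the slope of [B] divided by that of
    [A]. *)
Lemma sd_implicit (A B : {poly K}) (s : K -> K) (w : K) :
  tends (nbhs w) s (s w) -> A^`().[s w] != 0 ->
  (\forall w' \near w, A.[s w'] = B.[w']) ->
  exists2 l, sd s w l & A^`().[s w] * l = B^`().[w].
Proof.
move=> sc A'w NSw; have ss := tends_diag_map sc.
have [qA [qA1 qA2 qA3]] := sd_horner A (s w).
have [qB [qB1 qB2 qB3]] := sd_horner B w.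
have qAs : tends (diag w) (fun p => qA (s p.1, s p.2)) A^`().[s w].
  by move=> U /qA1 /ss.
pose proof (tends_neq0 qAs A'w) as qA0.
exists (B^`().[w] / A^`().[s w]); last by rewrite mulrC divfK.
exists (fun p => qB p / qA (s p.1, s p.2)); split.
- exact: (tendsM qB1 (tendsV A'w qAs)).
- by rewrite /= qA2 qB2.
have h1 : \forall p \near diag w, A.[s p.1] - A.[s p.2] = qA (s p.1, s p.2) * (s p.1 - s p.2).
  exact: (ss _ qA3).
pose proof (filterI (near_fst NSw) (near_snd NSw)) as h2.
pose proof (filterI qA0 h2) as h3.
apply: filterS3 h3 h1 qB3 => p [q0 [s1 s2]] k1 k2.
by rewrite mulrAC -k2 -s1 -s2 k1 mulrC mulKf.
Qed.

End Pairs.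
Arguments tends_fst2 K p : clear implicits.
Arguments tends_snd2 K p : clear implicits.

Section Holomorphic.
Context (K : numFieldType).
Implicit Types (f g : K -> K) (z l m : K).

Definition hol f z : Prop := \forall w \near z, exists l, sd f w l.

Lemma hol_cst (c : K) z : hol (fun=> c) z.
Proof. by apply: filterS filterT => w _; exists 0; exact: sd_cst. Qed.

Lemma hol_id z : hol id z.
Proof. by apply: filterS filterT => w _; exists 1; exact: sd_id. Qed.

Lemma holD f g z : hol f z -> hol g z -> hol (fun w => f w + g w) z.
Proof. by apply: filterS2 => w [l fl] [m gm]; eexists; exact: sdD fl gm. Qed.

Lemma holB f g z : hol f z -> hol g z -> hol (fun w => f w - g w) z.
Proof. by apply: filterS2 => w [l fl] [m gm]; eexists; exact: sdB fl gm. Qed.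

Lemma holN f z : hol f z -> hol (fun w => - f w) z.
Proof. by apply: filterS => w [l fl]; eexists; exact: sdN fl. Qed.

Lemma holM f g z : hol f z -> hol g z -> hol (fun w => f w * g w) z.
Proof. by apply: filterS2 => w [l fl] [m gm]; eexists; exact: sdM fl gm. Qed.

Lemma holX f z n : hol f z -> hol (fun w => f w ^+ n) z.
Proof. by apply: filterS => w [l fl]; eexists; exact: sdX fl. Qed.

Lemma hol_tends f z : hol f z -> tends (nbhs z) f (f z).
Proof. by move=> /nbhs_singleton[l /sd_cont]. Qed.

Lemma hol_neq0 f z : hol f z -> f z != 0 -> \forall w \near z, f w != 0.
Proof. by move=> /hol_tends fz f0; exact: (tends_neq0 fz f0). Qed.

Lemma holV f z : f z != 0 -> hol f z -> hol (fun w => (f w)^-1) z.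
Proof.
move=> f0 fh; apply: filterS2 (hol_neq0 fh f0) fh => w fw [l fl].
by eexists; exact: sdV fw fl.
Qed.

Lemma hol_horner (p : {poly K}) f z : hol f z -> hol (fun w => p.[f w]) z.
Proof. by apply: filterS => w [l fl]; eexists; exact: sd_comp fl (sd_horner p _). Qed.

Lemma hol_near f z : hol f z -> \forall w \near z, hol f w.
Proof. exact: near_join. Qed.

Lemma hol_comp f g z : hol g z -> hol f (g z) -> hol (fun w => f (g w)) z.
Proof.
move=> gh fh; apply: filterS2 gh (hol_tends gh fh) => w [l gl] [m fm].
by eexists; exact: sd_comp gl fm.
Qed.

End Holomorphic.

Section ImplicitFunction.
Context (R : realType).
Local Notation K := (Cx R).

Lemma mod_prod_ge (rs : seq K) (y0 : K) (e : R) : 0 <= e ->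
  (forall y, y \in rs -> e <= mod (y - y0)) ->
  e ^+ size rs <= mod (\prod_(x <- rs) ('X - x%:P)).[y0].
Proof.
move=> e0; elim: rs => [|y rs IH] H; first by rewrite big_nil hornerC mod1 expr0.
rewrite big_cons hornerM modM exprS; apply: ler_pM => //; first exact: exprn_ge0.
  by rewrite hornerXsubC modC; apply: H; rewrite mem_head.
by apply: IH => x xr; apply: H; rewrite inE xr orbT.
Qed.

(** If every root of [p - c] were at distance at least [e] from [y0], then the factorization of
    [p - c] would give [|p(y0) - c|] at least the modulus of the leading coefficient times [e] to
    the degree, which is the chosen bound. *)
Lemma root_near (p : {poly K}) (y0 : K) (e : R) : (1 < size p)%N -> 0 < e ->
  exists2 d : R, 0 < d & forall c, mod (p.[y0] - c) < d ->
    exists2 y, p.[y] = c & mod (y - y0) < e.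
Proof.
move=> sp e0; have p0 : p != 0 by rewrite -size_poly_gt0 (ltn_trans _ sp).
exists (mod (lead_coef p) * e ^+ (size p).-1).
  by rewrite mulr_gt0 ?exprn_gt0 // mod_gt0 lead_coef_eq0.
move=> c pc; pose q := p - c%:P.
have sc : (size (- c%:P : {poly K}) < size p)%N.
  by rewrite size_polyN (leq_ltn_trans (size_polyC_leq1 c)).
have sq : size q = size p by rewrite /q size_polyDl.
have lq : lead_coef q = lead_coef p by rewrite /q lead_coefDl.
have l0 : lead_coef q != 0 by rewrite lq lead_coef_eq0.
have [rs rsE] := closed_field_poly_normal q.
have [[y yr yy]|H] := pselect (exists2 y, y \in rs & mod (y - y0) < e).
  exists y => //; have : root q y by rewrite rsE rootZ // root_prod_XsubC.
  by rewrite /root /q !hornerE subr_eq0 => /eqP.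
exfalso; have srs : size rs = (size p).-1.
  by rewrite -sq rsE size_scale // size_prod_XsubC.
have h : e ^+ (size p).-1 <= mod (\prod_(x <- rs) ('X - x%:P)).[y0].
  rewrite -srs; apply: mod_prod_ge; first exact: ltW.
  by move=> y yr; rewrite leNgt; apply/negP => h; apply: H; exists y.
have : mod (q.[y0]) < mod (lead_coef p) * e ^+ (size p).-1.
  by rewrite /q !hornerE.
rewrite rsE hornerZ modM lq ltr_pM2l ?mod_gt0 -?lq //.
by move=> /lt_le_trans/(_ h); rewrite ltxx.
Qed.

Lemma deriv_size (p : {poly K}) (y : K) : p^`().[y] != 0 -> (1 < size p)%N.
Proof.
apply: contraNltn => /size1_polyC ->; by rewrite derivC horner0.
Qed.

(** [s w] is the root of [A - B(w)] close to [y0]: it exists by continuity of roots and is unique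
    because [A] is injective near [y0]. The last clause says that the curve has no other points near
    [(z0, y0)]. *)
Lemma implicit_function (A B : {poly K}) (z0 y0 : K) :
  A.[y0] = B.[z0] -> A^`().[y0] != 0 ->
  exists s : K -> K, [/\ s z0 = y0,
    \forall w \near z0, [/\ A.[s w] = B.[w], A^`().[s w] != 0 &
       exists2 l, sd s w l & A^`().[s w] * l = B^`().[w] ]
    & \forall p \near ((z0, y0) : K * K), A.[p.2] = B.[p.1] -> p.2 = s p.1].
Proof.
move=> AB A'0; have sA := deriv_size A'0.
have /diag_mod[e0 e00 Hinj] := sd_inj_near (sd_horner A y0) A'0.
have hA' : hol (fun y => A^`().[y]) y0 by apply: hol_horner; exact: hol_id.
have /nbhs_mod[e1 e10 HA'] := hol_neq0 hA' A'0.
pose e := Num.min e0 e1.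
have ee : 0 < e by rewrite lt_min e00.
have e_e0 : e <= e0 by rewrite ge_min lexx.
have e_e1 : e <= e1 by rewrite ge_min lexx orbT.
have inj v w : mod (v - y0) < e -> mod (w - y0) < e -> A.[v] = A.[w] -> v = w.
  by move=> h1 h2; apply: Hinj; [exact: lt_le_trans h1 e_e0|exact: lt_le_trans h2 e_e0].
pose S w := [set y | mod (y - y0) < e /\ A.[y] = B.[w]].
pose s w := xget y0 (S w).
have sE w y : S w y -> s w = y.
  move=> Sy; apply: xget_unique => // y' [h1 h2]; case: Sy => h3 h4.
  by apply: inj => //; rewrite h2 h4.
have [d d0 Hd] := root_near y0 sA ee.
have contB w : tends (nbhs w) (horner B) B.[w] by exact: sd_cont (sd_horner B w).
have NS : \forall w \near z0, S w (s w).
  have /cvg_mod/(_ d d0) := contB z0; apply: filterS => w.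
  rewrite modC -AB => /Hd[y e2 e3].
  by have Sy : S w y by []; rewrite (sE _ _ Sy).
have Sz0 : S z0 y0 by split; rewrite // subrr mod0.
exists s; split; first exact: sE.
  apply: filterS (near_join NS) => w NSw.
  have [sw1 sw2] := nbhs_singleton NSw.
  have A'w : A^`().[s w] != 0 by apply: HA'; exact: lt_le_trans sw1 e_e1.
  split=> //.
  have sc : tends (nbhs w) s (s w).
    apply/cvg_mod => e' e'0.
    (* The second bound keeps the new root within [e] of [y0], where it has to be [s w']. *)
    have e20 : 0 < Num.min e' (e - mod (s w - y0)) by rewrite lt_min e'0 subr_gt0.
    have [d' d'0 Hd'] := root_near (s w) sA e20.
    have /cvg_mod/(_ d' d'0) := contB w; apply: filterS => w'.
    rewrite modC -sw2 => /Hd'[y yE]; rewrite lt_min => /andP[y1 y2].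
    have Sy : S w' y.
      split=> //; have := modD (y - s w) (s w - y0).
      by rewrite addrA subrK => h; apply: (le_lt_trans h); rewrite -ltrBrDr.
    by rewrite (sE _ _ Sy).
  by apply: (sd_implicit sc A'w); apply: filterS NSw => w' [].
have N2 : \forall p \near ((z0, y0) : K * K), mod (p.2 - y0) < e.
  by have /cvg_mod/(_ e ee) := tends_snd2 _ ((z0, y0) : K * K).
by apply: filterS N2 => p p2 pAB; rewrite (@sE p.1 p.2).
Qed.

End ImplicitFunction.

(** * Topology of the glued surface *)

Lemma nbhs_open (T : topologicalType) (p : T) (P : set T) :
  nbhs p P -> exists X, [/\ open X, X p & X `<=` P].
Proof. by rewrite nbhsE => -[X [Xo Xp] XP]; exists X. Qed.

Section SurfTopology.
Context (R : realType) (k : nat).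
Local Notation K := (Cx R).

(** The change of charts is an involution, so the same formula serves in both directions. *)
Lemma chart_affE (p : K * K) : p.1 != 0 ->
  @chart_inf R k (p.1^-1, p.2 / p.1 ^+ k) = chart_aff k p.
Proof.
move=> p0; rewrite /chart_inf /chart_aff /= invr_eq0 (negbTE p0) invrK.
congr Aff; rewrite exprVn invrK -mulrA mulVf ?mulr1 // expf_neq0 //.
Qed.

Lemma chart_infE (p : K * K) : p.1 != 0 ->
  @chart_inf R k p = chart_aff k (p.1^-1, p.2 / p.1 ^+ k).
Proof. by move=> p0; rewrite /chart_inf (negbTE p0). Qed.

Lemma nbhs_surf (P : surf R k) (U : set (surf R k)) :
  nbhs P U <-> exists V, [/\ surf_open V, V P & V `<=` U].
Proof.
rewrite nbhsE; split.
  by move=> [V [oV VP] VU]; exists V.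
by move=> [V [oV VP VU]]; exists V.
Qed.

Lemma open_nbhs_all (A : set (K * K)) : (forall p, A p -> nbhs p A) -> open A.
Proof. by move=> H; rewrite openE => p /H. Qed.

(** The image of an open set of this chart is open in the other one too, because the change of
    charts is continuous where it is defined. *)
Lemma nbhs_aff (x y : K) (U : set (surf R k)) :
  nbhs (Aff x y : surf R k) U <-> \forall p \near ((x, y) : K * K), U (Aff p.1 p.2).
Proof.
rewrite nbhs_surf; split.
  move=> [V [[V1 _] VP VU]]; have : open_nbhs ((x, y) : K * K) (@chart_aff R k @^-1` V) by split.
  by move=> /open_nbhs_nbhs; apply: filterS => p /VU.
move=> /nbhs_open[X [Xo Xxy XU]].
exists (@chart_aff R k @` X); split; last 2 first.
- by exists (x, y).
- by move=> _ [p Op <-]; exact: XU.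
split.
  suff -> : @chart_aff R k @^-1` (@chart_aff R k @` X) = X by [].
  apply/seteqP; split => [p [q Oq]|p Op]; last by exists p.
  by rewrite /chart_aff => -[e1 e2]; rewrite [p]surjective_pairing -e1 -e2 -surjective_pairing.
apply: open_nbhs_all => p [q Oq qp].
have p0 : p.1 != 0 by move: qp; rewrite /chart_aff /chart_inf; case: (eqVneq p.1 0).
have Op' : X (p.1^-1, p.2 / p.1 ^+ k).
  move: qp; rewrite chart_infE // /chart_aff => -[e1 e2].
  by move: Oq; rewrite [q]surjective_pairing e1 e2.
have N : \forall q \near p, X (q.1^-1, q.2 / q.1 ^+ k).
  by apply: (transition_cvg p0); exact: open_nbhs_nbhs.
apply: filterS2 (fst_neq0_near p0) N => q' q'0 Oq'.
by exists (q'.1^-1, q'.2 / q'.1 ^+ k) => //; rewrite -chart_infE.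
Qed.

Lemma nbhs_inf (v : K) (U : set (surf R k)) :
  nbhs (Inf v : surf R k) U <-> \forall p \near ((0, v) : K * K), U (chart_inf k p).
Proof.
rewrite nbhs_surf; split.
  move=> [V [[_ V1] VP VU]].
  have : open_nbhs ((0, v) : K * K) (@chart_inf R k @^-1` V).
    by split=> //=; rewrite /chart_inf /= eqxx.
  by move=> /open_nbhs_nbhs; apply: filterS => p /VU.
move=> /nbhs_open[X [Xo Xxy XU]].
exists (@chart_inf R k @` X); split; last 2 first.
- by exists (0, v) => //; rewrite /chart_inf /= eqxx.
- by move=> _ [p Op <-]; exact: XU.
split.
  apply: open_nbhs_all => p [q Oq qp].
  have q0 : q.1 != 0 by move: qp; rewrite /chart_inf; case: (eqVneq q.1 0).
  have p0 : p.1 != 0.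
    by move: qp; rewrite chart_infE // /chart_aff => -[<- _]; rewrite invr_eq0.
  have e : (p.1^-1, p.2 / p.1 ^+ k) = q.
    move: qp; rewrite chart_infE // /chart_aff => -[<- <-] /=.
    rewrite invrK exprVn invrK -mulrA mulVf ?mulr1 ?expf_neq0 //.
    by rewrite -surjective_pairing.
  have N : \forall q \near p, X (q.1^-1, q.2 / q.1 ^+ k).
    by apply: (transition_cvg p0); rewrite e; exact: open_nbhs_nbhs.
  apply: filterS2 (fst_neq0_near p0) N => q' q'0 Oq'.
  by exists (q'.1^-1, q'.2 / q'.1 ^+ k) => //; exact: chart_affE.
suff -> : @chart_inf R k @^-1` (@chart_inf R k @` X) = X by [].
apply/seteqP; split => [p [q Oq]|p Op]; last by exists p.
rewrite /chart_inf; case: (eqVneq q.1 0) => [q0|q0]; case: (eqVneq p.1 0) => [p0|p0] //.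
  by move=> [e]; rewrite [p]surjective_pairing p0 -e -q0 -surjective_pairing.
move=> [/invr_inj e1]; rewrite e1 => /mulIf e2.
rewrite [p]surjective_pairing -e1 -e2 -?surjective_pairing //.
by rewrite invr_eq0 expf_neq0.
Qed.

Lemma tends_xco (x y : K) : tends (nbhs (Aff x y : surf R k)) (@xco R k) x.
Proof. by move=> U HU; apply/nbhs_aff; exact: (tends_fst2 (Cx R) (x, y) _ HU). Qed.

Lemma tends_yco (x y : K) : tends (nbhs (Aff x y : surf R k)) (@yco R k) y.
Proof. by move=> U HU; apply/nbhs_aff; exact: (tends_snd2 (Cx R) (x, y) _ HU). Qed.

Lemma uco_chart (p : K * K) : uco (@chart_inf R k p) = p.1.
Proof. by rewrite /chart_inf; case: eqP => [->|_] //=; rewrite invrK. Qed.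

Lemma vco_chart (p : K * K) : vco (@chart_inf R k p) = p.2.
Proof.
rewrite /chart_inf; case: eqP => [//|/eqP p0] /=.
by rewrite exprVn invrK -mulrA mulVf ?mulr1 // expf_neq0.
Qed.

Lemma tends_uco (v : K) : tends (nbhs (Inf v : surf R k)) (@uco R k) 0.
Proof.
move=> U HU; apply/nbhs_inf; have N : \forall p \near ((0, v) : K * K), U p.1
  := tends_fst2 (Cx R) (0, v) _ HU.
by apply: filterS N => p; rewrite /= uco_chart.
Qed.

Lemma tends_vco (v : K) : tends (nbhs (Inf v : surf R k)) (@vco R k) v.
Proof.
move=> U HU; apply/nbhs_inf; have N : \forall p \near ((0, v) : K * K), U p.2
  := tends_snd2 (Cx R) (0, v) _ HU.
by apply: filterS N => p; rewrite /= vco_chart.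
Qed.

End SurfTopology.

Section SurfMaps.
Context (R : realType) (k : nat).
Local Notation K := (Cx R).

Lemma near_chart_aff (p : K * K) (U : set (surf R k)) : nbhs (chart_aff k p) U ->
  \forall p' \near p, U (chart_aff k p').
Proof. by case: p => x y /nbhs_aff. Qed.

Lemma near_chart_inf (p : K * K) (U : set (surf R k)) : nbhs (chart_inf k p) U ->
  \forall p' \near p, U (chart_inf k p').
Proof.
have [p0|p0] := eqVneq p.1 0.
  case: p p0 => u v /= ->; have -> : chart_inf k (0, v) = Inf v by rewrite /chart_inf /= eqxx.
  by move=> /nbhs_inf.
rewrite chart_infE // => /near_chart_aff N.
have N'' : \forall p' \near p, U (chart_aff k (p'.1^-1, p'.2 / p'.1 ^+ k)).
  by pose proof (@transition_cvg K k p p0) as G; exact: (G _ N).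
apply: filterS2 (fst_neq0_near p0) N'' => p' p'0 h.
by rewrite chart_infE.
Qed.

Lemma near_pair (f g : K -> K) z (P : set (K * K)) :
  tends (nbhs z) f (f z) -> tends (nbhs z) g (g z) ->
  (\forall p \near ((f z, g z) : K * K), P p) -> \forall z' \near z, P (f z', g z').
Proof. by move=> fc gc N; pose proof (tends_pair fc gc) as G; exact: (G _ N). Qed.

Lemma near_swap (x y : K) (P : set (K * K)) :
  (\forall p \near ((x, y) : K * K), P p) -> \forall p \near ((y, x) : K * K), P (p.2, p.1).
Proof.
move=> N.
pose proof (tends_pair (tends_snd2 _ ((y, x) : K * K)) (tends_fst2 _ ((y, x) : K * K))) as G.
exact: (G _ N).
Qed.

Lemma near_tends_xco (x y : K) : \forall Q \near (Aff x y : surf R k),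
  tends (nbhs Q) (@xco R k) (xco Q).
Proof. by apply/nbhs_aff; apply: filterS filterT => p _; exact: tends_xco. Qed.

Lemma near_tends_yco (x y : K) : \forall Q \near (Aff x y : surf R k),
  tends (nbhs Q) (@yco R k) (yco Q).
Proof. by apply/nbhs_aff; apply: filterS filterT => p _; exact: tends_yco. Qed.

Lemma near_tends_uco (v : K) : \forall Q \near (Inf v : surf R k),
  tends (nbhs Q) (@uco R k) (uco Q).
Proof.
apply/nbhs_inf; apply: filterS filterT => p _.
rewrite /chart_inf; case: eqP => [_|/eqP p0]; first exact: tends_uco.
have x0 : p.1^-1 != 0 by rewrite invr_eq0.
pose proof (tendsV x0 (@tends_xco R k p.1^-1 (p.2 / p.1 ^+ k))) as N.
apply: tends_near N; apply/nbhs_aff; apply: filterS filterT => p' _ //.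
Qed.

End SurfMaps.

(** * The equation of C in its two charts *)

Section CurvePolynomial.
Context (R : realType) (t t' : Cx R).
Local Notation K := (Cx R).
Local Notation F := (polyC2 t t').

Lemma polyC2E x : F.[x] = (t' - x ^+ 2) * (t' - 1 - x ^+ 2) * (t' - t - x ^+ 2).
Proof. by rewrite /polyC2 !hornerE. Qed.

Lemma polyC2_coef : F`_(2 * 3)%N = -1.
Proof.
have -> : F = - 'X^6 + (t' + (t' - 1) + (t' - t))%:P * 'X^4
   - (t' * (t' - 1) + t' * (t' - t) + (t' - 1) * (t' - t))%:P * 'X^2
   + (t' * (t' - 1) * (t' - t))%:P.
  rewrite /polyC2 !(polyCD, polyCB, polyCM, polyCN, polyC1); ring.
by rewrite !coefE /= !mulr0 subr0 !addr0.
Qed.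

Lemma polyC2_deriv x : F^`().[x] =
  - (2 * x) * ((t' - 1 - x ^+ 2) * (t' - t - x ^+ 2) +
  (t' - x ^+ 2) * (t' - t - x ^+ 2) + (t' - x ^+ 2) * (t' - 1 - x ^+ 2)).
Proof. by rewrite /polyC2 !derivM !derivB !derivC !derivXn !hornerE /=; ring. Qed.

Hypotheses (t0 : t != 0) (t1 : t != 1) (t'0 : t' != 0) (t'1 : t' != 1) (tt' : t != t').

(** Smoothness of C: the numbers [t'], [t' - 1], [t' - t] are distinct and nonzero. The second
    conclusion separates the points with y = 0 from the ramification points of f. *)
Lemma polyC2_separable x : F.[x] = 0 -> F^`().[x] != 0 /\ x != 0.
Proof.
have d1 : t' - 1 != 0 by rewrite subr_eq0.
have d2 : t' - t != 0 by rewrite subr_eq0 eq_sym.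
have d3 : t - 1 != 0 by rewrite subr_eq0.
have two : (2 : K) != 0 by rewrite pnatr_eq0.
move=> Fx; have x0 : x != 0.
  apply/eqP => e; move: Fx; rewrite polyC2E e expr0n /= !subr0 => /eqP.
  by rewrite !mulf_eq0 (negbTE t'0) (negbTE d1) (negbTE d2).
split=> //; have /eqP := Fx; rewrite polyC2E polyC2_deriv.
rewrite [in X in X -> _]mulf_eq0 [in X in X -> _]mulf_eq0 -orbA => /or3P[] /eqP e.
- have -> : x ^+ 2 = t' by apply/eqP; rewrite eq_sym -subr_eq0 e.
  rewrite (_ : - (2 * x) * _ = (2 * x) * - t); last by ring.
  by rewrite !mulf_neq0 // oppr_eq0.
- have -> : x ^+ 2 = t' - 1 by apply/eqP; rewrite eq_sym -subr_eq0 e.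
  rewrite (_ : - (2 * x) * _ = (2 * x) * (t - 1)); last by ring.
  by rewrite !mulf_neq0.
- have -> : x ^+ 2 = t' - t by apply/eqP; rewrite eq_sym -subr_eq0 e.
  rewrite (_ : - (2 * x) * _ = - (2 * x) * (t * (t - 1))); last by ring.
  by rewrite !mulf_neq0 // oppr_eq0 mulf_neq0.
Qed.

(** This is [u^6 F(1/u)], the right-hand side of the equation of C at infinity. *)
Definition revC : {poly K} :=
  (t'%:P * 'X^2 - 1) * ((t' - 1)%:P * 'X^2 - 1) * ((t' - t)%:P * 'X^2 - 1).

Lemma revCE u : revC.[u] =
  (t' * u ^+ 2 - 1) * ((t' - 1) * u ^+ 2 - 1) * ((t' - t) * u ^+ 2 - 1).
Proof. by rewrite /revC !hornerE. Qed.

Lemma revC_chart (u v : K) : curveC t t' (chart_inf 3 (u, v)) <-> v ^+ 2 = revC.[u].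
Proof.
rewrite /chart_inf /=; case: eqP => [->|/eqP u0] /=.
  have -> : revC.[0] = -1 by rewrite revCE expr0n /=; ring.
  by rewrite polyC2_coef.
have -> : F.[u^-1] = revC.[u] / u ^+ 6 by rewrite polyC2E revCE; field.
have u6 : u ^+ 6 != 0 by rewrite expf_neq0.
by rewrite expr_div_n -exprM; split=> [/(divIf u6)|->].
Qed.

End CurvePolynomial.

(** * Polar parts of omega *)

Section Poles.
Context (R : realType) (F : {poly Cx R}).
Local Notation K := (Cx R).

Lemma quotient_at (x0 : K) : exists G : {poly K}, F = G * ('X - x0%:P) + F.[x0]%:P.
Proof.
have : root (F - F.[x0]%:P) x0 by rewrite /root !hornerE subrr.
by move=> /factor_theorem[G e]; exists G; rewrite -e subrK.
Qed.

Lemma two_neq0 : (2 : K) != 0. Proof. by rewrite pnatr_eq0. Qed.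

(* (1/2) (y + y1) / (x - x1) dx/y in the coordinate x *)
Lemma pole_regular (s : K -> K) (x0 x1 y1 : K) : hol s x0 ->
  (\forall z \near x0, s z ^+ 2 = F.[z]) -> s x0 != 0 -> y1 ^+ 2 = F.[x1] ->
  exists hq, hol hq x0 /\ \forall z \near x0, (z != x0) || (x0 != x1) ->
    z != x1 /\ 2^-1 * ((s z + y1) / (z - x1)) / s z =
      ((x0 == x1) && (s x0 == y1))%:R / (z - x0) + hq z.
Proof.
move=> hs sF s0 y1F; have two := two_neq0.
have sn := hol_neq0 hs s0.
have idh := @hol_id K x0.
have [e|ne] := eqVneq x0 x1; last first.
  have xh : hol (fun z => z - x1) x0 by apply: holB idh _; exact: hol_cst.
  have x0n : x0 - x1 != 0 by rewrite subr_eq0.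
  exists (fun z => 2^-1 * ((s z + y1) / (z - x1)) / s z); split.
    apply: holM; last exact: holV.
    apply: holM; first exact: hol_cst.
    by apply: holM; [apply: holD => //; exact: hol_cst|exact: holV].
  apply: filterS (hol_neq0 xh x0n) => z zn _.
  by rewrite mul0r add0r; split=> //; rewrite -subr_eq0.
subst x1; have [G GE] := quotient_at x0.
have GF z : F.[z] = G.[z] * (z - x0) + F.[x0] by rewrite {1}GE !hornerE.
have hG : hol (fun z => G.[z]) x0 by apply: hol_horner.
have sx0 : s x0 ^+ 2 = F.[x0] by exact: nbhs_singleton sF.
have hsum : hol (fun z => s z + s x0) x0 by apply: holD => //; exact: hol_cst.
have sum0 : s x0 + s x0 != 0 by rewrite -mulr2n -mulr_natr mulf_neq0.
have sumn := hol_neq0 hsum sum0.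
have : y1 ^+ 2 == s x0 ^+ 2 by rewrite y1F sx0.
(* There are two points of C over [x0]. At [(x1, y1)] the residue is 1; at the opposite point the
   numerator vanishes as well. The regular parts come from [s z ^+ 2 - s x0 ^+ 2 = G.[z] * (z -
   x0)]. *)
rewrite eqf_sqr => /orP[] /eqP ->.
  exists (fun z => - (2^-1 * G.[z] / (s z * (s z + s x0)))); split.
    apply: holN; apply: holM; first by apply: holM hG; exact: hol_cst.
    by apply: holV; [rewrite mulf_neq0|exact: holM].
  apply: filterS3 sF sn sumn => z sz snz suz; rewrite ?eqxx orbF => zx; split=> //.
  have zn : z - x0 != 0 by rewrite subr_eq0.
  have -> : G.[z] = (s z ^+ 2 - s x0 ^+ 2) / (z - x0) by rewrite sz sx0 GF addrK mulfK.
  have -> : (true && true)%:R = 1 :> K by [].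
  by field; rewrite suz snz zn ?two.
exists (fun z => 2^-1 * G.[z] / (s z * (s z + s x0))); split.
  apply: holM; first by apply: holM hG; exact: hol_cst.
  by apply: holV; [rewrite mulf_neq0|exact: holM].
apply: filterS3 sF sn sumn => z sz snz suz; rewrite ?eqxx orbF => zx; split=> //.
have zn : z - x0 != 0 by rewrite subr_eq0.
have -> : (s x0 == - s x0) = false by apply/negbTE; rewrite -subr_eq0 opprK.
rewrite mul0r add0r.
have -> : G.[z] = (s z ^+ 2 - s x0 ^+ 2) / (z - x0) by rewrite sz sx0 GF addrK mulfK.
by field; rewrite suz snz zn ?two.
Qed.

(* The same form in the coordinate y at a point with y = 0, where
   dx = 2 y dy / F'(x). *)
Lemma pole_branch (s : K -> K) (x0 x1 y1 : K) : hol s 0 -> s 0 = x0 ->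
  (\forall z \near 0, F.[s z] = z ^+ 2) -> F^`().[x0] != 0 -> y1 ^+ 2 = F.[x1] ->
  exists hq, hol hq 0 /\ \forall z \near 0, z != 0 ->
    s z != x1 /\ 2^-1 * ((z + y1) / (s z - x1)) / z * (2 * z / F^`().[s z]) =
      ((x0 == x1) && (0 == y1))%:R / z + hq z.
Proof.
move=> hs s0 sF F'0 y1F; have two := two_neq0.
have idh := @hol_id K 0.
have hF' : hol (fun z => F^`().[s z]) 0 by exact: hol_horner.
have F's : F^`().[s 0] != 0 by rewrite s0.
have F'n := hol_neq0 hF' F's.
have [e|ne] := eqVneq x0 x1; last first.
  have xh : hol (fun z => s z - x1) 0 by apply: holB hs _; exact: hol_cst.
  have x0n : s 0 - x1 != 0 by rewrite s0 subr_eq0.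
  exists (fun z => (z + y1) / (s z - x1) / F^`().[s z]); split.
    apply: holM; last exact: holV.
    by apply: holM; [apply: holD => //; exact: hol_cst|exact: holV].
  apply: filterS2 (hol_neq0 xh x0n) F'n => z zn f'n z0.
  rewrite mul0r add0r; split; first by rewrite -subr_eq0.
  by field; rewrite zn f'n z0 ?two.
subst x1; have [G GE] := quotient_at x0.
have Fx0 : F.[x0] = 0 by rewrite -s0 (nbhs_singleton sF) expr0n.
have y10 : y1 = 0 by apply/eqP; move: y1F; rewrite Fx0 => /eqP; rewrite sqrf_eq0.
have GF z : F.[z] = G.[z] * (z - x0) by rewrite {1}GE Fx0 !hornerE.
have F'E z : F^`().[z] = G^`().[z] * (z - x0) + G.[z].
  by rewrite {1}GE Fx0 derivD derivM derivB derivX !derivC !hornerE; ring.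
have hG : hol (fun z => G.[s z]) 0 by exact: hol_horner.
have G0 : G.[s 0] != 0 by move: F'0; rewrite F'E s0 subrr mulr0 add0r.
have Gn := hol_neq0 hG G0.
(* Subtracting [1 / z] from the form leaves this term, by [G(s) (s - x0) = z^2] and
   [F'(s) = G'(s) (s - x0) + G(s)]. *)
exists (fun z => - (z * G^`().[s z] / (G.[s z] * F^`().[s z]))); split.
  apply: holN; apply: holM; first by apply: holM => //; exact: hol_horner.
  by apply: holV; [rewrite mulf_neq0|exact: holM].
apply: filterS3 sF F'n Gn => z sz f'n gn z0.
rewrite y10 eqxx addr0.
have sx0 : s z - x0 != 0.
  apply/eqP => e; move: sz; rewrite GF e mulr0 => /esym/eqP.
  by rewrite sqrf_eq0 (negbTE z0).
split; first by rewrite -subr_eq0.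
have GE' : G.[s z] = z ^+ 2 / (s z - x0) by rewrite -sz GF mulfK.
have h : F^`().[s z] = G^`().[s z] * (s z - x0) + z ^+ 2 / (s z - x0) by rewrite F'E GE'.
have f'n2 := f'n; rewrite h in f'n2.
have -> : (true && true)%:R = 1 :> K by [].
rewrite h GE'; field; rewrite sx0 z0 ?two /=.
move: f'n2; rewrite -(inj_eq (mulIf sx0)) mul0r mulrDl divfK // => ->.
by rewrite ?andbT.
Qed.

(* The same form in the coordinate u = 1/x at a point at infinity, where
   y = v / u^3. *)
Lemma pole_infinity (s : K -> K) (x1 y1 : K) : hol s 0 -> s 0 != 0 ->
  exists hq, hol hq 0 /\ \forall u \near 0, u != 0 ->
    u^-1 != x1 /\ 2^-1 * ((s u / u ^+ 3 + y1) / (u^-1 - x1)) / (s u / u ^+ 3) * (- u ^- 2) =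
      - 2^-1 / u + hq u.
Proof.
move=> hs s0; have two := two_neq0; have idh := @hol_id K 0.
have hd : hol (fun u => 1 - x1 * u) 0.
  by apply: holB; [exact: hol_cst|apply: holM idh; exact: hol_cst].
have d0 : 1 - x1 * 0 != 0 :> K by rewrite mulr0 subr0 oner_eq0.
exists (fun u => - (2^-1 * (x1 / (1 - x1 * u) + y1 * u ^+ 2 / (s u * (1 - x1 * u))))); split.
  apply: holN; apply: holM; first exact: hol_cst.
  apply: holD; apply: holM.
  - exact: hol_cst.
  - exact: holV.
  - by apply: holM; [exact: hol_cst|exact: holX].
  - by apply: holV; [rewrite mulf_neq0|exact: holM].
apply: filterS2 (hol_neq0 hs s0) (hol_neq0 hd d0) => u sn dn u0.
have e : u^-1 - x1 = (1 - x1 * u) / u by field.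
split; first by rewrite -subr_eq0 e mulf_neq0 // invr_eq0.
by rewrite e; field; rewrite sn dn u0 ?two.
Qed.

End Poles.

(** * Local charts of C adapted to omega and to f *)

Lemma aff_eq (R : realType) (k : nat) (x y x' y' : Cx R) :
  ((Aff x y : surf R k) == Aff x' y') = (x == x') && (y == y').
Proof. by apply/eqP/andP => [[-> ->]|[/eqP-> /eqP->]]. Qed.

Lemma inf_eq (R : realType) (k : nat) (v v' : Cx R) :
  ((Inf v : surf R k) == Inf v') = (v == v').
Proof. by apply/eqP/eqP => [[]|->]. Qed.

Lemma aff_inf (R : realType) (k : nat) (x y v : Cx R) :
  ((Aff x y : surf R k) == Inf v) = false.
Proof. by apply/negbTE/eqP. Qed.

Lemma inf_aff (R : realType) (k : nat) (x y v : Cx R) :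
  ((Inf v : surf R k) == Aff x y) = false.
Proof. by apply/negbTE/eqP. Qed.

Section Charts.
Context (R : realType) (t t' vinf : Cx R) (q1 q2 : Cx R * Cx R) (l1 l2 : Cx R).
Local Notation K := (Cx R).
Local Notation C := (curveC t t').
Local Notation F := (polyC2 t t').
Local Notation om := (omega q1 q2 l1 l2).
Local Notation tau := (@loc_coord R 3).
Hypotheses (t0 : t != 0) (t1 : t != 1) (t'0 : t' != 0) (t'1 : t' != 1) (tt' : t != t').
Hypotheses (vinfE : vinf ^+ 2 = -1).
Hypotheses (q1C : C (Aff q1.1 q1.2)) (q2C : C (Aff q2.1 q2.2)).

(* phi is an inverse of the local coordinate tau at P; in this coordinate omega
   is (n / (z - z0) + h) dz, and ch_cover compares tau with the coordinate of E
   at f(P). *)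
Record chart (P : surf R 3) (phi : K -> surf R 3) (h : K -> K) : Prop := {
  ch_0 : phi (tau P P) = P;
  ch_inv : \forall Q \near P, C Q -> phi (tau P Q) = Q;
  ch_coord : \forall Q \near P, C Q -> tends (nbhs Q) (tau P) (tau P Q);
  ch_curve : \forall z \near (tau P P), C (phi z) /\ tau P (phi z) = z;
  ch_cont : \forall z \near (tau P P), forall U, nbhs (phi z) U ->
    \forall z' \near z, U (phi z');
  ch_hol : hol h (tau P P);
  ch_form : \forall z \near (tau P P), (z != tau P P) \/ Cgen t t' q1 q2 P ->
    Cgen t t' q1 q2 (phi z) /\ exists d, [/\ d != 0, sd (fun w => xco (phi w)) z d
      & om (phi z) * d = (divL q1 q2 vinf P)%:~R / (z - tau P P) + h z];
  ch_cover : (forall y, P <> Aff 0 y) -> hol (fun w => uco (phi w)) (tau P P) /\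
    exists kappa, [/\ hol kappa (tau P P), kappa (tau P P) != 0
      & \forall z \near (tau P P),
        loc_coord (coverf t' P) (coverf t' (phi z)) - loc_coord (coverf t' P) (coverf t' P)
          = (z - tau P P) * kappa z] }.

Lemma omegaE (x y : K) : om (Aff x y) = 2^-1 * ((y + q1.2) / (x - q1.1)) / y +
  2^-1 * ((y + q2.2) / (x - q2.1)) / y + l1 / y + l2 * x / y.
Proof. by rewrite /omega mulrDr mulrDl. Qed.

Lemma omegaM (x y l : K) : om (Aff x y) * l =
  2^-1 * ((y + q1.2) / (x - q1.1)) / y * l + 2^-1 * ((y + q2.2) / (x - q2.1)) / y * l
  + l1 / y * l + l2 * x / y * l.
Proof. by rewrite omegaE !(mulrDl _ _ l). Qed.

Lemma divL_aff (x y : K) : (divL q1 q2 vinf (Aff x y))%:~R =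
  ((x == q1.1) && (y == q1.2))%:R + ((x == q2.1) && (y == q2.2))%:R :> K.
Proof. by rewrite /divL !aff_eq !aff_inf !subr0 rmorphD. Qed.

(** The two points at infinity are distinct, so each is counted once. The value -1 matches the two
    residues -1/2 found in [pole_infinity]. *)
Lemma divL_inf (v : K) : C (Inf v) -> divL q1 q2 vinf (Inf v) = -1.
Proof.
rewrite /= polyC2_coef -vinfE => /eqP; rewrite eqf_sqr /divL !inf_eq !inf_aff => h.
have ne : vinf != - vinf.
  rewrite -subr_eq0 opprK -mulr2n -mulr_natr mulf_neq0 ?two_neq0 //.
  by rewrite -sqrf_eq0 vinfE oppr_eq0 oner_eq0.
by case/orP: h => /eqP ->; rewrite eqxx ?(negbTE ne) // eq_sym (negbTE ne).
Qed.

Lemma chart_regular (x0 y0 : K) : C (Aff x0 y0) -> y0 != 0 ->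
  exists phi h, chart (Aff x0 y0) phi h.
Proof.
move=> CP y0n; have E : tau (Aff x0 y0) = @xco R 3 by rewrite /= (negbTE y0n).
have [||s [s0 sn su]] := @implicit_function R 'X^2 F x0 y0.
- by rewrite hornerXn.
- by rewrite derivXn hornerMn hornerXn expr1 -mulr_natr mulf_neq0 ?two_neq0.
have hs : hol s x0 by apply: filterS sn => w [_ _ [l sl _]]; exists l.
have sF : \forall w \near x0, s w ^+ 2 = F.[w].
  by apply: filterS sn => w [+ _ _]; rewrite hornerXn.
have s0n : s x0 != 0 by rewrite s0.
have snn := hol_neq0 hs s0n.
have [h1 [hh1 p1]] := @pole_regular R F s x0 q1.1 q1.2 hs sF s0n q1C.
have [h2 [hh2 p2]] := @pole_regular R F s x0 q2.1 q2.2 hs sF s0n q2C.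
have hid := @hol_id K x0.
exists (fun z => Aff z (s z)), (fun z => h1 z + h2 z + l1 / s z + l2 * z / s z).
split; rewrite ?E.
- by rewrite /= s0.
- by apply/nbhs_aff; apply: filterS su => p /=; rewrite hornerXn => H /H <-.
- by apply: filterS (near_tends_xco 3 x0 y0) => Q ? _.
- by apply: filterS sF.
- apply: filterS (hol_near hs) => z /hol_tends sz U.
  have := @near_chart_aff R 3 (z, s z) U => N /N {}N.
  exact: (near_pair (tends_id z) sz N).
- apply: holD; last by apply: holM; [apply: holM hid; exact: hol_cst|exact: holV].
  apply: holD; last by apply: holM; [exact: hol_cst|exact: holV].
  exact: holD.
- rewrite [xco _]/=; apply: filterS3 (filterI sF snn) p1 p2 => z [zF zn] z1 z2 zx.
  have [c1 c2] : ((z != x0) || (x0 != q1.1)) /\ ((z != x0) || (x0 != q2.1)).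
    by case: zx => [->|[_ _ /= -> ->]] //; rewrite !orbT.
  have [n1 e1] := z1 c1; have [n2 e2] := z2 c2.
  split; first by split.
  exists 1; split; [exact: oner_neq0|exact: sd_id|].
  by rewrite mulr1 omegaE divL_aff e1 e2 s0; ring.
- move=> Pn; have x0n : x0 != 0 by apply/eqP => e; apply: (Pn y0); rewrite e.
  split; first exact: holV.
  (* This is [(t' - z^2) - (t' - x0^2)] divided by [z - x0]; its value at [x0] is nonzero away from
     the ramification points. *)
  exists (fun z => - (z + x0)); split.
  + by apply: holN; apply: holD hid _; exact: hol_cst.
  + by rewrite /= oppr_eq0 -mulr2n -mulr_natr mulf_neq0 ?two_neq0.
  + by apply: filterS filterT => z _; rewrite /= (negbTE y0n) /=; ring.
Qed.

Lemma chart_branch (x0 : K) : C (Aff x0 0) -> exists phi h, chart (Aff x0 0) phi h.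
Proof.
move=> CP; have E : tau (Aff x0 0) = @yco R 3 by rewrite /= eqxx.
have Fx0 : F.[x0] = 0 by rewrite -CP expr0n.
have [F'0 x0n] := polyC2_separable t0 t1 t'0 t'1 tt' Fx0.
have [||s [s0 sn su]] := @implicit_function R F 'X^2 0 x0.
- by rewrite hornerXn expr0n.
- exact: F'0.
have hs : hol s 0 by apply: filterS sn => w [_ _ [l sl _]]; exists l.
have sF : \forall w \near 0, F.[s w] = w ^+ 2.
  by apply: filterS sn => w [+ _ _]; rewrite hornerXn.
have [h1 [hh1 p1]] := @pole_branch R F s x0 q1.1 q1.2 hs s0 sF F'0 q1C.
have [h2 [hh2 p2]] := @pole_branch R F s x0 q2.1 q2.2 hs s0 sF F'0 q2C.
have hid := @hol_id K 0.
have hF' : hol (fun z => F^`().[s z]) 0 by exact: hol_horner.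
have F's : F^`().[s 0] != 0 by rewrite s0.
exists (fun z => Aff (s z) z), (fun z => h1 z + h2 z + 2 * (l1 + l2 * s z) / F^`().[s z]).
split; rewrite ?E.
- by rewrite /= s0.
- apply/nbhs_aff; apply: filterS (near_swap su) => p /=; rewrite hornerXn => H e.
  by rewrite -H // e.
- by apply: filterS (near_tends_yco 3 x0 0) => Q ? _.
- by apply: filterS sF => w /esym.
- apply: filterS (hol_near hs) => z /hol_tends sz U.
  have := @near_chart_aff R 3 (s z, z) U => N /N {}N.
  exact: (near_pair sz (tends_id z) N).
- apply: holD; first exact: holD.
  apply: holM; last exact: holV.
  apply: holM; first exact: hol_cst.
  by apply: holD; [exact: hol_cst|apply: holM hs; exact: hol_cst].
- rewrite [yco _]/=; apply: filterS3 sn p1 p2 => z [zF f'n [l sl lE]] z1 z2 zx.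
  have z0 : z != 0 by case: zx => // -[_ /=]; rewrite eqxx.
  have [n1 e1] := z1 z0; have [n2 e2] := z2 z0.
  have lE' : l = 2 * z / F^`().[s z].
    apply: (mulfI f'n); rewrite lE derivXn hornerMn hornerXn expr1 mulrC divfK //.
    by rewrite mulr_natl.
  split; first by split=> //=; rewrite zF hornerXn.
  exists l; split=> //.
    by rewrite lE' mulf_neq0 ?invr_eq0 // mulf_neq0 // two_neq0.
  rewrite omegaM divL_aff lE' e1 e2 subr0.
  have -> : l1 / z * (2 * z / F^`().[s z]) = 2 * l1 / F^`().[s z] by field; rewrite f'n z0.
  have -> : l2 * s z / z * (2 * z / F^`().[s z]) = 2 * (l2 * s z) / F^`().[s z].
    by field; rewrite f'n z0.
  by ring.
- move=> Pn; split; first by apply: holV; rewrite ?s0.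
  exists (fun z => 1); split; [exact: hol_cst|exact: oner_neq0|].
  by apply: filterS filterT => z _; rewrite /= eqxx /= mulr1.
Qed.

Lemma chart_infinity (v0 : K) : C (Inf v0) -> exists phi h, chart (Inf v0) phi h.
Proof.
move=> CP; have dP := divL_inf CP.
have v0E : v0 ^+ 2 = -1 by rewrite -(polyC2_coef t t').
have v0n : v0 != 0 by rewrite -sqrf_eq0 v0E oppr_eq0 oner_eq0.
have E : tau (Inf v0) = @uco R 3 by rewrite /= (negbTE v0n).
have G0 : (revC t t').[0] = -1 by rewrite revCE expr0n /=; ring.
have [||s [s0 sn su]] := @implicit_function R 'X^2 (revC t t') 0 v0.
- by rewrite hornerXn G0.
- by rewrite derivXn hornerMn hornerXn expr1 -mulr_natr mulf_neq0 ?two_neq0.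
have hs : hol s 0 by apply: filterS sn => w [_ _ [l sl _]]; exists l.
have sG : \forall w \near 0, s w ^+ 2 = (revC t t').[w].
  by apply: filterS sn => w [+ _ _]; rewrite hornerXn.
have s0n : s 0 != 0 by rewrite s0.
have snn := hol_neq0 hs s0n.
have [h1 [hh1 p1]] := @pole_infinity R s q1.1 q1.2 hs s0n.
have [h2 [hh2 p2]] := @pole_infinity R s q2.1 q2.2 hs s0n.
have hid := @hol_id K 0.
exists (fun z => chart_inf 3 (z, s z)), (fun z => h1 z + h2 z - l1 * z / s z - l2 / s z).
split; rewrite ?E.
- by rewrite /= /chart_inf /= eqxx s0.
- apply/nbhs_inf; apply: filterS su => -[u v] /=; rewrite hornerXn => H.
  by rewrite uco_chart => /revC_chart/H /= <-.
- by apply: filterS (near_tends_uco 3 v0) => Q ? _.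
- by apply: filterS sG => u uG; rewrite uco_chart; split=> //; apply/revC_chart.
- apply: filterS (hol_near hs) => z /hol_tends sz U.
  have := @near_chart_inf R 3 (z, s z) U => N /N {}N.
  exact: (near_pair (tends_id z) sz N).
- apply: holB; last by apply: holM; [exact: hol_cst|exact: holV].
  apply: holB; last by apply: holM; [apply: holM hid; exact: hol_cst|exact: holV].
  exact: holD.
- rewrite [uco _]/=; apply: filterS3 (filterI sG snn) p1 p2 => z [zG zn] z1 z2 zx.
  have z0 : z != 0 by case: zx => // -[_ /=]; rewrite eqxx.
  have [n1 e1] := z1 z0; have [n2 e2] := z2 z0.
  have pE w : w != 0 -> chart_inf 3 (w, s w) = Aff w^-1 (s w / w ^+ 3).
    by move=> w0; rewrite /chart_inf /= (negbTE w0).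
  have Cz : C (chart_inf 3 (z, s z)) by apply/revC_chart.
  rewrite pE // in Cz *; split.
    by split=> //=; rewrite mulf_neq0 // invr_eq0 expf_neq0.
  exists (- z ^- 2); split.
  + by rewrite oppr_eq0 invr_eq0 expf_neq0.
  + have := sdV z0 (sd_id z); rewrite mulN1r; apply: sd_near.
    by apply: filterS (hol_neq0 (@hol_id K z) z0) => w w0; rewrite pE.
  + rewrite omegaM dP e1 e2 subr0.
    have -> : (-1)%:~R = -1 :> K by [].
    field; rewrite ?zn ?z0 ?two_neq0 //.
- move=> _; split.
    by apply: filterS filterT => z _; exists 1; apply: sd_ext (sd_id z) => w; rewrite uco_chart.
  have hd : hol (fun z => t' * z ^+ 2 - 1) 0.
    apply: holB; last exact: hol_cst.
    by apply: holM; [exact: hol_cst|exact: holX].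
  have d0 : t' * 0 ^+ 2 - 1 != 0 :> K by rewrite expr0n /= mulr0 sub0r oppr_eq0 oner_eq0.
  (* The coordinate of E at infinity is y divided by the square of the abscissa. Here the abscissa
     is [t' - 1/z^2] and y is [s z / z^3], so it equals [z] times this function. *)
  exists (fun z => s z / (t' * z ^+ 2 - 1) ^+ 2); split.
  + apply: holM hs _; apply: holV; last exact: holX.
    by rewrite expf_neq0.
  + by rewrite mulf_neq0 // invr_eq0 expf_neq0.
  + apply: filterS (hol_neq0 hd d0) => z zd.
    have [->|z0] := eqVneq z 0.
      by rewrite /chart_inf /= !eqxx /= !subrr mul0r.
    rewrite /chart_inf /= (negbTE z0) /= eqxx /= !subr0.
    have e : t' - z^-1 ^+ 2 = (t' * z ^+ 2 - 1) / z ^+ 2 by field.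
    by rewrite e; field; rewrite zd z0.
Qed.

Lemma chart_exists (P : surf R 3) : C P -> exists phi h, chart P phi h.
Proof.
case: P => [x y|v]; last exact: chart_infinity.
by have [->|y0] := eqVneq y 0; [exact: chart_branch|move=> CP; exact: chart_regular].
Qed.

End Charts.

(** * The multiplicative cocycle of omega on C *)

Lemma sd_exprz (K : numFieldType) (m : int) (z : K) : z != 0 ->
  sd (fun w => w ^ m) z (m%:~R / z * z ^ m).
Proof.
move=> z0; case: m => n.
  apply: sdS (sdX n (sd_id z)); rewrite mul1r -mulr_natl; case: n => [|n]; first by rewrite !mul0r.
  by rewrite -exprnP -pmulrn /= exprS mulrA divfK.
have zn : z ^+ n.+1 != 0 by rewrite expf_neq0.
apply: (@sd_ext _ (fun w => (w ^+ n.+1)^-1)) => //.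
have H := @sdV K (fun w => w ^+ n.+1) z _ zn (sdX n.+1 (sd_id z)).
apply: sdS H.
rewrite NegzE /= -exprnN mul1r rmorphN /= -pmulrn.
rewrite /exprz /= !mulNr; congr (- _).
rewrite -(mulr_natl (z ^+ n)) (_ : z ^+ n.+1 = z * z ^+ n) ?exprS //.
by field; rewrite z0 expf_neq0.
Qed.

Lemma CexpK (R : realType) (c v : Cx R) : c * Cexp v * Cexp (- v) = c.
Proof. by rewrite -mulrA (mulrC (Cexp v)) CexpN mulr1. Qed.

Section HasDeriv.
Context (R : realType) (k : nat) (X : set (surf R k)).
Local Notation K := (Cx R).

(** Both [G] and [tau] are read in an auxiliary coordinate [m] that is injective around [Q]; the
    derivative is the quotient of their derivatives in [m]. *)
Lemma has_deriv_param (tau G m : surf R k -> K) (g c : K -> K) Q l d :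
  (\forall Q' \near Q, X Q' -> G Q' = g (m Q') /\ tau Q' = c (m Q')) -> X Q ->
  (forall U, nbhs (m Q) U -> \forall Q' \near Q, X Q' -> U (m Q')) ->
  (\forall Q' \near Q^', X Q' -> m Q' != m Q) ->
  sd g (m Q) l -> sd c (m Q) d -> d != 0 -> has_deriv X tau G Q (l / d).
Proof.
move=> E XQ mc minj gl cd d0.
have [gQ tQ] := nbhs_singleton E XQ.
have mcvg : m Q' @[Q' --> within X Q^'] --> (m Q)^'.
  move=> U HU; have := mc _ HU; rewrite /within /= => N.
  have N' : \forall Q' \near Q^', X Q' -> m Q' != m Q -> U (m Q') by exact: cvg_within N.
  suff : \forall Q' \near Q^', X Q' -> U (m Q') by [].
  by apply: filterS2 N' minj => Q' h1 h2 XQ'; apply: h1 => //; exact: h2.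
pose proof (tendsM (sd_cvg gl) (tendsV d0 (sd_cvg cd))) as H.
have H1 : tends (within X Q^') (fun Q' => (g (m Q') - g (m Q)) / (m Q' - m Q) /
     ((c (m Q') - c (m Q)) / (m Q' - m Q))) (l / d).
  by move=> U HU; exact: (mcvg _ (H _ HU)).
apply: tends_near H1.
have E' : \forall Q' \near Q^', X Q' -> G Q' = g (m Q') /\ tau Q' = c (m Q') by exact: cvg_within E.
suff : \forall Q' \near Q^', X Q' -> (g (m Q') - g (m Q)) / (m Q' - m Q) /
     ((c (m Q') - c (m Q)) / (m Q' - m Q)) = (G Q' - G Q) / (tau Q' - tau Q) by [].
apply: filterS2 E' minj => Q' h1 h2 XQ'.
have [-> ->] := h1 XQ'; rewrite gQ tQ.
have mn : m Q' - m Q != 0 by rewrite subr_eq0; exact: h2.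
by rewrite invf_div mulrA divfK.
Qed.

End HasDeriv.

Section Sigma.
Context (R : realType) (t t' vinf : Cx R) (q1 q2 : Cx R * Cx R) (l1 l2 : Cx R).
Local Notation K := (Cx R).
Local Notation C := (curveC t t').
Local Notation om := (omega q1 q2 l1 l2).
Local Notation tau := (@loc_coord R 3).
Local Notation Cgen := (Cgen t t' q1 q2).
Local Notation chart := (chart t t' vinf q1 q2 l1 l2).
Local Notation dL := (divL q1 q2 vinf).
Hypotheses (t0 : t != 0) (t1 : t != 1) (t'0 : t' != 0) (t'1 : t' != 1) (tt' : t != t').
Hypotheses (vinfE : vinf ^+ 2 = -1).
Hypotheses (q1C : C (Aff q1.1 q1.2)) (q2C : C (Aff q2.1 q2.2)).

Record sigma_spec (s : surf R 3 -> surf R 3 -> K) (P : surf R 3) (phi : K -> surf R 3)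
    (h W : K -> K) : Prop := {
  ss_chart : chart P phi h;
  ss_W0 : W (tau P P) = 0;
  ss_W : \forall w \near (tau P P), sd W w (h w);
  ss_E : forall Q, s P Q = if Q == P then 1 else
     (tau P Q - tau P P) ^ (- dL P) * Cexp (- W (tau P Q)) }.

(* s P Q is the ratio of the values at Q and P of a branch of exp(- \int omega);
   its value at Q = P is normalized to 1 even when P is a pole of omega. *)
Lemma sigma_exists : exists s, forall P, C P -> exists phi h W, sigma_spec s P phi h W.
Proof.
have H P : exists p : (K -> surf R 3) * (K -> K) * (K -> K), C P ->
    [/\ chart P p.1.1 p.1.2, p.2 (tau P P) = 0 & \forall w \near (tau P P), sd p.2 w (p.1.2 w)].
  have [CP|nCP] := pselect (C P); last by exists ((fun=> P), (fun=> 0), (fun=> 0)).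
  have [phi [h ch]] := chart_exists l1 l2 t0 t1 t'0 t'1 tt' vinfE q1C q2C CP.
  have [W [W0 dW]] := local_primitive (ch_hol ch).
  by exists (phi, h, W).
have [f Hf] := choice H.
exists (fun P Q => if Q == P then 1 else
     (tau P Q - tau P P) ^ (- dL P) * Cexp (- (f P).2 (tau P Q))) => P CP.
by have [h1 h2 h3] := Hf P CP; exists (f P).1.1, (f P).1.2, (f P).2; split.
Qed.

Context (s : surf R 3 -> surf R 3 -> K).
Hypothesis sE : forall P, C P -> exists phi h W, sigma_spec s P phi h W.

Lemma sigma_id P : C P -> s P P = 1.
Proof. by move=> /sE[phi [h [W H]]]; rewrite (ss_E H) eqxx. Qed.

Lemma chart_inj P phi h : chart P phi h -> \forall Q \near P, C Q -> Q != P -> tau P Q != tau P P.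
Proof.
move=> ch; apply: filterS (ch_inv ch) => Q H CQ; apply: contraNneq => e.
by rewrite -(H CQ) e (ch_0 ch).
Qed.

Lemma sigma_neq0 P : C P -> \forall Q \near P, C Q -> s P Q != 0.
Proof.
move=> /sE[phi [h [W H]]]; apply: filterS (chart_inj (ss_chart H)) => Q HQ CQ.
rewrite (ss_E H); case: (eqVneq Q P) => [_|QP]; first exact: oner_neq0.
by rewrite mulf_neq0 ?Cexp_neq0 // expfz_neq0 // subr_eq0; exact: HQ.
Qed.

Lemma chart_coordP P phi h : chart P phi h -> C P -> tends (nbhs P) (tau P) (tau P P).
Proof. by move=> ch CP; exact: (nbhs_singleton (ch_coord ch) CP). Qed.

Lemma near_Cgen P : C P -> \forall Q \near P, C Q -> Q != P -> Cgen Q.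
Proof.
move=> CP; have [phi [h [W H]]] := sE CP; have ch := ss_chart H.
have N := chart_coordP ch CP (ch_form ch).
have N' : \forall Q \near P, (tau P Q != tau P P) \/ Cgen P ->
   Cgen (phi (tau P Q)).
  have N0 : \forall Q \near P, (tau P Q != tau P P) \/ Cgen P -> Cgen (phi (tau P Q)) /\
     exists d, [/\ d != 0, sd (fun w => xco (phi w)) (tau P Q) d
      & om (phi (tau P Q)) * d = (dL P)%:~R / (tau P Q - tau P P) + h (tau P Q)] := N.
  by apply: filterS N0 => Q HQ /HQ[].
apply: filterS3 N' (chart_inj ch) (ch_inv ch) => Q h1 h2 h3 CQ QP.
by rewrite -(h3 CQ); apply: h1; left; exact: h2.
Qed.

Lemma Cgen_divL Q : Cgen Q -> dL Q = 0.
Proof.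
case: Q => [x y|v] [CQ /= yn x1 x2]; last by rewrite eqxx in yn.
by rewrite /divL !aff_eq !aff_inf (negbTE x1) (negbTE x2).
Qed.

Lemma Cgen_tau Q : Cgen Q -> tau Q = @xco R 3.
Proof. by case: Q => [x y|v] [CQ /= yn x1 x2]; [rewrite (negbTE yn)|rewrite eqxx in yn]. Qed.

Lemma sigma_gen Q : Cgen Q -> exists W : K -> K, W (xco Q) = 0 /\ \forall Q' \near Q, C Q' ->
  [/\ sd W (xco Q') (om Q'), s Q Q' = Cexp (- W (xco Q')), tends (nbhs Q') (@xco R 3) (xco Q')
    & \forall Q'' \near Q', C Q'' -> Q'' != Q' -> xco Q'' != xco Q'].
Proof.
move=> gQ; have CQ : C Q by case: gQ.
have [phi [h [W H]]] := sE CQ; have ch := ss_chart H.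
have E := Cgen_tau gQ; have n0 := Cgen_divL gQ.
have tc := chart_coordP ch CQ.
exists W; rewrite -E; split; first exact: ss_W0 H.
have N : \forall z \near (tau Q Q), sd W z (h z) /\ h z = om (phi z).
  apply: filterS3 (ss_W H) (ch_form ch) (near_join (ch_curve ch)) => z dW F c.
  split=> //; have [_ [d [_ sd1 e]]] := F (or_intror gQ).
  have d1 : d = 1.
    apply: sd_uniq sd1 _; apply: sd_near (sd_id z).
    by apply: filterS c => w [_]; rewrite E.
  by move: e; rewrite d1 n0 mulr1 mul0r add0r.
have N1 := tc _ N; have N1' : \forall Q' \near Q, sd W (tau Q Q') (h (tau Q Q')) /\
   h (tau Q Q') = om (phi (tau Q Q')) by exact: N1.
apply: filterS3 N1' (near_join (ch_inv ch)) (ch_coord ch) => Q' [d1 d2] i1 c1 CQ'.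
have i2 := nbhs_singleton i1 CQ'.
split.
- by rewrite i2 in d2; rewrite -d2.
- rewrite (ss_E H) n0 oppr0 expr0z mul1r; case: eqP => // ->.
  by rewrite (ss_W0 H) oppr0 Cexp0.
- exact: c1.
- apply: filterS i1 => Q'' i3 CQ''; apply: contraNneq => e.
  by rewrite -(i3 CQ'') e i2.
Qed.

(** Only generic [Q] different from [P] matter. There [f], the candidate [s P Q'] divided by
    [s Q Q'], has zero logarithmic derivative, since both are built from primitives of omega; it is
    constant and is evaluated at [Q]. *)
Lemma sigma_cocycle P : C P -> \forall Q \near P, C Q -> \forall Q' \near Q, C Q' ->
  s P Q * s Q Q' = s P Q'.
Proof.
move=> CP; have [phi [h [W H]]] := sE CP; have ch := ss_chart H.
have tc := chart_coordP ch CP.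
pose z0 := tau P P; pose n := dL P.
have N1 : \forall Q \near P, \forall z \near (tau P Q), sd W z (h z) by exact: (tc _ (near_join (ss_W H))).
have N2 : \forall Q \near P, \forall z \near (tau P Q), z != z0 -> C (phi z) /\
    exists d, sd (fun w => xco (phi w)) z d /\ om (phi z) * d = n%:~R / (z - z0) + h z.
  have X : \forall z \near z0, z != z0 -> C (phi z) /\
    exists d, sd (fun w => xco (phi w)) z d /\ om (phi z) * d = n%:~R / (z - z0) + h z.
    apply: filterS (ch_form ch) => z F zz; have [[Cz _ _ _] [d [_ sd1 e]]] := F (or_introl zz).
    by split=> //; exists d.
  exact: (tc _ (near_join X)).
have N3 : \forall Q \near P, forall U, nbhs (phi (tau P Q)) U -> \forall z' \near (tau P Q), U (phi z').
  exact: (tc _ (ch_cont ch)).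
have N4 : \forall Q \near P, \forall Q' \near Q, C Q' -> phi (tau P Q') = Q' by exact: near_join (ch_inv ch).
have N5 : \forall Q \near P, \forall Q' \near Q, C Q' -> Q' != P -> tau P Q' != tau P P.
  exact: near_join (chart_inj ch).
apply: filterS3 (filterI N1 N2) (filterI N3 N4)
  (filterI (filterI N5 (ch_coord ch)) (near_Cgen CP)) => Q [k1 k2] [k3 k4] [[k5 k6] k7] CQ.
have [->|QP] := eqVneq Q P.
  by apply: filterS filterT => Q' _ _; rewrite sigma_id // mul1r.
have gQ := k7 CQ QP; have tcQ := k6 CQ.
have zQ : tau P Q != z0 by exact: (nbhs_singleton k5).
have pQ : phi (tau P Q) = Q by exact: (nbhs_singleton k4).
have [V [V0 HV]] := sigma_gen gQ.
pose f z := (z - z0) ^ (- n) * Cexp (- W z) * Cexp (V (xco (phi z))).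
have NV : \forall z \near (tau P Q), C (phi z) -> sd V (xco (phi z)) (om (phi z)).
  have X : \forall Q' \near Q, C Q' -> sd V (xco Q') (om Q') by apply: filterS HV => Q' HQ /HQ[].
  by rewrite -{1}pQ in X; exact: k3 X.
have Nz : \forall z \near (tau P Q), z != z0.
  have X := hol_neq0 (holB (@hol_id K (tau P Q)) (@hol_cst K z0 (tau P Q))).
  have Y : tau P Q - z0 != 0 by rewrite subr_eq0.
  by apply: filterS (X Y) => z; rewrite subr_eq0.
have fc : \forall z \near (tau P Q), f z = f (tau P Q).
  apply: sd0_const; apply: filterS3 (filterI k1 k2) NV Nz => z [dW F] dV zz.
  have [Cz [d [dx e]]] := F zz.
  have zz0 : z - z0 != 0 by rewrite subr_eq0.
  have D1 := sd_comp (sdB (sd_id z) (sd_cst z0 z)) (sd_exprz (- n) zz0).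
  have D2 := sd_comp (sdN dW) (sd_Cexp (- W z)).
  have D3 := sd_comp (sd_comp dx (dV Cz)) (sd_Cexp (V (xco (phi z)))).
  apply: sdS (sdM (sdM D1 D2) D3).
  by rewrite e rmorphN /=; ring.
have Nf := tcQ _ fc.
have Nf' : \forall Q' \near Q, f (tau P Q') = f (tau P Q) by exact: Nf.
have NP : \forall Q' \near Q, tau P Q' != z0 by exact: (tcQ _ Nz).
apply: filterS3 (filterI Nf' NP) k4 HV => Q' [e1 e2] e3 e4 CQ'.
have [_ -> _ _] := e4 CQ'.
have Q'P : Q' != P by apply: contraNneq e2 => ->.
rewrite !(ss_E H) (negbTE QP) (negbTE Q'P) -/n -/z0.
move: e1; rewrite /f (e3 CQ') pQ V0 Cexp0 mulr1 => <-.
exact: CexpK.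
Qed.

Definition C_transport (P Q : surf R 3) (c : K) : K := c * s P Q.

(** The base is all of C: the homotopies used for periods may cross poles of omega, and
    [circle_transport] contracts a loop onto a ramification point. *)
Lemma C_system : local_system C (fun P => [set c | c != 0]) C_transport.
Proof.
split=> [P c CP _|P CP]; first by rewrite /C_transport sigma_id // mulr1.
apply: filterS2 (sigma_neq0 CP) (sigma_cocycle CP) => Q h1 h2 CQ.
have s0 := h1 CQ; split.
- by move=> c /= c0; rewrite mulf_neq0.
- by move=> c c' _ _ /(mulIf s0).
- move=> c /= c0; exists (c / s P Q); rewrite /C_transport ?divfK //=.
  by rewrite mulf_neq0 ?invr_eq0.
- by apply: filterS (h2 CQ) => Q' h CQ' c _; rewrite /C_transport -mulrA h.
Qed.

End Sigma.

(** * The double cover f and its sheets *)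

Lemma box_near (R : realType) (x y : Cx R) (P : set (Cx R * Cx R)) :
  (\forall p \near ((x, y) : Cx R * Cx R), P p) -> exists2 e : R, 0 < e &
     forall u v, mod (u - x) < e -> mod (v - y) < e -> P (u, v).
Proof.
move=> [[A B] /= [/nbhs_mod[e e0 eA] /nbhs_mod[e' e'0 eB]] AB].
exists (Num.min e e'); first by rewrite lt_min e0.
move=> v w; rewrite !lt_min => /andP[v1 _] /andP[_ w2].
by apply: AB; split=> /=; [exact: eA|exact: eB].
Qed.

Lemma near_box (R : realType) (x y : Cx R) (P Q : set (Cx R)) :
  (\forall u \near x, P u) -> (\forall v \near y, Q v) ->
  \forall p \near ((x, y) : Cx R * Cx R), P p.1 /\ Q p.2.
Proof. by move=> HP HQ; exists (P, Q). Qed.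

Lemma mod_sqr_lt (R : realType) (x y : Cx R) (e : R) : 0 < e ->
  mod (x ^+ 2 - y ^+ 2) < e ^+ 2 -> mod (x - y) < e \/ mod (- x - y) < e.
Proof.
move=> e0; have [h|h] := ltP (mod (x - y)) e; first by left.
have [h'|h'] := ltP (mod (- x - y)) e; first by right.
have -> : x ^+ 2 - y ^+ 2 = - ((x - y) * (- x - y)) by ring.
rewrite modN modM => /(le_lt_trans (ler_pM (ltW e0) (ltW e0) h h')).
by rewrite -expr2 ltxx.
Qed.

Lemma horner_cubic (K : fieldType) (t x : K) :
  ('X * ('X - 1) * ('X - t%:P)).[x] = x * (x - 1) * (x - t).
Proof. by rewrite !hornerE. Qed.

Section Cover.
Context (R : realType) (t t' y0 vinf : Cx R).
Local Notation K := (Cx R).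
Local Notation C := (curveC t t').
Local Notation E := (curveE t).
Local Notation cov := (coverf t').
Local Notation A := (Epunct t t' y0).
Hypotheses (y0E : y0 ^+ 2 = t' * (t' - 1) * (t' - t)) (vinfE : vinf ^+ 2 = -1).

Lemma polyEE x : (polyE t).[x] = x * (x - 1) * (x - t).
Proof. exact: horner_cubic. Qed.

Lemma polyE_coef : (polyE t)`_(2 * 2)%N = 0.
Proof.
have -> : polyE t = 'X^3 - (1 + t)%:P * 'X^2 + t%:P * 'X.
  by rewrite /polyE polyCD polyC1; ring.
by rewrite !coefE /= !mulr0 subr0 addr0.
Qed.

Lemma polyE_cover x : (polyE t).[t' - x ^+ 2] = (polyC2 t t').[x].
Proof. by rewrite polyEE polyC2E; ring. Qed.

Definition unramified (P : surf R 3) : Prop := forall y, P <> Aff 0 y.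

Lemma curve_iota Q : C Q -> C (iotaC Q).
Proof.
case: Q => [x y|v] /=; last by rewrite sqrrN.
by move=> ->; rewrite -!polyE_cover sqrrN.
Qed.

Lemma cov_iota Q : cov (iotaC Q) = cov Q.
Proof. by case: Q => [x y|v] //=; rewrite sqrrN. Qed.

Lemma iotaK Q : iotaC (iotaC Q) = Q :> surf R 3.
Proof. by case: Q => [x y|v] /=; rewrite opprK. Qed.

Lemma unramified_iota Q : unramified Q -> unramified (iotaC Q).
Proof.
case: Q => [x y|v] // H y' /= [e1 e2]; apply: (H y).
by congr Aff; apply/eqP; rewrite -oppr_eq0 e1.
Qed.

Lemma cov_fiber Q Q' : C Q -> C Q' -> cov Q = cov Q' -> Q' = Q \/ Q' = iotaC Q.
Proof.
case: Q Q' => [x y|v] [x' y'|v'] //=.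
  move=> _ _ [/addrI/oppr_inj/esym/eqP]; rewrite eqf_sqr => /orP[]/eqP -> ->; by [left|right].
move=> vE v'E _; have /eqP : v' ^+ 2 = v ^+ 2 by rewrite vE v'E.
by rewrite eqf_sqr => /orP[]/eqP ->; [left|right].
Qed.

Lemma cov_surj q : E q -> exists2 Q, C Q & cov Q = q.
Proof.
case: q => [x y|v] /= H.
  exists (Aff (sqrtC (t' - x)) y) => /=.
    by rewrite -polyE_cover sqrtCK subKr.
  by rewrite sqrtCK subKr.
exists (Inf vinf); first by rewrite /= polyC2_coef.
rewrite polyE_coef in H; congr Inf; apply/esym/eqP.
by rewrite -sqrf_eq0 H.
Qed.

Lemma inf_mod (v : K) : C (Inf v) -> mod v = 1.
Proof.
rewrite /= polyC2_coef => e; have : mod v ^+ 2 = 1 by rewrite expr2 -modM -expr2 e modN mod1.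
by move=> /eqP; rewrite sqrf_eq1 => /orP[]/eqP // e'; have := mod_ge0 v; rewrite e'; lra.
Qed.

(* A neighbourhood of P on which f is injective. *)
Definition sheet (P Q : surf R 3) : Prop :=
  match P with
  | Aff x _ => mod (xco Q - x) < mod x
  | Inf v => mod (vco Q - v) < 1
  end.

Lemma xco_iota Q : xco (iotaC Q) = - xco Q :> K.
Proof. by case: Q => [x y|v] //=; rewrite oppr0. Qed.

Lemma vco_iota Q : vco (iotaC Q) = - vco Q :> K.
Proof.
case: Q => [x y|v] //=; have -> : (- x) ^+ 3 = - x ^+ 3 by ring.
by rewrite invrN mulrN.
Qed.

(** The coordinates of [Q] and [iotaC Q] are opposite, so their differences with that of [P] add up
    to minus twice the latter; they cannot both be shorter than it. *)
Lemma sheet_disjoint P Q : C P -> sheet P Q -> sheet P (iotaC Q) -> False.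
Proof.
case: P => [x y|v] CP /=; rewrite ?xco_iota ?vco_iota.
  set z := xco Q => h1 h2; have := modD (z - x) (- z - x).
  have -> : z - x + (- z - x) = - (2%:R%:C%C * x) by rewrite rmorph_nat; ring.
  by rewrite modN modM mod_real normr_nat; lra.
set z := vco Q => h1 h2; have := modD (z - v) (- z - v).
have -> : z - v + (- z - v) = - (2%:R%:C%C * v) by rewrite rmorph_nat; ring.
by rewrite modN modM mod_real normr_nat (inf_mod CP); lra.
Qed.

Lemma sheet_iota P Q : sheet P (iotaC Q) -> sheet (iotaC P) Q.
Proof.
case: P => [x y|v] /=; rewrite ?xco_iota ?vco_iota -modN opprD !opprK ?modN //.
Qed.

Lemma sheet_inj P Q Q' : C P -> C Q -> C Q' -> sheet P Q -> sheet P Q' ->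
  cov Q = cov Q' -> Q = Q'.
Proof.
move=> CP CQ CQ' s1 s2 /(cov_fiber CQ CQ')[//|e]; rewrite e in s2.
by have := sheet_disjoint CP s1 s2.
Qed.

Lemma sheet_near P : unramified P -> \forall Q \near P, sheet P Q.
Proof.
case: P => [x y|v] uP /=.
  have x0 : 0 < mod x by rewrite mod_gt0; apply/eqP => e; apply: (uP y); rewrite e.
  by have /cvg_mod/(_ _ x0) := @tends_xco R 3 x y.
by have /cvg_mod/(_ _ ltr01) := @tends_vco R 3 v.
Qed.

(** Openness of f, stated on fibres: the coordinates on E determine those on C up to the involution,
    and nearby squares have nearby roots up to sign. *)
Lemma cov_open P (V : set (surf R 3)) : C P -> nbhs P V ->
  \forall q \near (cov P), forall Q, C Q -> cov Q = q -> V Q \/ V (iotaC Q).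
Proof.
case: P => [x0 y1|v0] CP.
  move=> /nbhs_aff/box_near[e e0 HV]; apply/nbhs_aff.
  have e20 : 0 < e ^+ 2 by rewrite exprn_gt0.
  have N1 : \forall u \near (t' - x0 ^+ 2), mod (u - (t' - x0 ^+ 2)) < e ^+ 2.
    by apply/nbhs_mod; exists (e ^+ 2).
  have N2 : \forall u \near y1, mod (u - y1) < e by apply/nbhs_mod; exists e.
  apply: filterS (near_box N1 N2) => -[X Y] /= [h1 h2] [x y|v] // CQ [eX eY].
  rewrite -eX -modN in h1.
  have {}h1 : mod (x ^+ 2 - x0 ^+ 2) < e ^+ 2.
    by move: h1; congr (mod _ < _); ring.
  rewrite -eY in h2.
  by case: (mod_sqr_lt e0 h1) => h; [left|right]; apply: (HV _ _ h h2).
move=> NV; have VP : V (Inf v0) by exact: nbhs_singleton NV.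
move: NV => /nbhs_inf/box_near[e e0 HV]; apply/nbhs_inf.
have e20 : 0 < e ^+ 2 by rewrite exprn_gt0.
have hd : hol (fun U => t' * U - 1) (0 : K).
  by apply: holB; [apply: holM; [exact: hol_cst|exact: hol_id]|exact: hol_cst].
have d0 : t' * 0 - 1 != 0 :> K by rewrite mulr0 sub0r oppr_eq0 oner_eq0.
(* If [U] is the coordinate 1/x of E, then [g U] is [1/xi^2] and [r (g U)] is the square of [v].
   Since [1/xi] is close to 0 with either sign, only the sign of [v] decides between [Q] and
   [iotaC Q]. *)
pose g (U : K) := U / (t' * U - 1).
have hg : hol g 0 by apply: holM; [exact: hol_id|exact: holV].
pose r (w : K) := (t' * w - 1) * ((t' - 1) * w - 1) * ((t' - t) * w - 1).
have hr : hol (fun U => r (g U)) 0.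
  have lin c : hol (fun U => c * g U - 1) 0.
    by apply: holB; [apply: holM hg; exact: hol_cst|exact: hol_cst].
  by apply: holM; [apply: holM|]; exact: lin.
have g0 : g 0 = 0 by rewrite /g mul0r.
have r0 : r (g 0) = -1 by rewrite g0 /r !mulr0; ring.
have N1 : \forall U \near (0 : K), mod (g U - 0) < e ^+ 2.
  by have /cvg_mod/(_ _ e20) := hol_tends hg; rewrite g0.
have N2 : \forall U \near (0 : K), mod (r (g U) - (-1)) < e ^+ 2.
  by have /cvg_mod/(_ _ e20) := hol_tends hr; rewrite r0.
have N3 := hol_neq0 hd d0.
have NT : \forall U \near (0 : K), True by exact: filterT.
apply: filterS (near_box (filterI N1 (filterI N2 N3)) NT) => -[U Y] /= [[h1 [h2 h3]] _] [x y|v] CQ.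
  move=> /= covE.
  have U0 : U != 0 by apply/eqP => e'; move: covE; rewrite /chart_inf /= e' eqxx.
  move: covE; rewrite /chart_inf /= (negbTE U0) => -[eX _].
  have x2 : x ^+ 2 = (t' * U - 1) / U.
    have -> : x ^+ 2 = t' - U^-1 by rewrite -eX; ring.
    by field.
  have xn : x != 0 by rewrite -sqrf_eq0 x2 mulf_neq0 // invr_eq0.
  have gU : g U = x^-1 ^+ 2 by rewrite exprVn x2 /g invf_div.
  have CQ' : C (chart_inf 3 (x^-1, y / x ^+ 3)) by rewrite (@chart_affE R 3 (x, y)).
  have v2 : (y / x ^+ 3) ^+ 2 = r (g U) by move: CQ' => /revC_chart ->; rewrite revCE /r gU.
  have m1 : mod (x^-1 - 0) < e.
    have := @mod_sqr_lt R x^-1 0 e e0; rewrite -gU expr0n => /(_ h1).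
    by rewrite !subr0 modN => -[].
  have v0E : v0 ^+ 2 = -1 by rewrite -(polyC2_coef t t').
  have := @mod_sqr_lt R (y / x ^+ 3) v0 e e0; rewrite v2 v0E => /(_ h2)[] m2.
    by left; have := HV _ _ m1 m2; rewrite /= (@chart_affE R 3 (x, y)).
  right; have m1' : mod (- x^-1 - 0) < e by rewrite subr0 modN -(subr0 x^-1).
  have := HV _ _ m1' m2; rewrite /=.
  have xn' : (- x) != 0 by rewrite oppr_eq0.
  have -> : (- x^-1, - (y / x ^+ 3)) = ((- x)^-1, y / (- x) ^+ 3).
    by congr pair; field.
  by rewrite (@chart_affE R 3 (- x, y)).
move=> _; case: (@cov_fiber (Inf v0) (Inf v) CP CQ erefl) => ->; first by left.
by right; rewrite iotaK.
Qed.

(* The inverse of f on the sheet of P, extended by the junk value P. *)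
Definition lift (P : surf R 3) (q : surf R 2) : surf R 3 :=
  xget P [set Q | [/\ C Q, cov Q = q & sheet P Q]].

Lemma lift_eq P Q : C P -> C Q -> sheet P Q -> lift P (cov Q) = Q.
Proof.
move=> CP CQ sPQ; apply: xget_unique => // Q' [CQ' e sQ'].
exact: sheet_inj CP CQ' CQ sQ' sPQ e.
Qed.

Lemma lift_near P (V : set (surf R 3)) : C P -> unramified P -> nbhs P V ->
  \forall q \near (cov P), E q -> [/\ C (lift P q), cov (lift P q) = q & V (lift P q)].
Proof.
move=> CP uP NV; have N : nbhs P (fun Q => V Q /\ sheet P Q) by apply: filterI NV (sheet_near uP).
apply: filterS (cov_open CP N) => q H /cov_surj[Q CQ e].
case: (H Q CQ e) => -[VQ sQ].
  by rewrite -e lift_eq.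
by rewrite -e -cov_iota lift_eq //; [split=> //|]; exact: curve_iota.
Qed.

Lemma Epunct_unramified P : C P -> A (cov P) -> unramified P.
Proof.
move=> CP [_ nA] y e; apply: nA; move: CP; rewrite e /= expr0n /= subr0 polyC2E.
rewrite expr0n /= !subr0 -y0E => /eqP; rewrite eqf_sqr => /orP[]/eqP ->; by [left|right].
Qed.

End Cover.

(** * The direct image local system on E minus the branch points *)

Lemma near_punctured (T : topologicalType) (p : T) (X P : set T) :
  (\forall q \near p, q != p -> X q -> P q) -> \forall q \near p^', X q -> P q.
Proof. by []. Qed.

Lemma ord_geD (R : realType) (k : nat) (X : set (surf R k)) (F G : surf R k -> Cx R) m P :
  ord_ge X F m P -> ord_ge X G m P -> ord_ge X (fun Q => F Q + G Q) m P.
Proof.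
move=> [F' hF FE] [G' hG GE]; exists (fun Q => F' Q + G' Q).
  apply: filterS2 hF hG => Q H1 H2 XQ; have [d1 D1] := H1 XQ; have [d2 D2] := H2 XQ.
  exists (d1 + d2); apply: tends_ext (tendsD D1 D2) => Q' /=.
  by rewrite -mulrDl; congr (_ / _); ring.
by apply: filterS2 FE GE => Q e1 e2 XQ; rewrite e1 // e2 // mulrDl.
Qed.

Lemma hol_exprz (K : numFieldType) (f : K -> K) (m : int) z :
  hol f z -> f z != 0 -> hol (fun w => f w ^ m) z.
Proof.
move=> hf f0; apply: filterS2 hf (hol_neq0 hf f0) => w [l fl] fw.
by eexists; exact: sd_comp fl (sd_exprz m fw).
Qed.

Lemma unramified_near (R : realType) (P : surf R 3) : unramified P ->
  \forall Q \near P, unramified Q.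
Proof.
case: P => [x y|v] uP.
  have x0 : x != 0 by apply/eqP => e; apply: (uP y); rewrite e.
  pose proof (tends_neq0 (@tends_xco R 3 x y) x0) as N.
  by apply: filterS N => Q Q0 y' e; move: Q0; rewrite e /= eqxx.
apply/nbhs_inf; apply: filterS filterT => p _ y'; rewrite /chart_inf; case: eqP => // /eqP p0 [e _].
by move: p0; rewrite -invr_eq0 e eqxx.
Qed.

Section ESystem.
Context (R : realType) (t t' y0 vinf : Cx R) (q1 q2 : Cx R * Cx R) (l1 l2 : Cx R).
Local Notation K := (Cx R).
Local Notation C := (curveC t t').
Local Notation E := (curveE t).
Local Notation cov := (coverf t').
Local Notation A := (Epunct t t' y0).
Local Notation om := (omega q1 q2 l1 l2).
Local Notation tau := (@loc_coord R 3).
Local Notation Cgen := (Cgen t t' q1 q2).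
Local Notation dL := (divL q1 q2 vinf).
Local Notation lift := (lift t t').
Hypotheses (y0E : y0 ^+ 2 = t' * (t' - 1) * (t' - t)) (vinfE : vinf ^+ 2 = -1).
Context (s : surf R 3 -> surf R 3 -> K).
Hypothesis sE : forall P, C P -> exists phi h W, sigma_spec t t' vinf q1 q2 l1 l2 s P phi h W.

Lemma lift_id P : C P -> unramified P -> lift P (cov P) = P.
Proof. by move=> CP uP; apply: lift_eq => //; exact: nbhs_singleton (sheet_near uP). Qed.

Lemma lift_compat P : C P -> unramified P -> \forall q \near (cov P), E q ->
  [/\ C (lift P q), cov (lift P q) = q, unramified (lift P q), sheet P (lift P q)
    & \forall q' \near q, E q' -> lift (lift P q) q' = lift P q'].
Proof.
move=> CP uP; have N := near_join (sheet_near uP).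
apply: filterS (lift_near vinfE CP uP (filterI N (unramified_near uP))) => q H /H[CQ e [sQ uQ]].
split=> //; first exact: nbhs_singleton sQ.
have := lift_near vinfE CQ uQ sQ; rewrite {1}e.
apply: filterS => q' H' /H'[CQ' e' sQ'].
by rewrite -{2}e' lift_eq.
Qed.

(* c stands for the value at P of a branch of exp(- \int omega). *)
Definition E_fiber (p : surf R 2) : set (surf R 3 * K) :=
  [set y | [/\ C y.1, cov y.1 = p & y.2 != 0]].

Definition E_transport (p q : surf R 2) (y : surf R 3 * K) : surf R 3 * K :=
  (lift y.1 q, y.2 * s y.1 (lift y.1 q)).

Lemma E_system_near P : C P -> unramified P -> \forall q \near (cov P), E q ->
  [/\ C (lift P q), cov (lift P q) = q, s P (lift P q) != 0, sheet P (lift P q)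
    & \forall q' \near q, E q' -> lift (lift P q) q' = lift P q' /\
      s P (lift P q) * s (lift P q) (lift P q') = s P (lift P q')].
Proof.
move=> CP uP.
pose proof (filterI (sigma_neq0 sE CP) (sigma_cocycle sE CP)) as N.
apply: filterS2 (lift_near vinfE CP uP N) (lift_compat CP uP) => q H1 H2 Eq.
have [CQ e [s0 coc]] := H1 Eq; have [_ _ uQ shQ c] := H2 Eq; split=> //; first exact: s0.
have := lift_near vinfE CQ uQ (coc CQ); rewrite {1}e => N'.
apply: filterS2 N' c => q' H' c' Eq'.
have [CQ' e' coc'] := H' Eq'; have e2 := c' Eq'; split=> //.
by rewrite -e2; apply: coc'.
Qed.

Lemma E_system : local_system A E_fiber E_transport.
Proof.
split=> [p [P c] Ap [/= CP e c0]|p Ap].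
  have uP : unramified P by apply: (Epunct_unramified y0E CP); rewrite e.
  by rewrite /E_transport /= -e lift_id // (sigma_id sE CP) mulr1.
have [P CP e] := cov_surj t' vinfE Ap.1.
have uP : unramified P by apply: (Epunct_unramified y0E CP); rewrite e.
have CP' := curve_iota CP; have uP' := unramified_iota uP.
have eP' : cov (iotaC P) = p by rewrite cov_iota.
have N1 := E_system_near CP uP; have N2 := E_system_near CP' uP'.
rewrite e in N1; rewrite eP' in N2.
have N3 := cov_open CP (sheet_near uP); rewrite e in N3.
apply: filterS3 N1 N2 N3 => q H1 H2 H3 Aq.
have [C1 c1 s1 sh1 k1] := H1 Aq.1; have [C2 c2 s2 sh2 k2] := H2 Aq.1.
have fib P' c : E_fiber p (P', c) -> P' = P \/ P' = iotaC P.
  by move=> [/= CP'' e' _]; exact: (cov_fiber CP CP'' (etrans e (esym e'))).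
(* This separates the two points of the fibre and makes the transport injective on pairs. *)
have ne : lift P q <> lift (iotaC P) q.
  move=> eq; rewrite -eq in sh2.
  apply: (sheet_disjoint CP sh1).
  by have := @sheet_iota R (iotaC P) (iotaC (lift P q)); rewrite !iotaK; exact.
split.
- move=> [P' c] /[dup] /fib[] -> [_ _ /= c0]; split=> //=; exact: mulf_neq0.
- move=> [P' c] [P'' c'] F1 F2; rewrite /E_transport /=.
  case: (fib _ _ F1) => ->; case: (fib _ _ F2) => -> [].
  + by move=> /(mulIf s1) ->.
  + by move=> /ne.
  + by move=> /esym/ne.
  + by move=> /(mulIf s2) ->.
- move=> [Q c] [/= CQ eQ c0].
  have L P' : C P' -> cov P' = p -> sheet P' Q -> s P' (lift P' q) != 0 ->
      exists2 y, E_fiber p y & E_transport p q y = (Q, c).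
    move=> CP'' e'' sh sn; have lQ : lift P' q = Q by rewrite -eQ lift_eq.
    exists (P', c / s P' (lift P' q)).
      by split=> //=; rewrite mulf_neq0 ?invr_eq0.
    by rewrite /E_transport /= divfK // lQ.
  case: (H3 Q CQ eQ) => sh; first exact: (L P).
  by apply: (L (iotaC P)) => //; exact: sheet_iota.
- apply: filterS2 k1 k2 => q' m1 m2 Aq' [P' c] F'; rewrite /E_transport /=.
  by case: (fib _ _ F') => ->; [have [-> <-] := m1 Aq'.1|have [-> <-] := m2 Aq'.1]; rewrite mulrA.
Qed.

Lemma lift_in P (U : set (surf R 3)) : C P -> unramified P -> nbhs P U ->
  \forall q \near (cov P), E q -> U (lift P q).
Proof.
by move=> CP uP NU; apply: filterS (lift_near vinfE CP uP NU) => q H /H[].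
Qed.

(* Near f(P), a branch of exp(- \int omega) read on E through the sheet of P,
   possibly multiplied by 1/xi. *)
Lemma branch_ord (P : surf R 3) (c : K) (b : bool) (m : int) : C P -> unramified P ->
  m <= - dL P ->
  ord_ge E (fun q => c * s P (lift P q) * (if b then uco (lift P q) else 1)) m (cov P).
Proof.
move=> CP uP mn; have [phi [h [W H]]] := sE CP; have ch := ss_chart H.
pose z0 := tau P P; pose n := dL P.
have [hu [kap [hk k0 ke]]] := ch_cover ch uP.
have [k kE] : exists k : nat, - n - m = k%:Z.
  by exists (absz (- n - m)); rewrite gez0_abs // subr_ge0.
have hb : hol (fun z => if b then uco (phi z) else 1) z0.
  by case: b; [exact: hu|exact: hol_cst].
(* The exponent [- n] of the branch is split as [k + m]. The coordinate of E is [z - z0] times the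
   unit [kap], so taking its power [m] out leaves [kap ^ (- m)]. *)
pose g z := c * ((z - z0) ^+ k * kap z ^ (- m) * Cexp (- W z)) * (if b then uco (phi z) else 1).
have hid := @hol_id K z0.
have hz : hol (fun z => z - z0) z0 by apply: holB hid _; exact: hol_cst.
have hW : hol W z0 by apply: filterS (ss_W H) => w dW; exists (h w).
have hg : hol g z0.
  apply: holM hb.
  apply: holM; first exact: hol_cst.
  apply: holM; first by apply: holM; [exact: holX|exact: hol_exprz].
  apply: (@hol_comp K (@Cexp R) (fun z => - W z)); first exact: holN.
  by apply: filterS filterT => w _; exists (Cexp w); exact: sd_Cexp.
(* The coordinate of E at [f(P)], read in the chart of [P]. *)
pose cc z := loc_coord (cov P) (cov P) + (z - z0) * kap z.
have hcc : hol cc z0 by apply: holD; [exact: hol_cst|exact: holM].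
have [dk dkE] := nbhs_singleton hk.
have scc : sd cc z0 (kap z0).
  apply: sdS (sdD (sd_cst _ z0) (sdM (sdB (sd_id z0) (sd_cst z0 z0)) dkE)).
  by rewrite subrr; ring.
have ncc := sd_neq0_near scc k0.
pose mm q := tau P (lift P q).
have tc := chart_coordP ch CP.
have Nz : \forall q \near (cov P), E q ->
    [/\ exists l, sd g (mm q) l, exists2 d, sd cc (mm q) d & d != 0
      & loc_coord (cov P) (cov (phi (mm q))) - loc_coord (cov P) (cov P) = (mm q - z0) * kap (mm q)].
  have X : \forall z \near z0, [/\ exists l, sd g z l, exists2 d, sd cc z d & d != 0
      & loc_coord (cov P) (cov (phi z)) - loc_coord (cov P) (cov P) = (z - z0) * kap z].
    apply: filterS3 hg (filterI hcc ncc) ke => z h1 [[d h2] h3] h4; split=> //.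
    by exists d => //; exact: h3.
  exact: (lift_in CP uP (tc _ X)).
have Ni : \forall q \near (cov P), E q -> C (lift P q) -> phi (mm q) = lift P q.
  exact: (lift_in CP uP (ch_inv ch)).
have Nc : \forall q \near (cov P), E q -> C (lift P q) -> tends (nbhs (lift P q)) (tau P) (mm q).
  exact: (lift_in CP uP (ch_coord ch)).
have Nl := lift_compat CP uP.
have Nk : \forall q \near (cov P), E q -> kap (mm q) != 0.
  exact: (lift_in CP uP (tc _ (hol_neq0 hk k0))).
exists (fun q => g (mm q)).
  apply: filterS3 (near_join (filterI Nz Nl)) (near_join Ni) (filterI Nc Nl) => q A1 A2 [A3 A4] Eq.
  have [CQ eQ uQ shQ cQ] := A4 Eq.
  have [[l dg] [d dc d0] _] := (nbhs_singleton A1).1 Eq.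
  have D1 : \forall q' \near q, E q' -> g (mm q') = g (mm q') /\ loc_coord (cov P) q' = cc (mm q').
    apply: filterS2 A1 A2 => q' [B1 B2] B3 Eq'; split=> //.
    have [CQ' eQ' _ _ _] := B2 Eq'; have [_ _ e] := B1 Eq'.
    by rewrite /cc -e B3 // eQ' addrC subrK.
  have D2 U : nbhs (mm q) U -> \forall q' \near q, E q' -> U (mm q').
    move=> HU; have T := A3 Eq CQ _ HU.
    have := lift_in CQ uQ T; rewrite eQ => T'.
    by apply: filterS2 T' cQ => q' T2 c2 Eq'; rewrite /mm -(c2 Eq'); exact: T2.
  have D3 : \forall q' \near q^', E q' -> mm q' != mm q.
    have pq := (nbhs_singleton A2) Eq CQ.
    apply: near_punctured; apply: filterS2 A1 A2 => q' [_ B2] B3 qq' Eq'.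
    have [CQ' eQ' _ _ _] := B2 Eq'.
    apply: contraNneq qq' => e.
    by rewrite -eQ' -(B3 Eq' CQ') e pq eQ.
  by exists (l / d); exact: (has_deriv_param D1 Eq D2 D3 dg dc d0).
pose proof (filterI Nz (filterI Nk Ni)) as Nt.
suff N : \forall q \near (cov P), E q -> q != cov P ->
  c * s P (lift P q) * (if b then uco (lift P q) else 1) =
    g (mm q) * (loc_coord (cov P) q - loc_coord (cov P) (cov P)) ^ m.
  by apply: near_punctured; apply: filterS N => q N' qP Eq; exact: N'.
apply: filterS2 Nt Nl => q [A1 [A2 A3]] A4 Eq qP.
have [CQ eQ _ _ _] := A4 Eq; have [_ _ e] := A1 Eq; have k0' := A2 Eq.
have pQ := A3 Eq CQ.
have QP : lift P q != P by apply: contraNneq qP => e'; rewrite -eQ e'.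
have z0' : mm q - z0 != 0.
  rewrite subr_eq0; apply: contraNneq QP => e'.
  by rewrite -pQ e' (ch_0 ch).
rewrite pQ eQ in e; rewrite e (ss_E H) (negbTE QP) /g pQ -/n -/z0 -/(mm q).
have -> : (mm q - z0) ^ (- n) = (mm q - z0) ^+ k * (mm q - z0) ^ m.
  by rewrite exprnP -kE -expfzDr // subrK.
have -> : ((mm q - z0) * kap (mm q)) ^ m = (mm q - z0) ^ m * kap (mm q) ^ m.
  by rewrite exprzMl // unitfE.
have -> : kap (mm q) ^ (- m) = (kap (mm q) ^ m)^-1 by rewrite invr_expz.
have km : kap (mm q) ^ m != 0 by rewrite expfz_neq0.
by field.
Qed.

End ESystem.

(** * Periods as multipliers of the transport on C *)

Section Period.
Context (R : realType) (t t' y0 vinf : Cx R) (q1 q2 : Cx R * Cx R) (l1 l2 : Cx R).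
Local Notation K := (Cx R).
Local Notation C := (curveC t t').
Local Notation cov := (coverf t').
Local Notation om := (omega q1 q2 l1 l2).
Local Notation Cgen := (Cgen t t' q1 q2).
Local Notation I01 := (@I01 R).
Context (s : surf R 3 -> surf R 3 -> K).
Hypothesis sE : forall P, C P -> exists phi h W, sigma_spec t t' vinf q1 q2 l1 l2 s P phi h W.
Local Notation Cfib := (fun P : surf R 3 => [set c : K | c != 0]).

Lemma omega_gen P : Cgen P -> om P =
  2^-1 * ((yco P + q1.2) / (xco P - q1.1) + (yco P + q2.2) / (xco P - q2.1)) / yco P
  + l1 / yco P + l2 * xco P / yco P.
Proof. by case: P => [x y|v] // [_ /=]; rewrite eqxx. Qed.

Lemma gen_tends P : Cgen P ->
  tends (nbhs P) (@xco R 3) (xco P) /\ tends (nbhs P) (@yco R 3) (yco P).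
Proof.
case: P => [x y|v]; last by move=> [_ /=]; rewrite eqxx.
by move=> _; split; [exact: tends_xco|exact: tends_yco].
Qed.

Lemma omega_cont (c : R -> surf R 3) : continuous c -> (forall r, Cgen (c r)) ->
  forall r, tends (nbhs r) (fun r => om (c r)) (om (c r)).
Proof.
move=> cc cg r; have [_ yn x1 x2] := cg r; have [tx ty] := gen_tends (cg r).
have tx' : tends (nbhs r) (fun r => xco (c r)) (xco (c r)) by move=> U /tx /cc.
have ty' : tends (nbhs r) (fun r => yco (c r)) (yco (c r)) by move=> U /ty /cc.
have d1 : xco (c r) - q1.1 != 0 by rewrite subr_eq0.
have d2 : xco (c r) - q2.1 != 0 by rewrite subr_eq0.
rewrite (omega_gen (cg r)).
apply: (@tends_ext _ _ _ (fun r => 2^-1 * ((yco (c r) + q1.2) / (xco (c r) - q1.1) +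
   (yco (c r) + q2.2) / (xco (c r) - q2.1)) / yco (c r)
  + l1 / yco (c r) + l2 * xco (c r) / yco (c r))) => [r'|]; first by rewrite omega_gen.
have tq (q : K * K) : xco (c r) - q.1 != 0 ->
    tends (nbhs r) (fun r => (yco (c r) + q.2) / (xco (c r) - q.1))
       ((yco (c r) + q.2) / (xco (c r) - q.1)).
  move=> d; exact: (tendsM (tendsD ty' (tends_cst q.2)) (tendsV d (tendsB tx' (tends_cst q.1)))).
pose proof (tendsV yn ty') as tv.
pose proof (tendsM (tendsM (tends_cst (2^-1 : K)) (tendsD (tq _ d1) (tq _ d2))) tv) as H1.
pose proof (tendsM (tends_cst l1) tv) as H2.
pose proof (tendsM (tendsM (tends_cst l2) tx') tv) as H3.
exact: (tendsD (tendsD H1 H2) H3).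
Qed.

Lemma C1_loop_rder (A : set (surf R 3)) (c : R -> surf R 3) : C1_loop A c ->
  forall r, rder (fun r => xco (c r)) r (velocity c r) /\
    tends (nbhs r) (velocity c) (velocity c r).
Proof.
move=> [_ _ _ H] r.
have [dR cR] := H _ (or_introl erefl); have [dI cI] := H _ (or_intror erefl).
split; last by apply: tends_ReIm; [exact: cR|exact: cI].
apply/rderP; split; apply: DeriveDef; rewrite /velocity /= ?derive1E //.
Qed.

(** Differentiability of [J] beyond 0 supplies the one-sided continuity at the endpoints. *)
Lemma path_integralE (g : R -> K) (J : R -> K) :
  (forall r, tends (nbhs r) g (g r)) -> (forall r, -1 < r -> rder J r (g r)) ->
  ((\int[lebesgue_measure]_(r in `[0%R, 1%R]) complex.Re (g r)) +i*
  (\int[lebesgue_measure]_(r in `[0%R, 1%R]) complex.Im (g r)))%C = (J 1 - J 0 : K).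
Proof.
move=> gc dJ.
have H (p : K -> R) : (forall r : R, {for r, continuous (fun r : R => p (g r))}) ->
    (forall r : R, -1 < r -> is_derive r 1 (fun r : R => p (J r)) (p (g r))) ->
    \int[lebesgue_measure]_(r in `[0%R, 1%R]) p (g r) = p (J 1) - p (J 0).
  move=> pc dp.
  have pJc (r : R) : -1 < r -> {for r, continuous (fun r : R => p (J r))}.
    move=> r1; apply: differentiable_continuous; apply/derivable1_diffP.
    exact: (@ex_derive _ _ _ _ _ _ _ (dp r r1)).
  rewrite /Rintegral (@continuous_FTC2 R (fun r => p (g r)) (fun r => p (J r))) //.
  - by apply: continuous_subspaceT => r; exact: pc.
  - split.
    + move=> r; rewrite in_itv /= => /andP[r0 _].
      by apply: (@ex_derive _ _ _ _ _ _ _ (dp r _)); apply: lt_trans r0; rewrite ltrN10.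
    + by apply: cvg_at_right_filter; apply: pJc; rewrite ltrN10.
    + by apply: cvg_at_left_filter; apply: pJc; lra.
  - move=> r; rewrite in_itv /= => /andP[r0 _].
    have r1 : -1 < r by apply: lt_trans r0; rewrite ltrN10.
    by rewrite derive1E; exact: (@derive_val _ _ _ _ _ _ _ (dp r r1)).
have HR := H (@complex.Re R) (fun r => tends_Re (gc r)) (fun r r1 => proj1 ((rderP _ _ _).1 (dJ r r1))).
have HI := H (@complex.Im R) (fun r => tends_Im (gc r)) (fun r r1 => proj2 ((rderP _ _ _).1 (dJ r r1))).
by rewrite HR HI -ReB -ImB; case: (J 1 - J 0).
Qed.

(** With [J] a primitive of omega along [c], the section [y exp(-(J r - J 0))] is flat, since a
    local primitive [W] of omega satisfies [W(xi(c)) - J = const] along [c]. *)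
Lemma loop_transport (c : R -> surf R 3) (y : K) : C1_loop Cgen c -> y != 0 ->
  transport Cfib (C_transport s) c y (y * Cexp (- path_integral om c)).
Proof.
move=> cL y_neq0; have [cg _ cc _] := cL.
pose g r := om (c r) * velocity c r.
have gc r : tends (nbhs r) g (g r).
  have X1 : tends (nbhs r) (fun r => om (c r)) (om (c r)) by exact: omega_cont.
  pose proof (tendsM X1 (proj2 (C1_loop_rder cL r))) as X.
  exact: X.
have [J dJ] := antiderivative (-1) gc.
exists (fun r => y * Cexp (- (J r - J 0))); split; last 2 first.
- by rewrite subrr oppr0 Cexp0 mulr1.
- by rewrite /path_integral (path_integralE gc dJ).
move=> r /andP[r0 r1]; split; first by rewrite /= mulf_neq0 // Cexp_neq0.
have [W [W0 HW]] := sigma_gen sE (cg r).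
have N : \forall r' \near r, sd W (xco (c r')) (om (c r')) /\
    s (c r) (c r') = Cexp (- W (xco (c r'))).
  have X : \forall Q' \near c r, C Q' -> sd W (xco Q') (om Q') /\
     s (c r) Q' = Cexp (- W (xco Q')) by apply: filterS HW => Q' H /H[].
  have X' : \forall r' \near r, C (c r') -> sd W (xco (c r')) (om (c r')) /\
    s (c r) (c r') = Cexp (- W (xco (c r'))) by exact: cc X.
  by apply: filterS X' => r'; apply; case: (cg r').
have /nbhs_ballP[e /= e0 He] := N.
(* The bound 1 keeps [r'] above -1, where [J] is known to be differentiable. *)
apply/nbhs_ballP; exists (Num.min e 1); first by rewrite /= lt_min e0 ltr01.
move=> r'; rewrite /ball /= lt_min => /andP[re r1'] _.
have K0 : W (xco (c r)) - J r = W (xco (c r')) - J r'.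
  apply: (@rder_const _ (fun u => W (xco (c u)) - J u)) => u /andP[u0 u1].
  have ru : `|r - u| < e /\ -1 < u.
    move: u0 u1 re r1'; rewrite !ltr_norml ge_min le_max.
    case: (leP r r') => rr /orP h1 /orP h2 /andP[h3 h4] /andP[h5 h6];
      split; try (apply/andP; split); lra.
  have [dW _] := He u ru.1.
  rewrite -(subrr (g u)); apply: rderB; last exact: dJ ru.2.
  exact: (rder_comp (C1_loop_rder cL u).1 dW).
rewrite /C_transport; have [_ ->] := He r' re.
rewrite -mulrA -CexpD; congr (_ * Cexp _).
have -> : W (xco (c r')) = J r' - J r.
  by move: K0; rewrite W0 sub0r => e'; rewrite -(subrK (J r') (W _)) -e'; ring.
ring.
Qed.

(** Transport along [a] is multiplication by some [k]. Free homotopy carries this multiplier to the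
    curve [c], where [loop_transport] computes it. *)
Lemma period_transport (a : R -> surf R 3) (N y : K) :
  cont_on I01 a -> (forall r, I01 r -> C (a r)) ->
  is_period t t' q1 q2 l1 l2 a N -> y != 0 ->
  transport Cfib (C_transport s) a y (y * Cexp (- N)).
Proof.
move=> ac aC [c [cL ac_htpy ->]] y_neq0; have LS := C_system sE.
have [y' Ty] := transport_exists LS ac aC y_neq0.
have [_ y'0] := transport_fib Ty.
pose k := y' / y; have kE : y' = y * k by rewrite /k mulrCA divff // mulr1.
have k0 : k != 0 by rewrite mulf_neq0 // invr_eq0.
rewrite kE in Ty.
have [z Tz] := @transport_free_homotopic R _ _ _ _ _ LS a c y (fun x => x * k)
  (fun p z z0 => mulf_neq0 z0 k0) (fun p q z => mulrAC _ _ _) ac_htpy Ty.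
have [z0 _] := transport_fib Tz.
have [cg _ cc _] := cL.
have Tz' := loop_transport cL z0.
have e : z * k = z * Cexp (- path_integral om c).
  apply: (transport_unique LS (continuous_cont_on cc) _ Tz Tz').
  by move=> r _; case: (cg r).
by rewrite -(mulfI z0 e).
Qed.

(** A short piece of an unramified path stays in one sheet, so [lift] recovers it from its image. *)
Lemma E_push (a : R -> surf R 3) (Y : R -> K) : cont_on I01 a ->
  (forall r, I01 r -> C (a r)) -> (forall r, I01 r -> unramified (a r)) ->
  flat Cfib (C_transport s) I01 a Y ->
  flat (E_fiber t t') (E_transport t t' s) I01 (fun r => cov (a r)) (fun r => (a r, Y r)).
Proof.
move=> ac aC aU fY r Ir; have [h1 h2] := fY r Ir; split; first by split=> //; exact: aC.
have N := ac r Ir _ (sheet_near (aU r Ir)).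
apply: filterS2 h2 N => r' k1 k2 Ir'.
have e : lift t t' (a r) (cov (a r')) = a r'.
  by apply: lift_eq; [exact: aC|exact: aC|exact: k2].
by rewrite /E_transport /= e k1.
Qed.

End Period.

(** * Transport around a branch point *)

Lemma cont_on_aff (R : realType) (k : nat) (S : topologicalType) (D : set S) (f g : S -> Cx R) :
  cont_on D f -> cont_on D g -> cont_on D (fun z => Aff (f z) (g z) : surf R k).
Proof.
move=> fc gc z Dz U /nbhs_aff/box_near[e e0 HU].
have N1 : nbhs (f z) [set w | mod (w - f z) < e] by apply/nbhs_mod; exists e.
have N2 : nbhs (g z) [set w | mod (w - g z) < e] by apply/nbhs_mod; exists e.
apply: filterS2 (fc z Dz _ N1) (gc z Dz _ N2) => z' h1 h2 Dz'.
exact: (HU _ _ (h1 Dz') (h2 Dz')).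
Qed.

Lemma tends_real (R : realType) (T : Type) (F : set_system T) {FF : Filter F} (f : T -> R) (l : R) :
  f x @[x --> F] --> l -> tends F (fun x => (f x)%:C%C : Cx R) (l%:C%C).
Proof. by move=> fl; apply: tends_ReIm => //=; exact: cvg_cst. Qed.

Section Circle.
Context (R : realType) (t t' vinf : Cx R) (q1 q2 : Cx R * Cx R) (l1 l2 : Cx R).
Local Notation K := (Cx R).
Local Notation C := (curveC t t').
Local Notation cov := (coverf t').
Local Notation I01 := (@I01 R).
Context (s : surf R 3 -> surf R 3 -> K).
Hypothesis sE : forall P, C P -> exists phi h W, sigma_spec t t' vinf q1 q2 l1 l2 s P phi h W.
Local Notation Cfib := (fun P : surf R 3 => [set c : K | c != 0]).
Local Notation Etr := (transport (E_fiber t t') (E_transport t t' s)).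

(** Half a turn per unit of [u], with orientation [o]. The circle runs through [turn o (2 * u)],
    whose square root, needed to lift it to C, is [turn o u]. *)
Definition turn (o : bool) (u : R) : K := Cexp (0 +i* ((-1) ^+ o * pi * u))%C.

Lemma turnD o u v : turn o (u + v) = turn o u * turn o v.
Proof. by rewrite /turn -CexpD; congr Cexp; apply/eqP; rewrite eq_complex /= addr0 mulrDr !eqxx. Qed.

Lemma turn0 o : turn o 0 = 1.
Proof. by rewrite /turn mulr0; exact: Cexp0. Qed.

Lemma turn1 o : turn o 1 = -1.
Proof.
rewrite /turn mulr1 /Cexp /= expR0 !mul1r; case: o; rewrite ?expr0 ?expr1 ?mul1r ?mulN1r.
  by rewrite cosN cospi sinN sinpi oppr0; apply/eqP; rewrite eq_complex /= oppr0 !eqxx.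
by rewrite cospi sinpi; apply/eqP; rewrite eq_complex /= oppr0 !eqxx.
Qed.

Lemma turn2 o : turn o 2 = 1.
Proof. by rewrite (_ : 2 = 1 + 1 :> R) // turnD turn1 mulrNN mulr1. Qed.

Lemma turn_neq0 o u : turn o u != 0. Proof. exact: Cexp_neq0. Qed.

Lemma mod_turn o u : mod (turn o u) = 1.
Proof.
rewrite /turn /Cexp /mod normc_def /= expR0 !mul1r cos2Dsin2 sqrtr1 //.
Qed.

Lemma circle_transport (p : K * K) (r : R) (h : K -> K) (o : bool) (P : surf R 3) (c : K) :
  p.1 = t' -> coord_disc t p r h -> C P -> c != 0 ->
  let circle (u : R) : surf R 2 :=
    let x := p.1 + r%:C%C * Cexp (0 +i* ((-1) ^+ o * 2 * pi * u))%C in Aff x (h x) in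
  cov P = circle 0 ->
  exists P' c', [/\ P' <> P, Etr circle (P, c) (P', c') & Etr circle (P', c') (P, c)].
Proof.
move=> p1 [r0 hc hp hF] CP c0 circle.
have circleE u : circle u = Aff (t' + r%:C%C * turn o (2 * u)) (h (t' + r%:C%C * turn o (2 * u))).
  by rewrite /circle p1 /turn (_ : (-1) ^+ o * 2 * pi * u = (-1) ^+ o * pi * (2 * u)) //; ring.
rewrite circleE mulr0 turn0 mulr1.
case: P CP => [x y|v] // CP [/eqP]; rewrite -subr_eq0 => /eqP xE yE.
have x2 : x ^+ 2 = - r%:C%C.
  by apply/eqP; rewrite -subr_eq0 opprK; apply/eqP; rewrite -[RHS](oppr0) -xE; ring.
have x0 : x != 0 by rewrite -sqrf_eq0 x2 oppr_eq0 eq_complex /= gt_eqF.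
have modx : mod x ^+ 2 = r by rewrite expr2 -modM -expr2 x2 modN mod_real gtr0_norm.
(* At [z.1 = 0] this is the lift of the circle described twice; increasing [z.1] shrinks it radially
   onto the ramification point over the centre, inside the preimage of the disc. *)
pose xi (z : R * R) : K := (1 - z.1)%:C%C * (x * turn o (2 * z.2)).
pose H (z : R * R) : surf R 3 := Aff (xi z) (h (t' - xi z ^+ 2)).
have disc z : rect (0:R) 1 0 1 z -> `|t' - xi z ^+ 2 - p.1| <= (r%:C%C : K).
  move=> [/andP[z0 z1] _]; rewrite p1 addrC addKr modE lecR modN expr2 modM -expr2.
  rewrite /xi !modM mod_turn mulr1 mod_real exprMn modx.
  rewrite -[leRHS]mul1r; apply: ler_wpM2r; first exact: ltW.
  by rewrite expr_le1 ?normr_ge0 // ler_norml; apply/andP; split; lra.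
have HC z : rect (0:R) 1 0 1 z -> C (H z).
  by move=> /disc/hF[_ e]; rewrite /H /= e polyE_cover.
have xic z : tends (nbhs z) xi (xi z).
  apply: tendsM.
    apply: tends_real; apply: cvgB; [exact: cvg_cst|exact: cvg_fst].
  apply: tendsM; first exact: tends_cst.
  apply: Cexp_cont0; apply: tends_ReIm => /=; first exact: cvg_cst.
  by apply: cvgM; [exact: cvg_cst|apply: cvgM; [exact: cvg_cst|exact: cvg_snd]].
have Hc : cont_on (rect (0:R) 1 0 1) H.
  apply: cont_on_aff; first exact: continuous_cont_on.
  apply: (@cont_on_comp _ _ _ [set w : K | `|w - p.1| <= r%:C%C] _ h (fun z => t' - xi z ^+ 2)).
  - exact: within_cont_on hc.
  - apply: continuous_cont_on => z.
    pose proof (tendsB (tends_cst t') (tendsX 2 (xic z))) as X; exact: X.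
  - by move=> z /disc; rewrite /= p1.
have LS := C_system sE.
have I010 : I01 0 by rewrite /I01 /= lexx ler01.
have I011 : I01 1 by rewrite /I01 /= lexx ler01.
have row u : I01 u -> rect (0:R) 1 0 1 (0, u) by [].
have [Y [Y0 frow fcol urow ucol]] := flat_square LS Hc HC (c0 : [set c | c != 0] c).
(* The fully contracted loop is constant. *)
have Y11 : Y (1, 0) = Y (1, 1).
  have e b : H (1, b) = H (1, 0) by rewrite /H /xi /= subrr !mul0r.
  have fk : flat Cfib (C_transport s) I01 (fun b => H (1, b)) (fun=> Y (1, 0)).
    apply: (@flat_eq _ _ Cfib (C_transport s) _ I01 (fun=> H (1, 0))) => [b _|]; first by rewrite e.
    by apply: (flat_cst LS); [apply: HC|case: (frow 1 I011 0 I010)].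
  by have [-> ] := urow 1 _ I011 fk.
(* The sides [z.2 = 0] and [z.2 = 1] are the same path, so equality at their contracted end
   propagates back. *)
have Y01 : Y (0, 1) = c.
  have e b : H (b, 1) = H (b, 0) by rewrite /H /xi /= mulr1 mulr0 turn2 turn0.
  have f1 : flat Cfib (C_transport s) I01 (fun b => H (b, 0)) (fun b => Y (b, 1)).
    by apply: flat_eq (fcol 1 I011) => b _; exact: e.
  by rewrite -Y0; apply/esym/(ucol 0 _ I010 f1).
pose g (u : R) := H (0, u).
have gE u : g u = Aff (x * turn o (2 * u)) (h (t' - (x * turn o (2 * u)) ^+ 2)).
  by rewrite /g /H /xi /= subr0 mul1r.
have covg u : cov (g u) = circle (2 * u).
  rewrite gE circleE /= exprMn x2 expr2 -turnD mulNr opprK.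
  by rewrite (_ : 2 * u + 2 * u = 2 * (2 * u)) //; ring.
have gu u : I01 u -> unramified (g u).
  by move=> _ y' /eqP; rewrite gE aff_eq mulf_eq0 (negbTE x0) (negbTE (turn_neq0 _ _)).
have fE := E_push (cont_on_comp Hc (@edge_cont R _ 0) row)
  (fun b Ib => HC _ (row b Ib)) gu (frow 0 I010).
have g0 : g 0 = Aff x y.
  rewrite gE mulr0 turn0 mulr1 yE; congr (Aff _ (h _)).
  by rewrite x2 opprK.
have g1 : g 1 = Aff x y by rewrite -g0 !gE mulr1 mulr0 turn2 turn0.
(* The lift of the double circle covers the circle once on each half of the parameter interval; [v]
   is 0 or 1/2. *)
have half v : 0 <= v <= 2^-1 -> (forall u, cov (g (2^-1 * u + v)) = circle u) ->
    Etr circle (g v, Y (0, v)) (g (2^-1 + v), Y (0, 2^-1 + v)).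
  move=> /andP[v0 v1] e; exists (fun u => (g (2^-1 * u + v), Y (0, 2^-1 * u + v))).
  split; rewrite ?mulr0 ?add0r ?mulr1 //.
  apply: (@flat_eq _ _ (E_fiber t t') (E_transport t t' s) _ I01
    (fun u => cov (g (2^-1 * u + v))) circle
    (fun u => (g (2^-1 * u + v), Y (0, 2^-1 * u + v)))) => [u _|]; first exact: e.
  apply: (@flat_comp _ _ _ _ _ _ _ _ _ _ (fun u : R => 2^-1 * u + v) _ _ fE).
    exact: continuous_cont_on (@affine_cont R 2^-1 v).
  by rewrite /I01 /= => u /andP[u0 u1]; apply/andP; split; lra.
exists (g (2^-1)), (Y (0, 2^-1)); split.
- rewrite gE mulfV ?pnatr_eq0 // turn1 mulrN1 => -[/eqP]; rewrite -subr_eq0 -opprD oppr_eq0.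
  by rewrite -mulr2n -mulr_natr mulf_eq0 (negbTE x0) (negbTE (two_neq0 R)).
- have := half 0; rewrite addr0 g0 Y0; apply=> [|u]; first by apply/andP; split; lra.
  by rewrite covg addr0 mulrA mulfV ?pnatr_eq0 // mul1r.
- have e1 : 2^-1 + 2^-1 = 1 :> R by field.
  have := half 2^-1; rewrite e1 g1 Y01; apply=> [|u]; first by apply/andP; split; lra.
  rewrite covg !circleE.
  have -> : turn o (2 * (2 * (2^-1 * u + 2^-1))) = turn o (2 * u) * turn o 2.
    by rewrite -turnD; congr turn; field.
  by rewrite turn2 mulr1.
Qed.

Lemma E_scale (c : R -> surf R 2) P Q a b m : m != 0 -> Etr c (P, a) (Q, b) ->
  Etr c (P, m * a) (Q, m * b).
Proof.
move=> m0 [Y [fY Y0 Y1]]; exists (fun u => ((Y u).1, m * (Y u).2)).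
split; rewrite ?Y0 ?Y1 // => u Iu; have [[h1 h2 h3] h4] := fY u Iu; split.
  by split=> //=; rewrite mulf_neq0.
by apply: filterS h4 => v H Iv; rewrite H //= /E_transport /= mulrA.
Qed.

End Circle.

(** * Transport along the generators of the fundamental group *)

Lemma pcat1 (R : realType) (T : Type) (c d : R -> T) : pcat c d 1 = d 1.
Proof. by rewrite /pcat ifF; [congr d; ring|apply/negbTE; rewrite -ltNge; lra]. Qed.

Section Loops.
Context (R : realType) (t t' y0 vinf : Cx R) (q1 q2 : Cx R * Cx R) (l1 l2 : Cx R).
Local Notation K := (Cx R).
Local Notation C := (curveC t t').
Local Notation cov := (coverf t').
Local Notation A := (Epunct t t' y0).
Local Notation I01 := (@I01 R).
Hypotheses (y0E : y0 ^+ 2 = t' * (t' - 1) * (t' - t)) (vinfE : vinf ^+ 2 = -1).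
Context (s : surf R 3 -> surf R 3 -> K).
Hypothesis sE : forall P, C P -> exists phi h W, sigma_spec t t' vinf q1 q2 l1 l2 s P phi h W.
Local Notation T := (transport (E_fiber t t') (E_transport t t' s)).
Local Notation Pp := (Inf vinf : surf R 3).
Local Notation Pm := (Inf (- vinf) : surf R 3).
Local Notation loop := (loop_in A (infE R)).
Implicit Types c d : R -> surf R 2.
Let LS := E_system y0E vinfE sE.

Let I010 : I01 0. Proof. by rewrite /I01 /= lexx ler01. Qed.
Let I011 : I01 1. Proof. by rewrite /I01 /= lexx ler01. Qed.

Lemma path_in_cont (X : topologicalType) (B : set X) p q (c : R -> X) :
  path_in B p q c -> cont_on I01 c.
Proof.
move=> [/within_cont_on cc _ _ _] z; rewrite /I01 /= => Iz U HU.
by apply: filterS (cc z _ U HU) => [z' H Iz'|]; [apply: H|]; rewrite /= in_itv.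
Qed.

Lemma homotopic_cont (X : topologicalType) (B : set X) (c d : R -> X) :
  homotopic B c d -> [/\ cont_on I01 d, forall r, I01 r -> B (d r), d 0 = c 0 & d 1 = c 1].
Proof.
move=> [H [/within_cont_on Hc HB Hcd Hends]].
have Hcont : cont_on (rect (0:R) 1 0 1) H by exact: Hc.
have e r : I01 r -> H (1, r) = d r by move=> Ir; exact: (proj2 (Hcd r Ir)).
have m r : I01 r -> rect (0:R) 1 0 1 (1, r) by move=> Ir; split=> //=; rewrite lexx ler01.
split.
- move=> z Iz U; rewrite -e // => HU.
  have := cont_on_comp Hcont (@edge_cont R _ 1) m Iz HU.
  by apply: filterS => z' h Iz'; rewrite -e //; exact: h.
- by move=> r Ir; rewrite -e //; apply: HB => //; rewrite lexx ler01.
- by rewrite -e //; apply: (proj1 (Hends _ I011)).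
- by rewrite -e //; apply: (proj2 (Hends _ I011)).
Qed.

(** Existence along [c] and uniqueness along [d] replace reversing the homotopy. *)
Lemma transport_homotopic_back c d y y' : cont_on I01 c -> (forall r, I01 r -> A (c r)) ->
  homotopic A c d -> T d y y' -> T c y y'.
Proof.
move=> cc cA H Td; have [dc dA d0 _] := homotopic_cont H.
have [Fy _] := transport_fib Td; rewrite d0 in Fy.
have [y'' Tc] := transport_exists LS cc cA Fy.
by rewrite (transport_unique LS dc dA Td (transport_homotopic LS H Tc)).
Qed.

Lemma loop_unique c y y' y'' : loop c -> T c y y' -> T c y y'' -> y' = y''.
Proof. by move=> cl; have [_ _ _ cA] := cl; exact: (transport_unique LS (path_in_cont cl) cA). Qed.

Lemma inf_points P : C P -> cov P = infE R -> P = Pp \/ P = Pm.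
Proof.
case: P => [x y|v] // Cv _; move: Cv; rewrite /= polyC2_coef -vinfE => /eqP.
by rewrite eqf_sqr => /orP[]/eqP ->; [left|right].
Qed.

Lemma inf_fiber y : E_fiber t t' (infE R) y -> y.2 != 0 /\ (y.1 = Pp \/ y.1 = Pm).
Proof.
by case: y => P c [/= CP eP c0]; split=> //; exact: inf_points.
Qed.

Lemma in_fiber (c : K) : c != 0 -> E_fiber t t' (infE R) (Pp, c) /\ E_fiber t t' (infE R) (Pm, c).
Proof. by move=> c0; split; split=> //=; rewrite polyC2_coef ?sqrrN. Qed.

Lemma loop_rev c : loop c -> loop (path_rev c).
Proof.
move=> cl; have [_ c0 c1 cA] := cl; have rc := rev_cont (path_in_cont cl).
split; rewrite /path_rev ?subrr ?subr0 //.
  apply/subspace_continuousP => z; rewrite /= in_itv /= => Iz U HU.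
  by apply: filterS (rc z Iz U HU) => z' H; rewrite /= in_itv /= => Iz'; exact: H.
by move=> r Ir; exact: cA (I01_rev Ir).
Qed.

Lemma loop_exists c y : loop c -> E_fiber t t' (infE R) y ->
  exists y', T c y y' /\ E_fiber t t' (infE R) y'.
Proof.
move=> cl Fy; have [_ c0 c1 cA] := cl; rewrite -c0 in Fy.
have [y' Ty] := transport_exists LS (path_in_cont cl) cA Fy.
by exists y'; split=> //; have [_] := transport_fib Ty; rewrite c1.
Qed.

Definition swaps (k : K) (c : R -> surf R 2) : Prop :=
  T c (Pp, 1) (Pm, k) /\ T c (Pm, k) (Pp, 1).

Definition fixes (k m1 m2 : K) (c : R -> surf R 2) : Prop :=
  T c (Pp, 1) (Pp, m1) /\ T c (Pm, k) (Pm, m2 * k).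

Lemma simple_loop_swaps (p : K * K) (g : R -> surf R 2) : p.1 = t' -> loop g ->
  simple_loop_around t A (infE R) p g -> exists2 k, k != 0 & swaps k g.
Proof.
move=> p1 gl [r [h [delta [oo [disc dl _ _ H]]]]].
set circle := fun _ : R => _ in H dl.
have [_ d0 d1 dA] := dl; have dc := path_in_cont dl.
have [_ _ _ gA] := gl; have gc := path_in_cont gl.
have [F1 _] := in_fiber (oner_neq0 K).
have [[P c] T1] : exists y, T delta (Pp, 1) y.
  by apply: (transport_exists LS dc dA); rewrite d0.
have [_ [/= CP eP c0]] := transport_fib T1; rewrite d1 in eP.
have [P' [c' [PP' T2 T3]]] := circle_transport sE p1 disc CP c0 eP.
have c10 : circle 1 = circle 0.
  have := turn2 R oo; rewrite /turn /circle mulr1 mulr0 Cexp0.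
  by rewrite (mulrAC _ pi) => ->.
have [_ [/= CP' eP' c'0]] := transport_fib T2.
have rdc := rev_cont dc.
have rdA u : I01 u -> A (path_rev delta u) by move=> Iu; exact: dA (I01_rev Iu).
have [y T4] : exists y, T (path_rev delta) (P', c') y.
  by apply: (transport_exists LS rdc rdA); rewrite /path_rev subr0 d1; split=> //=;
    exact: etrans eP' c10.
have T4' := transport_rev T4.
have T4'' : T delta y (P', c').
  by apply: transport_eq T4' => u _; rewrite /path_rev subKr.
have [_ Fy] := transport_fib T4; rewrite /path_rev subrr d0 in Fy.
have [k0 yP] := inf_fiber Fy.
(* If the way back ended on the sheet of [vinf], then by scaling [delta] would lead from there to
   both [P] and [P']. *)
have {yP} yE : y = (Pm, y.2).
  case: y yP T4'' {T4 T4' Fy} k0 => y1 k /= [] -> // Tk k0.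
  have T1' : T delta (Pp, k) (P, k * c) by have := E_scale k0 T1; rewrite mulr1.
  by have [/esym/PP'] := transport_unique LS dc dA T1' Tk.
exists y.2 => //.
have j1 : delta 1 = circle 0 by [].
have j2 : pcat delta circle 1 = path_rev delta 0 by rewrite pcat1 c10 /path_rev subr0.
by split; rewrite -yE; apply: (transport_homotopic_back gc gA H);
  apply: (transport_cat j2); try exact: (transport_cat j1 T1 T2); try exact: T4;
  try exact: (transport_rev T1); exact: (transport_cat j1 T4'' T3).
Qed.

Lemma Cpunct_loop (c : R -> surf R 3) : loop_in (Cpunct t t' y0) Pp c ->
  [/\ cont_on I01 c, forall r, I01 r -> C (c r), forall r, I01 r -> unramified (c r),
     c 0 = Pp & c 1 = Pp].
Proof.
move=> cl; have [_ c0 c1 cA] := cl; split=> //; first exact: path_in_cont cl.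
  by move=> r /cA[].
move=> r /cA[CQ nQ] y e; apply: nQ; move: CQ; rewrite e /= polyC2E expr0n /= !subr0 -y0E.
by move=> /eqP; rewrite eqf_sqr => /orP[]/eqP ->; [left|right].
Qed.

Lemma period_loop (a1 : R -> surf R 3) (c : R -> surf R 2) (N : K) :
  loop_in (Cpunct t t' y0) Pp a1 -> is_period t t' q1 q2 l1 l2 a1 N ->
  homotopic A (cov \o a1) c -> T c (Pp, 1) (Pp, Cexp (- N)).
Proof.
move=> /Cpunct_loop[a1c a1C a1u a10 a11] NE H; apply: (transport_homotopic LS H).
have [Y [fY Y0 Y1]] := period_transport sE a1c a1C NE (oner_neq0 K).
exists (fun r => (a1 r, Y r)); split; [exact: (E_push a1c a1C a1u fY)|by rewrite a10 Y0|].
by rewrite a11 Y1 mul1r.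
Qed.

Lemma period_fixes k (a g1 : R -> surf R 2) (a1 a2 : R -> surf R 3) (N1 N2 : K) : k != 0 ->
  loop a -> loop g1 -> swaps k g1 ->
  loop_in (Cpunct t t' y0) Pp a1 -> loop_in (Cpunct t t' y0) Pp a2 ->
  is_period t t' q1 q2 l1 l2 a1 N1 -> is_period t t' q1 q2 l1 l2 a2 N2 ->
  homotopic A (cov \o a1) a ->
  homotopic A (cov \o a2) (pcat (pcat (path_rev g1) a) g1) ->
  fixes k (Cexp (- N1)) (Cexp (- N2)) a.
Proof.
move=> k0 al gl [g12 g21] a1l a2l N1E N2E H1 H2; split; first exact: period_loop a1l N1E H1.
have T2 := period_loop a2l N2E H2.
have [_ g0 g1' _] := gl; have [_ a0 a1' _] := al.
have [z [Tz Fz]] := loop_exists al (proj2 (in_fiber k0)).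
have [w [Tw Fw]] := loop_exists gl Fz.
have T3 : T (pcat (pcat (path_rev g1) a) g1) (Pp, 1) w.
  apply: (transport_cat _ _ Tw); first by rewrite pcat1 a1' g0.
  apply: (transport_cat _ (transport_rev g21) Tz); by rewrite /path_rev subrr g0 a0.
have [pc pA _ _] := homotopic_cont H2.
have we := transport_unique LS pc pA T2 T3; rewrite -we in Tw.
(* Both [z] and [(Pm, exp(-N2) k)] are carried to [(Pp, exp(-N2))] by [g1], hence they coincide. *)
have := E_scale (Cexp_neq0 (- N2)) g21; rewrite mulr1 => T4.
by have zE := loop_unique (loop_rev gl) (transport_rev Tw) (transport_rev T4); rewrite zE in Tz.
Qed.

Lemma fixes_scale k m1 m2 c x : x != 0 -> fixes k m1 m2 c ->
  T c (Pp, x) (Pp, x * m1) /\ T c (Pm, x * k) (Pm, x * m2 * k).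
Proof.
move=> x0 [T1 T2]; have := E_scale x0 T1; have := E_scale x0 T2.
by rewrite mulr1 -mulrA.
Qed.

(** On each sheet [a] and [b] act by scalars, and scalars commute. *)
Lemma comm_fixes k (a b : R -> surf R 2) m1 m2 n1 n2 : loop a -> loop b ->
  m1 != 0 -> m2 != 0 -> n1 != 0 -> n2 != 0 ->
  fixes k m1 m2 a -> fixes k n1 n2 b -> fixes k 1 1 (pcomm a b).
Proof.
move=> [_ a0 a1 _] [_ b0 b1 _] m10 m20 n10 n20 fa fb.
have j1 : a 1 = b 0 by rewrite a1 b0.
have j2 : pcat a b 1 = path_rev a 0 by rewrite pcat1 /path_rev subr0 a1 b1.
have j3 : pcat (pcat a b) (path_rev a) 1 = path_rev b 0.
  by rewrite pcat1 /path_rev subrr subr0 a0 b1.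
split.
- have [Ta _] := fa; have [Tb _] := fixes_scale m10 fb; have [Ta' _] := fixes_scale n10 fa.
  rewrite mulrC in Tb.
  apply: (transport_cat j3 _ (transport_rev (proj1 fb))).
  exact: (transport_cat j2 (transport_cat j1 Ta Tb) (transport_rev Ta')).
- have [_ Ta] := fa; have [_ Tb] := fixes_scale m20 fb; have [_ Ta'] := fixes_scale n20 fa.
  rewrite (mulrC m2 n2) in Tb.
  rewrite mul1r; apply: (transport_cat j3 _ (transport_rev (proj2 fb))).
  exact: (transport_cat j2 (transport_cat j1 Ta Tb) (transport_rev Ta')).
Qed.

Lemma relation_swaps k c (g1 g2 : R -> surf R 2) : k != 0 -> c 1 = infE R -> loop g1 -> loop g2 ->
  fixes k 1 1 c -> swaps k g1 ->
  homotopic A (pcat (pcat c g1) g2) (fun=> infE R) -> swaps k g2.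
Proof.
move=> k0 c1 g1l g2l [c12 c21] [g12 g21] H; rewrite mul1r in c21.
have [_ g10 g11 _] := g1l; have [_ g20 g21' _] := g2l.
have [hc hA _ _] := homotopic_cont H.
have cst y : E_fiber t t' (infE R) y -> T ((fun=> infE R) : R -> surf R 2) y y.
  by move=> Fy; exists (fun=> y); split=> //; exact: (flat_cst LS (hA 0 I010) Fy).
have j1 : c 1 = g1 0 by rewrite c1 g10.
have j2 : pcat c g1 1 = g2 0 by rewrite pcat1 g11 g20.
have [F1 _] := in_fiber (oner_neq0 K); have [_ F2] := in_fiber k0.
split.
- have [w [Tw Fw]] := loop_exists g2l F1.
  have T1 := transport_homotopic LS H (transport_cat j2 (transport_cat j1 c21 g21) Tw).
  by rewrite -(transport_unique LS hc hA T1 (cst _ F2)) in Tw *.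
- have [w [Tw Fw]] := loop_exists g2l F2.
  have T1 := transport_homotopic LS H (transport_cat j2 (transport_cat j1 c12 g12) Tw).
  by rewrite -(transport_unique LS hc hA T1 (cst _ F1)) in Tw *.
Qed.

End Loops.

(** * Branches as horizontal sections of the connection on L *)

Lemma iota_near (R : realType) (P : surf R 3) (U : set (surf R 3)) :
  nbhs (iotaC P) U -> \forall Q \near P, U (iotaC Q).
Proof.
case: P => [x y|v].
  move=> /nbhs_aff N; apply/nbhs_aff.
  have c : (- p.1, p.2) @[p --> ((x, y) : Cx R * Cx R)] --> ((- x, y) : Cx R * Cx R).
    exact: (cvg_pair (tendsN (tends_fst2 (Cx R) (x, y))) (tends_snd2 (Cx R) (x, y))).
  exact: c _ N.
move=> /nbhs_inf N; apply/nbhs_inf.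
have c : (- p.1, - p.2) @[p --> ((0, v) : Cx R * Cx R)] --> ((0, - v) : Cx R * Cx R).
  rewrite -{2}(oppr0 (Cx R)).
  exact: (cvg_pair (tendsN (tends_fst2 (Cx R) (0, v))) (tendsN (tends_snd2 (Cx R) (0, v)))).
have N' : \forall p \near ((0, v) : Cx R * Cx R), U (chart_inf 3 (- p.1, - p.2)) by exact: c _ N.
apply: filterS N' => -[u w]; rewrite /chart_inf /= oppr_eq0; case: eqP => //= _.
have -> : (- u) ^+ 3 = - u ^+ 3 by ring.
by rewrite invrN invrN mulrNN.
Qed.

Lemma has_deriv_ext (R : realType) (k : nat) (X : set (surf R k)) tau F G Q l :
  (\forall Q' \near Q, X Q' -> F Q' = G Q') -> X Q ->
  has_deriv X tau F Q l -> has_deriv X tau G Q l.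
Proof.
move=> FG XQ; have FGQ := nbhs_singleton FG XQ.
apply: tends_near; rewrite /within /= -FGQ.
have FG' : \forall Q' \near Q^', X Q' -> F Q' = G Q' by exact: cvg_within FG.
by apply: filterS FG' => Q' h XQ'; rewrite h.
Qed.

Lemma coord_deriv (R : realType) (k : nat) (X : set (surf R k)) (m G : surf R k -> Cx R)
    (g : Cx R -> Cx R) Q l : X Q ->
  (\forall Q' \near Q, X Q' -> G Q' = g (m Q')) ->
  tends (nbhs Q) m (m Q) ->
  (\forall Q' \near Q, X Q' -> Q' != Q -> m Q' != m Q) ->
  sd g (m Q) l -> has_deriv X m G Q l.
Proof.
move=> XQ E1 tx inj dg; rewrite -(divr1 l).
have D1 : \forall Q' \near Q, X Q' -> G Q' = g (m Q') /\ m Q' = id (m Q').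
  by apply: filterS E1 => Q' h XQ'; split=> //; exact: h.
have D2 U : nbhs (m Q) U -> \forall Q' \near Q, X Q' -> U (m Q').
  move=> HU; have X1 : \forall Q' \near Q, U (m Q') by exact: tx _ HU.
  by apply: filterS X1 => Q' h _.
have D3 : \forall Q' \near Q^', X Q' -> m Q' != m Q.
  by apply: near_punctured; apply: filterS inj => Q' h QQ' XQ'; exact: h.
exact: (has_deriv_param D1 XQ D2 D3 dg (sd_id (m Q)) (oner_neq0 _)).
Qed.

Section Branches.
Context (R : realType) (t t' vinf : Cx R) (q1 q2 : Cx R * Cx R) (l1 l2 : Cx R).
Local Notation K := (Cx R).
Local Notation C := (curveC t t').
Local Notation E := (curveE t).
Local Notation cov := (coverf t').
Local Notation om := (omega q1 q2 l1 l2).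
Local Notation tau := (@loc_coord R 3).
Local Notation Cgen := (Cgen t t' q1 q2).
Local Notation dL := (divL q1 q2 vinf).
Hypotheses (vinfE : vinf ^+ 2 = -1).
Context (s : surf R 3 -> surf R 3 -> K).
Hypothesis sE : forall P, C P -> exists phi h W, sigma_spec t t' vinf q1 q2 l1 l2 s P phi h W.

Lemma sigma_ord P c : C P -> ord_ge C (fun Q => c * s P Q) (- dL P) P.
Proof.
move=> CP; have [phi [h [W H]]] := sE CP; have ch := ss_chart H.
have tc := chart_coordP ch CP.
exists (fun Q => c * Cexp (- W (tau P Q))).
  have N : \forall Q \near P, exists l, sd (fun z => c * Cexp (- W z)) (tau P Q) l.
    have X : \forall z \near (tau P P), exists l, sd (fun z => c * Cexp (- W z)) z l.
      apply: filterS (ss_W H) => z dW; eexists.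
      exact: (sdM (sd_cst c z) (sd_comp (sdN dW) (sd_Cexp (- W z)))).
    exact: (tc _ X).
  apply: filterS3 N (ch_coord ch) (near_join (ch_inv ch)) => Q [l dl] tQ iQ CQ.
  exists l; apply: (coord_deriv CQ _ (tQ CQ) _ dl).
    exact: (filterS (fun Q' _ _ => erefl) filterT).
  have iQQ := nbhs_singleton iQ CQ.
  by apply: filterS iQ => Q' i' CQ' QQ'; apply: contraNneq QQ' => e; rewrite -(i' CQ') e iQQ.
by apply: near_punctured; apply: filterS filterT => Q _ QP _; rewrite (ss_E H) (negbTE QP); ring.
Qed.

(** The last two clauses record that xi is a local coordinate, which turns derivatives of functions
    of xi into [has_deriv]. *)
Definition log_germ (e : surf R 3 -> K) (Q : surf R 3) : Prop :=
  exists W : K -> K, \forall Q' \near Q, C Q' ->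
  [/\ sd W (xco Q') (om Q'), e Q' = Cexp (- W (xco Q')), tends (nbhs Q') (@xco R 3) (xco Q')
    & \forall Q'' \near Q', C Q'' -> Q'' != Q' -> xco Q'' != xco Q'].

Lemma sigma_log P c : C P -> c != 0 -> \forall Q \near P, C Q -> Q != P ->
  log_germ (fun Q => c * s P Q) Q.
Proof.
move=> CP c0; apply: filterS3 (near_Cgen sE CP) (sigma_neq0 sE CP) (sigma_cocycle sE CP) =>
  Q g n coc CQ QP.
have [W [W0 HW]] := sigma_gen sE (g CQ QP).
(* The constant [c * s P Q] is absorbed into the primitive as an additive constant. *)
have [b bE] := Cexp_surj (mulf_neq0 c0 (n CQ)).
exists (fun z => W z - b); apply: filterS2 HW (coc CQ) => Q' h1 h2 CQ'.
have [dW e tx inj] := h1 CQ'; split=> //.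
  by apply: sdS (sdB dW (sd_cst b (xco Q'))); rewrite subr0.
by rewrite -(h2 CQ') mulrA -bE e -CexpD; congr Cexp; ring.
Qed.

Lemma log_exp_int e P : (\forall Q \near P, C Q -> Q != P -> log_germ e Q) -> exp_int t t' om e P.
Proof.
move=> H; apply: near_punctured.
apply: filterS H => Q h QP CQ; have [W HW] := h CQ QP.
exists (fun Q' => W (xco Q')); apply: filterS HW => Q' h' CQ'; have [dW -> tx inj] := h' CQ'.
split; last by [].
by apply: (coord_deriv CQ' _ tx inj dW); exact: (filterS (fun Q' _ _ => erefl) filterT).
Qed.

(** The primitive of the pullback is [W(-xi)], whose derivative has the sign built into [iota_pull].
    The germ [e'] supplies the fact that xi is a coordinate near [P] itself. *)
Lemma log_exp_int_iota e e' P : (\forall Q \near iotaC P, C Q -> Q != iotaC P -> log_germ e Q) ->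
  (\forall Q \near P, C Q -> Q != P -> log_germ e' Q) ->
  exp_int t t' (iota_pull om) (fun Q => e (iotaC Q)) P.
Proof.
move=> H H'; apply: near_punctured.
apply: filterS2 (iota_near H) H' => Q h h' QP CQ.
have [|W HW] := h (curve_iota CQ).
  by apply: contraNneq QP => /(congr1 (@iotaC R)); rewrite !iotaK => ->.
have [W' HW'] := h' CQ QP.
exists (fun Q' => W (- xco Q')); apply: filterS2 (iota_near HW) HW' => Q' k1 k2 CQ'.
have [dW e1 _ _] := k1 (curve_iota CQ'); have [_ _ tx inj] := k2 CQ'.
rewrite xco_iota in dW e1; split; last exact: e1.
have dW' : sd (fun z => W (- z)) (xco Q') (iota_pull om Q').
  by apply: sdS (sd_comp (sdN (sd_id (xco Q'))) dW); rewrite mulrN1.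
by apply: (coord_deriv CQ' _ tx inj dW'); exact: (filterS (fun Q' _ _ => erefl) filterT).
Qed.

Lemma log_nabla e Q : C Q -> log_germ e Q -> nablaL t t' om e Q 0.
Proof.
move=> CQ [W HW]; have [dW eQ tx inj] := nbhs_singleton HW CQ.
have d : sd (fun z => Cexp (- W z)) (xco Q) (0 - om Q * e Q).
  by apply: sdS (sd_comp (sdN dW) (sd_Cexp (- W (xco Q)))); rewrite eQ; ring.
apply: (coord_deriv CQ _ tx inj d).
by apply: filterS HW => Q' h CQ'; have [] := h CQ'.
Qed.

End Branches.

(** * The fundamental matrix and its monodromy *)

Lemma mulmx2E (K : pzRingType) (M N : 'M[K]_2) i j :
  (M *m N) i j = M i 0 * N 0 j + M i 1 * N 1 j.
Proof.
rewrite mxE big_ord_recl big_ord1; congr (_ + M i _ * N _ j); exact/val_inj.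
Qed.

Lemma det_mx2 (K : comNzRingType) (M : 'M[K]_2) : \det M = M 0 0 * M 1 1 - M 0 1 * M 1 0.
Proof.
rewrite (expand_det_row _ 0) big_ord_recl big_ord1 /cofactor !det_mx11 !mxE /=.
rewrite expr0 expr1 mul1r mulN1r mulrN; congr (_ * M _ _ - M 0 _ * M _ _); exact/val_inj.
Qed.

Lemma scale_mx22 (R : realType) (m a b c d : Cx R) i j : (m *: mx22 a b c d) i j =
  m * if i == 0 then (if j == 0 then a else b) else (if j == 0 then c else d).
Proof. by rewrite !mxE. Qed.

Section Fundamental.
Context (R : realType) (t t' y0 vinf : Cx R) (q1 q2 : Cx R * Cx R) (l1 l2 : Cx R).
Local Notation K := (Cx R).
Local Notation C := (curveC t t').
Local Notation E := (curveE t).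
Local Notation cov := (coverf t').
Local Notation om := (omega q1 q2 l1 l2).
Local Notation tau := (@loc_coord R 3).
Local Notation Cgen := (Cgen t t' q1 q2).
Local Notation dL := (divL q1 q2 vinf).
Local Notation lift := (lift t t').
Local Notation Et := (E_transport t t').
Local Notation A := (Epunct t t' y0).
Local Notation Pp := (Inf vinf : surf R 3).
Local Notation Pm := (Inf (- vinf) : surf R 3).
Hypotheses (y0E : y0 ^+ 2 = t' * (t' - 1) * (t' - t)) (vinfE : vinf ^+ 2 = -1).
Context (s : surf R 3 -> surf R 3 -> K).
Hypothesis sE : forall P, C P -> exists phi h W, sigma_spec t t' vinf q1 q2 l1 l2 s P phi h W.

(* The matrix of the paper, for the two points of C over a point of E and the
   values there of two branches of exp(- \int omega). *)
Definition Phi_at (z1 z2 : surf R 3 * K) : 'M[K]_2 :=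
  2^-1 *: mx22 (z1.2 + z2.2) (z1.2 - z2.2)
               (uco z1.1 * z1.2 + uco z2.1 * z2.2) (uco z1.1 * z1.2 - uco z2.1 * z2.2).

(** The right factor is [diag(m1, m2)] rewritten in the basis of the sum and the difference of the
    two branches. *)
Lemma Phi_at_diag z1 z2 m1 m2 :
  Phi_at z1 z2 *m (2^-1 *: mx22 (m1 + m2) (m1 - m2) (m1 - m2) (m1 + m2)) =
  Phi_at (z1.1, m1 * z1.2) (z2.1, m2 * z2.2).
Proof.
apply/matrixP => i j; rewrite mulmx2E /Phi_at !scale_mx22 /=.
have n2 := two_neq0 R.
by case: (i == 0); case: (j == 0); field.
Qed.

(** With [uco] of both points in the second row, the first column is symmetric in the two arguments
    and the second antisymmetric. *)
Lemma Phi_at_swap z1 z2 : Phi_at z1 z2 *m mx22 1 0 0 (-1) = Phi_at z2 z1.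
Proof.
apply/matrixP => i j; rewrite mulmx2E !mxE /=.
by case: (i == 0); case: (j == 0); ring.
Qed.

Lemma uco_iota Q : uco (iotaC Q) = - uco Q :> K.
Proof. by case: Q => [x y|v] /=; rewrite ?invrN ?oppr0. Qed.

Lemma Phi_at_unit P e1 e2 : uco P != 0 -> e1 != 0 -> e2 != 0 ->
  Phi_at (P, e1) (iotaC P, e2) \in unitmx.
Proof.
move=> u0 e10 e20; rewrite unitmxE det_mx2 !mxE /= uco_iota unitfE.
have n2 := two_neq0 R.
rewrite (_ : _ - _ = uco P * e1 * e2); last by field.
by rewrite !mulf_neq0.
Qed.

(** As a section of L upstairs, each column is the branch [e1] on the first sheet and, by
    [upstairs_r], plus or minus [e2] on the second; hence it is horizontal. *)
Lemma upstairs_l (S : surf R 2 -> 'M[K]_2) j P e1 e2 : xco P != 0 ->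
  S (cov P) = Phi_at (P, e1) (iotaC P, e2) -> upstairs t' (fun p => col j (S p)) P = e1.
Proof.
case: P => [x y|v] /= x0; last by rewrite eqxx in x0.
rewrite /upstairs => SE; rewrite !mxE SE !mxE /=.
have n2 := two_neq0 R.
by case: (j == 0); field; rewrite ?oppr_eq0 ?n2 ?x0.
Qed.

Lemma upstairs_r (S : surf R 2 -> 'M[K]_2) j P e1 e2 : xco P != 0 ->
  S (cov P) = Phi_at (iotaC P, e1) (P, e2) ->
  upstairs t' (fun p => col j (S p)) P = (-1) ^+ j * e2.
Proof.
case: P => [x y|v] /= x0; last by rewrite eqxx in x0.
rewrite /upstairs => SE; rewrite !mxE SE !mxE /=.
have n2 := two_neq0 R.
case: j => -[|[|//]] /= jj; rewrite ?expr0 ?expr1; by [field; rewrite ?oppr_eq0 ?n2 ?x0].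
Qed.

Local Notation Phi0 k := (fun q => Phi_at (Et s (infE R) q (Pp, 1)) (Et s (infE R) q (Pm, k))).

Lemma E_cocycle p y : E_fiber t t' p y -> (forall P, C P -> cov P = p -> unramified P) ->
  \forall q \near p, E q -> \forall q' \near q, E q' -> Et s q q' (Et s p q y) = Et s p q' y.
Proof.
case: y => P c [/= CP eP c0] up; have := E_system_near vinfE sE CP (up P CP eP); rewrite eP.
apply: filterS => q H Eq; have [CQ eQ s0 _ N] := H Eq.
by apply: filterS N => q' k Eq'; rewrite /E_transport /=; have [-> <-] := k Eq'; rewrite mulrA.
Qed.

Lemma Phi_at_meromorphic p z1 z2 i j : E_fiber t t' p z1 -> E_fiber t t' p z2 ->
  (forall P, C P -> cov P = p -> unramified P) ->
  meromorphic_at E (fun q => Phi_at (Et s p q z1) (Et s p q z2) i j) p.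
Proof.
case: z1 z2 => [P1 c1] [P2 c2] [/= C1 e1 _] [/= C2 e2 _] up.
(* Each entry mixes two branches whose pole orders may differ. *)
pose m := Order.min (- dL P1) (- dL P2).
have m1 : m <= - dL P1 by rewrite /m ge_min lexx.
have m2 : m <= - dL P2 by rewrite /m ge_min lexx orbT.
have B1 := branch_ord vinfE sE (2^-1 * c1) (i != 0) C1 (up P1 C1 e1) m1.
have B2 := branch_ord vinfE sE (2^-1 * ((if j == 0 then 1 else -1) * c2)) (i != 0) C2 (up P2 C2 e2) m2.
rewrite e1 in B1; rewrite e2 in B2; exists m.
have := ord_geD B1 B2; congr (ord_ge _ _ _ _); apply/funext => q.
rewrite /Phi_at scale_mx22 /E_transport /=.
by case: (i == 0); case: (j == 0) => /=; ring.
Qed.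

Lemma monodromy_flat k (g : R -> surf R 2) (M : 'M[K]_2) z1 z2 :
  loop_in A (infE R) g ->
  transport (E_fiber t t') (Et s) g (Pp, 1) z1 ->
  transport (E_fiber t t') (Et s) g (Pm, k) z2 ->
  (forall q, Phi_at (Et s (infE R) q z1) (Et s (infE R) q z2) = Phi0 k q *m M) ->
  monodromy E g (Phi0 k) M.
Proof.
move=> gl [Y1 [f1 b1 e1]] [Y2 [f2 b2 e2]] H; have [_ g0 g1 gA] := gl; have gc := path_in_cont gl.
have up r : I01 r -> forall P, C P -> cov P = g r -> unramified P.
  by move=> Ir P CP e; apply: (Epunct_unramified y0E CP); rewrite e; exact: gA.
exists (fun r q => Phi_at (Et s (g r) q (Y1 r)) (Et s (g r) q (Y2 r))); split.
- move=> r Ir i j; apply: Phi_at_meromorphic; [exact: (f1 r Ir).1|exact: (f2 r Ir).1|exact: up].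
- by rewrite g0 b1 b2; exact: (filterS (fun Q _ _ => erefl) filterT).
- by rewrite g1 e1 e2; exact: (filterS (fun Q _ _ => H Q) filterT).
- move=> r Ir; have [F1 N1] := f1 r Ir; have [F2 N2] := f2 r Ir.
  have K1 := gc r Ir _ (E_cocycle F1 (up r Ir)); have K2 := gc r Ir _ (E_cocycle F2 (up r Ir)).
  have N : \forall r' \near r, I01 r' -> \forall Q \near g r', E Q ->
      Phi_at (Et s (g r') Q (Y1 r')) (Et s (g r') Q (Y2 r')) =
      Phi_at (Et s (g r) Q (Y1 r)) (Et s (g r) Q (Y2 r)).
    apply: filterS2 (filterI N1 N2) (filterI K1 K2) => r' [n1 n2] [k1 k2] Ir'.
    have Er' : E (g r') by case: (gA r' Ir').
    apply: filterS2 (k1 Ir' Er') (k2 Ir' Er') => Q h1 h2 EQ.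
    by rewrite (n1 Ir') (n2 Ir') (h1 EQ) (h2 EQ).
  apply: filterS N => r' n Ir'; apply: near_punctured.
  by apply: filterS (n Ir') => Q n' _; exact: n'.
Qed.

Lemma monodromy_fixes k g m1 m2 : loop_in A (infE R) g -> fixes t t' vinf s k m1 m2 g ->
  monodromy E g (Phi0 k) (2^-1 *: mx22 (m1 + m2) (m1 - m2) (m1 - m2) (m1 + m2)).
Proof.
move=> gl [T1 T2]; apply: (monodromy_flat gl T1 T2) => q.
by rewrite Phi_at_diag /E_transport /= mul1r mulrA.
Qed.

Lemma monodromy_swaps k g : loop_in A (infE R) g -> swaps t t' vinf s k g ->
  monodromy E g (Phi0 k) (mx22 1 0 0 (-1)).
Proof.
by move=> gl [T1 T2]; apply: (monodromy_flat gl T1 T2) => q; rewrite Phi_at_swap.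
Qed.

Lemma near_inf (v : K) : C (Inf v) -> \forall P \near (Inf v : surf R 3), C P -> P != Inf v ->
  [/\ Cgen P, xco P != 0, lift (Inf v) (cov P) = P, lift (Inf (- v)) (cov P) = iotaC P
    & s (Inf v) P != 0].
Proof.
move=> Cv; have uv : unramified (Inf v : surf R 3) by [].
apply: filterS2 (filterI (near_Cgen sE Cv) (sigma_neq0 sE Cv))
  (filterI (sheet_near uv) (unramified_near uv)) => P [g n] [sh u] CP Pv.
have gP := g CP Pv; split=> //.
- case: P {g n sh CP Pv} u gP => [x y|w] u [_ /= y0n _ _]; last by rewrite eqxx in y0n.
  by apply/eqP => e; apply: (u y); rewrite e.
- exact: lift_eq.
- rewrite -[cov P]cov_iota; apply: lift_eq; [exact: (@curve_iota _ _ _ (Inf v))|exact: curve_iota|].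
  by apply: (@sheet_iota _ (Inf v : surf R 3)); rewrite iotaK.
- exact: n.
Qed.

Let CPp : C Pp. Proof. by rewrite /= polyC2_coef vinfE. Qed.
Let CPm : C Pm. Proof. by rewrite /= polyC2_coef sqrrN vinfE. Qed.

Lemma Phi0_near k : \forall P \near Pp, C P -> P != Pp ->
  Phi0 k (cov P) = Phi_at (P, s Pp P) (iotaC P, k * s Pm (iotaC P)).
Proof.
apply: filterS (near_inf CPp) => P H CP PP; have [_ _ e1 e2 _] := H CP PP.
by rewrite /E_transport /= e1 e2 mul1r.
Qed.

Lemma Phi0_near' k : \forall P \near Pm, C P -> P != Pm ->
  Phi0 k (cov P) = Phi_at (iotaC P, s Pp (iotaC P)) (P, k * s Pm P).
Proof.
apply: filterS (near_inf CPm) => P H CP PP; have [_ _ e1 e2 _] := H CP PP.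
by rewrite opprK in e2; rewrite /E_transport /= e1 e2 mul1r.
Qed.

Lemma Phi0_upstairs k j (b : bool) : let P0 := if b then Pp else Pm in
  \forall P \near P0, C P -> P != P0 ->
  upstairs t' (fun p => col j (Phi0 k p)) P = (if b then 1 else (-1) ^+ j * k) * s P0 P.
Proof.
case: b => /=.
  apply: filterS2 (near_inf CPp) (Phi0_near k) => P h1 h2 CP PP.
  have [_ x0 _ _ _] := h1 CP PP.
  by rewrite (upstairs_l (S := Phi0 k) j x0 (h2 CP PP)) mul1r.
apply: filterS2 (near_inf CPm) (Phi0_near' k) => P h1 h2 CP PP.
have [_ x0 _ _ _] := h1 CP PP.
by rewrite (upstairs_r (S := Phi0 k) j x0 (h2 CP PP)) mulrA.
Qed.

Lemma Phi0_section k j : sectionE t t' vinf q1 q2 (fun p => col j (Phi0 k p)) (infE R).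
Proof.
have ext P0 c : C P0 -> (\forall P \near P0, C P -> P != P0 ->
    upstairs t' (fun p => col j (Phi0 k p)) P = c * s P0 P) ->
    ord_ge C (upstairs t' (fun p => col j (Phi0 k p))) (- dL P0) P0.
  move=> CP0 N; have [G hG GE] := sigma_ord sE c CP0; exists G => //.
  have N' : \forall P \near P0^', C P -> upstairs t' (fun p => col j (Phi0 k p)) P = c * s P0 P.
    by apply: near_punctured; apply: filterS N => P h PP CP; exact: h.
  by apply: filterS2 GE N' => P g n CP; rewrite n // g.
move=> P CP /(inf_points vinfE CP)[] ->.
- exact: ext CPp (Phi0_upstairs k j true).
- exact: ext CPm (Phi0_upstairs k j false).
Qed.

Lemma near_neq_inf (P : surf R 3) v : yco P != 0 -> \forall P' \near P, P' != Inf v.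
Proof.
case: P => [x y|w] y0n; last by rewrite eqxx in y0n.
by apply/nbhs_aff; apply: filterS filterT => p _; apply/eqP.
Qed.

Lemma Phi0_nabla k j (b : bool) : k != 0 -> let P0 := if b then Pp else Pm in
  \forall P \near P0, C P -> P != P0 ->
  nablaL t t' om (upstairs t' (fun p => col j (Phi0 k p))) P 0.
Proof.
move=> k0; set P0 := if b then Pp else Pm => /=.
have CP0 : C P0 by rewrite /P0; case b.
pose c : K := if b then 1 else (-1) ^+ j * k.
have c0 : c != 0 by rewrite /c; case b; [exact: oner_neq0|rewrite mulf_neq0 // signr_eq0].
have [v vE] : exists v, P0 = Inf v by rewrite /P0; case b; [exists vinf|exists (- vinf)].
apply: filterS3 (sigma_log sE CP0 c0) (near_join (Phi0_upstairs k j b))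
  (near_Cgen sE CP0) => P h1 h2 h3 CP PP.
have [_ yn _ _] := h3 CP PP.
have N : \forall P' \near P, C P' -> c * s P0 P' = upstairs t' (fun p => col j (Phi0 k p)) P'.
  have N1 := @near_neq_inf P v yn; rewrite -vE in N1.
  by apply: filterS2 N1 h2 => P' n h CP'; rewrite h.
rewrite /nablaL -(nbhs_singleton N CP).
exact: has_deriv_ext N CP (log_nabla CP (h1 CP PP)).
Qed.

Lemma Phi0_unit k : k != 0 -> \forall P \near Pp, C P -> P != Pp -> Phi0 k (cov P) \in unitmx.
Proof.
move=> k0; have Niota : \forall P \near Pp, C P -> P != Pp -> s Pm (iotaC P) != 0.
  have N := @iota_near R Pp _ (near_inf CPm).
  apply: filterS N => P H CP PP; have [] // := H (curve_iota CP).
  by apply: contraNneq PP => e; rewrite -(iotaK P) e /= opprK.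
apply: filterS3 (near_inf CPp) (Phi0_near k) Niota => P h1 h2 h3 CP PP.
have [_ x0 _ _ s0] := h1 CP PP; rewrite (h2 CP PP).
apply: Phi_at_unit => //; last by rewrite mulf_neq0 // h3.
by case: P x0 {h1 h2 h3 CP PP s0} => [x y|w] /= x0; [rewrite invr_eq0|rewrite eqxx in x0].
Qed.

Lemma Phi0_fundamental k : k != 0 ->
  fundamental_matrix t t' vinf q1 q2 om (Phi0 k) (infE R).
Proof.
move=> k0; split=> [j|]; first exact: Phi0_section.
(* [V] gathers the requirements at [P] and at [iotaC P]. A single neighbourhood of the first point
   at infinity then controls, through [cov_open], both points of each nearby fibre. *)
pose V P := (C P -> P != Pp -> Phi0 k (cov P) \in unitmx /\
    forall j, nablaL t t' om (upstairs t' (fun p => col j (Phi0 k p))) P 0) /\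
  (C (iotaC P) -> iotaC P != Pm ->
    forall j, nablaL t t' om (upstairs t' (fun p => col j (Phi0 k p))) (iotaC P) 0).
have NV : nbhs Pp V.
  have a1 := Phi0_nabla 0 true k0; have a2 := Phi0_nabla 1 true k0.
  have b1 := iota_near (P := Pp) (Phi0_nabla 0 false k0).
  have b2 := iota_near (P := Pp) (Phi0_nabla 1 false k0).
  have j01 (j : 'I_2) : j = 0 \/ j = 1.
    by case: j => -[|[|//]] jj; [left|right]; exact/val_inj.
  apply: filterS3 (Phi0_unit k0) (filterI a1 a2) (filterI b1 b2) => P u [A1 A2] [B1 B2].
  split=> [CP PP|CP PP j]; last by case: (j01 j) => ->; [exact: B1|exact: B2].
  by split=> [|j]; [exact: u|case: (j01 j) => ->; [exact: A1|exact: A2]].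
apply: near_punctured; apply: filterS (cov_open CPp NV) => p Hp pinf Ep.
have ne P v : cov P = p -> P != Inf v by move=> e; apply: contraNneq pinf => P'; rewrite -e P'.
have ci P : cov P = p -> cov (iotaC P) = p by rewrite cov_iota.
split=> [|j P CP eP].
  have [P CP eP] := cov_surj t' vinfE Ep; rewrite -eP.
  have CP' := curve_iota CP; have eP' := ci P eP.
  case: (Hp P CP eP) => -[h _]; first by have [] := h CP (ne _ _ eP).
  by have [] := h CP' (ne _ _ eP'); rewrite cov_iota.
rewrite !mxE mulr0 addr0 mul0r.
case: (Hp P CP eP) => -[h1 h2]; first by have [_ X] := h1 CP (ne _ _ eP); exact: X.
by rewrite iotaK in h2; exact: h2 CP (ne _ _ eP) j.
Qed.

Lemma Phi0_form k : Phi_form t t' vinf (s Pp) (fun Q => k * s Pm (iotaC Q)) (Phi0 k).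
Proof.
apply: near_punctured; apply: filterS2 (near_inf CPp) (Phi0_near k) => P h1 h2 PP CP; rewrite (h2 CP PP).
have [_ x0 _ _ _] := h1 CP PP.
have uE : uco P = (xco P)^-1 by case: P x0 {h1 h2 CP PP} => [//|w] /=; rewrite eqxx.
(* The coordinate [u] changes sign under the involution, which exchanges sum and difference in the
   second row. *)
rewrite /Phi_at /= uco_iota uE; congr (_ *: mx22 _ _ _ _); ring.
Qed.

Lemma Phi0_exp_int k : k != 0 -> exp_int t t' om (s Pp) Pp /\
  exp_int t t' (iota_pull om) (fun Q => k * s Pm (iotaC Q)) Pp.
Proof.
move=> k0; have H1 := sigma_log sE CPp (oner_neq0 K).
have e1 : (fun Q => 1 * s Pp Q) = s Pp by apply/funext => Q; rewrite mul1r.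
rewrite e1 in H1; split; first exact: log_exp_int H1.
exact: (log_exp_int_iota (P := Pp) (sigma_log sE CPm k0) H1).
Qed.

End Fundamental.

Theorem proposition9 (R : realType) (t t' y0 vinf : Cx R)
    (q1 q2 : Cx R * Cx R) (l1 l2 : Cx R)
    (a b g1 g2 : R -> surf R 2) (a1 b1 a2 b2 : R -> surf R 3)
    (N1 N2 N3 N4 : Cx R)
    (t_neq0 : t != 0) (t_neq1 : t != 1)
    (t'_neq0 : t' != 0) (t'_neq1 : t' != 1) (t_neq_t' : t != t')
    (y0E : y0 ^+ 2 = t' * (t' - 1) * (t' - t))
    (vinfE : vinf ^+ 2 = -1)
    (q1C : curveC t t' (Aff q1.1 q1.2)) (q1_neq0 : q1.1 != 0)
    (q2C : curveC t t' (Aff q2.1 q2.2)) (q2_neq0 : q2.1 != 0)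
    (loops : loop_system t t' y0 vinf q1 q2 a b g1 g2 a1 b1 a2 b2)
    (N1E : is_period t t' q1 q2 l1 l2 a1 N1)
    (N2E : is_period t t' q1 q2 l1 l2 a2 N2)
    (N3E : is_period t t' q1 q2 l1 l2 b1 N3)
    (N4E : is_period t t' q1 q2 l1 l2 b2 N4) :
  exists (e1 e2 : surf R 3 -> Cx R) (Phi : surf R 2 -> 'M[Cx R]_2),
    [/\ exp_int t t' (omega q1 q2 l1 l2) e1 (Inf vinf),
        exp_int t t' (iota_pull (omega q1 q2 l1 l2)) e2 (Inf vinf),
        Phi_form t t' vinf e1 e2 Phi
      & fundamental_matrix t t' vinf q1 q2 (omega q1 q2 l1 l2) Phi (infE R)]
    /\
    [/\ monodromy (curveE t) a Phi
          (2^-1 *: mx22 (Cexp (- N1) + Cexp (- N2)) (Cexp (- N1) - Cexp (- N2))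
                        (Cexp (- N1) - Cexp (- N2)) (Cexp (- N1) + Cexp (- N2))),
        monodromy (curveE t) b Phi
          (2^-1 *: mx22 (Cexp (- N3) + Cexp (- N4)) (Cexp (- N3) - Cexp (- N4))
                        (Cexp (- N3) - Cexp (- N4)) (Cexp (- N3) + Cexp (- N4))),
        monodromy (curveE t) g1 Phi (mx22 1 0 0 (-1))
      & monodromy (curveE t) g2 Phi (mx22 1 0 0 (-1))].
Proof.
have [s sE] := sigma_exists l1 l2 t_neq0 t_neq1 t'_neq0 t'_neq1 t_neq_t' vinfE q1C q2C.
have dl c (Hc : [set a; b; g1; g2] c) := ls_downstairs loops Hc.
have ul c (Hc : [set a1; b1; a2; b2] c) := ls_upstairs loops Hc.
have al : loop_in (Epunct t t' y0) (infE R) a by apply: dl; do 3!left.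
have bl : loop_in (Epunct t t' y0) (infE R) b by apply: dl; do 2!left; right.
have g1l : loop_in (Epunct t t' y0) (infE R) g1 by apply: dl; left; right.
have g2l : loop_in (Epunct t t' y0) (infE R) g2 by apply: dl; right.
have a1l : loop_in (Cpunct t t' y0) (Inf vinf) a1 by apply: ul; do 3!left.
have b1l : loop_in (Cpunct t t' y0) (Inf vinf) b1 by apply: ul; do 2!left; right.
have a2l : loop_in (Cpunct t t' y0) (Inf vinf) a2 by apply: ul; left; right.
have b2l : loop_in (Cpunct t t' y0) (Inf vinf) b2 by apply: ul; right.
have [k k0 sw1] := simple_loop_swaps y0E vinfE sE (p := (t', y0)) erefl g1l (ls_g1 loops).
have fa := period_fixes y0E vinfE sE k0 al g1l sw1 a1l a2l N1E N2E (ls_a1 loops) (ls_a2 loops).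
have fb := period_fixes y0E vinfE sE k0 bl g1l sw1 b1l b2l N3E N4E (ls_b1 loops) (ls_b2 loops).
have fc := comm_fixes al bl (Cexp_neq0 _) (Cexp_neq0 _) (Cexp_neq0 _) (Cexp_neq0 _) fa fb.
have c1 : pcomm a b 1 = infE R by have [_ b0 _ _] := bl; rewrite /pcomm pcat1 /path_rev subrr.
have sw2 := relation_swaps y0E vinfE sE k0 c1 g1l g2l fc sw1 (ls_relation loops).
have [ee1 ee2] := Phi0_exp_int vinfE sE k0.
have Ff := Phi0_fundamental vinfE sE k0.
have Fo := Phi0_form vinfE sE k.
eexists; eexists; eexists; split; first by split; [exact: ee1|exact: ee2|exact: Fo|exact: Ff].
split.
- exact: (monodromy_fixes y0E vinfE sE al fa).
- exact: (monodromy_fixes y0E vinfE sE bl fb).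
- exact: (monodromy_swaps y0E vinfE sE g1l sw1).
- exact: (monodromy_swaps y0E vinfE sE g2l sw2).
Qed.
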